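(* Let $x_1,x_2$ be two distinct points of $\mathbb{S}^2$. Then $$(B_3(\mathbb{S}^2\setminus\{x_1,x_2\}))^{(1)}/(B_3(\mathbb{S}^2\setminus\{x_1,x_2\}))^{(2)}\cong\mathbb{Z}^4.$$
   Context: For a surface $M$, $F_m(M)=\{(y_1,\ldots,y_m)\in M^m: y_i\neq y_j\text{ if }i\neq j\}$, and $B_m(M)=\pi_1(F_m(M)/S_m)$ is the $m$-string braid group of $M$. Derived series: $G^{(0)}=G$, $G^{(i)}=[G^{(i-1)},G^{(i-1)}]$. *)

(* Defs.v *)
From HB Require Import structures.
From mathcomp Require Import all_boot all_order all_algebra perm.
From mathcomp Require Import all_classical all_reals all_analysis.
From mathcomp Require Import homotopy lra.

Set Implicit Arguments.
Unset Strict Implicit.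
Unset Printing Implicit Defensive.

Import Order.TTheory GRing.Theory Num.Theory.
Import numFieldNormedType.Exports.

Local Open Scope classical_set_scope.
Local Open Scope ring_scope.
Local Open Scope quotient_scope.

Lemma continuous_funcomp (X Y Z : topologicalType) (f : X -> Y) (g : Y -> Z) :
  continuous f -> continuous g -> continuous (fun x => g (f x)).
Proof. by move=> cf cg x; apply: continuous_comp; [exact: cf | exact: cg]. Qed.

Lemma continuous_pair (X Y Z : topologicalType) (f : X -> Y) (g : X -> Z) :
  continuous f -> continuous g -> continuous (fun x => (f x, g x)).
Proof. by move=> cf cg x; apply: cvg_pair; [exact: cf | exact: cg]. Qed.

Lemma continuous_fst (X Y : topologicalType) : continuous (@fst X Y).
Proof. by move=> u; exact: cvg_fst. Qed.

Lemma continuous_snd (X Y : topologicalType) : continuous (@snd X Y).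
Proof. by move=> u; exact: cvg_snd. Qed.

Section UnitInterval.
Variable R : realType.

Definition unitI : Type := set_type (`[0, 1]%classic : set R).

HB.instance Definition _ := Topological.on unitI.

Definition unitI_val (t : unitI) : R := set_val t.

Lemma unitI_val_itv (t : unitI) : 0 <= unitI_val t <= 1.
Proof. by have := set_mem (valP t); rewrite /= in_itv. Qed.

Lemma unitI_val_inj : injective unitI_val.
Proof. exact: val_inj. Qed.

Lemma unitI_val_continuous : continuous unitI_val.
Proof. exact: initial_continuous. Qed.

Lemma clamp_subproof (t : R) :
  Num.max 0 (Num.min 1 t) \in (`[0, 1]%classic : set R).
Proof. by rewrite inE /= in_itv /= le_max lexx /= ge_max ler01 ge_min lexx. Qed.

(* The retraction of R onto [0, 1]. *)
Definition clamp (t : R) : unitI := SigSub (clamp_subproof t).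

Lemma clampE (t : R) : 0 <= t <= 1 -> unitI_val (clamp t) = t.
Proof.
by case/andP=> t0 t1; rewrite /unitI_val set_valE /= min_r // max_r.
Qed.

Lemma clamp_val (t : unitI) : clamp (unitI_val t) = t.
Proof. by apply: unitI_val_inj; rewrite clampE ?unitI_val_itv. Qed.

Lemma clamp_continuous : continuous clamp.
Proof.
apply: continuous_comp_initial => t.
apply: (@continuous_max R R (cst 0) (fun t => Num.min 1 t)).
  exact: cvg_cst.
by apply: (@continuous_min R R (cst 1) id); [exact: cvg_cst | exact: cvg_id].
Qed.

Lemma unitI_neq : clamp 0 != clamp 1.
Proof.
apply/eqP => /(congr1 unitI_val).
by rewrite !clampE ?lexx ?ler01 // => /eqP; rewrite eq_sym oner_eq0.
Qed.

HB.instance Definition _ := isBiPointed.Build unitI unitI_neq.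

Lemma unitI_val0 : unitI_val zero = 0.
Proof. by rewrite clampE ?lexx ?ler01. Qed.

Lemma unitI_val1 : unitI_val one = 1.
Proof. by rewrite clampE ?lexx ?ler01. Qed.

Lemma paste_continuous (X T : topologicalType) (c : X -> R) (a : R)
    (f g : X -> T) :
  continuous c -> continuous f -> continuous g ->
  (forall x, c x = a -> f x = g x) ->
  continuous (fun x => if c x <= a then f x else g x).
Proof.
move=> cc cf cg fg; apply/continuous_subspace_setT.
have -> : [set: X] = (c @^-1` [set x | x <= a]) `|` (c @^-1` [set x | a <= x]).
  by apply/seteqP; split=> x //= _; case: (leP (c x) a); [left | right; exact: ltW].
apply: withinU_continuous.
- by apply: preimage_closed => //; exact: closed_le.
- by apply: preimage_closed => //; exact: closed_ge.
- apply: (@subspace_eq_continuous _ _ _ f); last exact: continuous_subspaceT.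
  by move=> x; rewrite inE /= /from_subspace => ->.
- apply: (@subspace_eq_continuous _ _ _ g); last exact: continuous_subspaceT.
  move=> x; rewrite inE /= /from_subspace => ax; case: ifP => // xa.
  by rewrite fg //; apply/eqP; rewrite eq_le xa.
Qed.

End UnitInterval.

Section Paths.
Variables (R : realType) (T : topologicalType).
Local Notation I := (unitI R).

(* Homotopy relative to the endpoints. *)
Definition path_homotopic (x y : T) (p q : {path I from x to y in T}) : Prop :=
  exists H : I * I -> T,
    [/\ continuous H,
        forall t, H (t, zero) = p t,
        forall t, H (t, one) = q t
      & forall s, H (zero, s) = x /\ H (one, s) = y].

Definition path_cat_fun (x y z : T) (p : {path I from x to y in T})
    (q : {path I from y to z in T}) (t : I) : T :=
  if unitI_val t <= 2^-1 then p (clamp (2 * unitI_val t))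
  else q (clamp (2 * unitI_val t - 1)).

Definition path_rev_fun (x y : T) (p : {path I from x to y in T}) (t : I) : T :=
  p (clamp (1 - unitI_val t)).

Let clamp_funcomp_continuous (f : R -> R) :
  continuous f -> continuous (fun t : I => clamp (f (unitI_val t)) : I).
Proof.
move=> cf; apply: (@continuous_funcomp I R I); last exact: clamp_continuous.
by apply: (@continuous_funcomp I R R _ f) => //; exact: unitI_val_continuous.
Qed.

Let dbl_continuous : continuous (fun t : I => clamp (2 * unitI_val t) : I).
Proof.
apply: (clamp_funcomp_continuous (f := fun t => 2 * t)) => t.
by apply: cvgM; [exact: cvg_cst | exact: cvg_id].
Qed.

Let dbl1_continuous : continuous (fun t : I => clamp (2 * unitI_val t - 1) : I).
Proof.
apply: (clamp_funcomp_continuous (f := fun t => 2 * t - 1)) => t.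
by apply: cvgB; [apply: cvgM; [exact: cvg_cst | exact: cvg_id] | exact: cvg_cst].
Qed.

Let opp_continuous : continuous (fun t : I => clamp (1 - unitI_val t) : I).
Proof.
apply: (clamp_funcomp_continuous (f := fun t => 1 - t)) => t.
by apply: cvgB; [exact: cvg_cst | exact: cvg_id].
Qed.

Section Cat.
Variables (x y z : T).
Variables (p : {path I from x to y in T}) (q : {path I from y to z in T}).

Lemma path_cat_continuous : continuous (path_cat_fun p q).
Proof.
apply: (@paste_continuous R I T _ _ (fun t => p (clamp (2 * unitI_val t)))
                                   (fun t => q (clamp (2 * unitI_val t - 1)))).
- exact: unitI_val_continuous.
- by apply: (@continuous_funcomp I I T _ p);
    [exact: dbl_continuous | exact: cts_fun].
- by apply: (@continuous_funcomp I I T _ q);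
    [exact: dbl1_continuous | exact: cts_fun].
- move=> t /= ->; rewrite divff ?pnatr_eq0 // subrr.
  by rewrite -[clamp 1]/one -[clamp 0]/zero path_one path_zero.
Qed.

Lemma path_cat_zero : path_cat_fun p q zero = x.
Proof.
by rewrite /path_cat_fun unitI_val0 invr_ge0 ler0n mulr0 [LHS]path_zero.
Qed.

Lemma path_cat_one : path_cat_fun p q one = z.
Proof.
rewrite /path_cat_fun unitI_val1 ifF; last by apply/negbTE; rewrite -ltNge; lra.
by rewrite (_ : 2 * 1 - 1 = 1 :> R); [rewrite [LHS]path_one | lra].
Qed.

Definition path_cat : {path I from x to z in T} :=
  mk_path path_cat_continuous path_cat_zero path_cat_one.

End Cat.

Section Rev.
Variables (x y : T) (p : {path I from x to y in T}).

Lemma path_rev_continuous : continuous (path_rev_fun p).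
Proof.
by apply: (@continuous_funcomp I I T _ p);
  [exact: opp_continuous | exact: cts_fun].
Qed.

Lemma path_rev_zero : path_rev_fun p zero = y.
Proof. by rewrite /path_rev_fun unitI_val0 subr0 [LHS]path_one. Qed.

Lemma path_rev_one : path_rev_fun p one = x.
Proof. by rewrite /path_rev_fun unitI_val1 subrr [LHS]path_zero. Qed.

Definition path_rev : {path I from y to x in T} :=
  mk_path path_rev_continuous path_rev_zero path_rev_one.

End Rev.

Definition path_cst (x : T) : {path I from x to x in T} := cst x.

Lemma path_homotopic_refl (x y : T) (p : {path I from x to y in T}) :
  path_homotopic p p.
Proof.
exists (p \o fst); split=> //=; last by move=> s; rewrite path_zero path_one.
by apply: (@continuous_funcomp (I * I)%type I T _ p);
  [exact: continuous_fst | exact: cts_fun].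
Qed.

Lemma path_homotopic_sym (x y : T) (p q : {path I from x to y in T}) :
  path_homotopic p q -> path_homotopic q p.
Proof.
case=> H [cH H0 H1 Hb].
exists (fun u => H (u.1, clamp (1 - unitI_val u.2))); split=> /=.
- apply: (@continuous_funcomp _ (I * I)%type _
    (fun u => (u.1, clamp (1 - unitI_val u.2))) H);
    last exact: cH.
  apply: continuous_pair; first exact: continuous_fst.
  exact: (continuous_funcomp (@continuous_snd _ _) opp_continuous).
- by move=> t; rewrite unitI_val0 subr0 [LHS]H1.
- by move=> t; rewrite unitI_val1 subrr [LHS]H0.
- by move=> s; exact: Hb.
Qed.

Lemma path_homotopic_trans (x y : T) (p q r : {path I from x to y in T}) :
  path_homotopic p q -> path_homotopic q r -> path_homotopic p r.
Proof.
case=> H [cH H0 H1 Hb] [K [cK K0 K1 Kb]].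
exists (fun u => if unitI_val u.2 <= 2^-1
                 then H (u.1, clamp (2 * unitI_val u.2))
                 else K (u.1, clamp (2 * unitI_val u.2 - 1))); split=> /=.
- apply: (@paste_continuous _ _ _ (fun u : I * I => unitI_val u.2)).
  + apply: continuous_funcomp; last exact: unitI_val_continuous.
    exact: continuous_snd.
  + apply: (@continuous_funcomp _ (I * I)%type _
      (fun u => (u.1, clamp (2 * unitI_val u.2))) H);
      last exact: cH.
    apply: continuous_pair; first exact: continuous_fst.
    exact: (continuous_funcomp (@continuous_snd _ _) dbl_continuous).
  + apply: (@continuous_funcomp _ (I * I)%type _
      (fun u => (u.1, clamp (2 * unitI_val u.2 - 1))) K);
      last exact: cK.
    apply: continuous_pair; first exact: continuous_fst.
    exact: (continuous_funcomp (@continuous_snd _ _) dbl1_continuous).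
  + move=> u ->; rewrite divff ?pnatr_eq0 // subrr.
    by rewrite [LHS]H1 [RHS]K0.
- by move=> t; rewrite unitI_val0 invr_ge0 ler0n mulr0 [LHS]H0.
- move=> t; rewrite unitI_val1 ifF; last by apply/negbTE; rewrite -ltNge; lra.
  by rewrite (_ : 2 * 1 - 1 = 1 :> R); [rewrite [LHS]K1 | lra].
- by move=> s; case: ifP => _; [exact: Hb | exact: Kb].
Qed.

Lemma path_cat_homotopic (x y z : T) (p p' : {path I from x to y in T})
    (q q' : {path I from y to z in T}) :
  path_homotopic p p' -> path_homotopic q q' ->
  path_homotopic (path_cat p q) (path_cat p' q').
Proof.
case=> H [cH H0 H1 Hb] [K [cK K0 K1 Kb]].
exists (fun u => if unitI_val u.1 <= 2^-1
                 then H (clamp (2 * unitI_val u.1), u.2)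
                 else K (clamp (2 * unitI_val u.1 - 1), u.2)); split=> /=.
- apply: (@paste_continuous _ _ _ (fun u : I * I => unitI_val u.1)).
  + apply: continuous_funcomp; last exact: unitI_val_continuous.
    exact: continuous_fst.
  + apply: (@continuous_funcomp _ (I * I)%type _
      (fun u => (clamp (2 * unitI_val u.1), u.2)) H);
      last exact: cH.
    apply: continuous_pair; last exact: continuous_snd.
    exact: (continuous_funcomp (@continuous_fst _ _) dbl_continuous).
  + apply: (@continuous_funcomp _ (I * I)%type _
      (fun u => (clamp (2 * unitI_val u.1 - 1), u.2)) K);
      last exact: cK.
    apply: continuous_pair; last exact: continuous_snd.
    exact: (continuous_funcomp (@continuous_fst _ _) dbl1_continuous).
  + move=> u ->; rewrite divff ?pnatr_eq0 // subrr.
    by rewrite [LHS](Hb _).2 [RHS](Kb _).1.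
- by move=> t; rewrite H0 K0.
- by move=> t; rewrite H1 K1.
- move=> s; rewrite unitI_val0 invr_ge0 ler0n mulr0 [H _](Hb _).1.
  split=> //; rewrite unitI_val1 ifF; last by apply/negbTE; rewrite -ltNge; lra.
  by rewrite (_ : 2 * 1 - 1 = 1 :> R); [rewrite [LHS](Kb _).2 | lra].
Qed.

Lemma path_rev_homotopic (x y : T) (p p' : {path I from x to y in T}) :
  path_homotopic p p' -> path_homotopic (path_rev p) (path_rev p').
Proof.
case=> H [cH H0 H1 Hb].
exists (fun u => H (clamp (1 - unitI_val u.1), u.2)); split=> /=.
- apply: (@continuous_funcomp _ (I * I)%type _
    (fun u => (clamp (1 - unitI_val u.1), u.2)) H);
    last exact: cH.
  apply: continuous_pair; last exact: continuous_snd.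
  exact: (continuous_funcomp (@continuous_fst _ _) opp_continuous).
- by move=> t; rewrite H0.
- by move=> t; rewrite H1.
- move=> s; rewrite unitI_val0 unitI_val1 subr0 subrr.
  by split; [rewrite [LHS](Hb _).2 | rewrite [LHS](Hb _).1].
Qed.

(* Two reparametrizations of the same path with the same endpoints are
   homotopic, by straight-line homotopy in the parameter. *)
Lemma path_reparam_homotopic (x y x' y' : T) (r : {path I from x' to y' in T})
    (f g : R -> R) (p q : {path I from x to y in T}) :
  continuous f -> continuous g ->
  f 0 = g 0 -> f 1 = g 1 ->
  (forall t, p t = r (clamp (f (unitI_val t)))) ->
  (forall t, q t = r (clamp (g (unitI_val t)))) ->
  path_homotopic p q.
Proof.
move=> cf cg fg0 fg1 pE qE.
exists (fun u => r (clamp ((1 - unitI_val u.2) * f (unitI_val u.1)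
                           + unitI_val u.2 * g (unitI_val u.1)))).
split=> /=.
- have c1 : continuous (fun u : I * I => unitI_val u.1).
    apply: continuous_funcomp; last exact: unitI_val_continuous.
    exact: continuous_fst.
  have c2 : continuous (fun u : I * I => unitI_val u.2).
    apply: continuous_funcomp; last exact: unitI_val_continuous.
    exact: continuous_snd.
  apply: (continuous_funcomp (g := r)); last exact: cts_fun.
  apply: (@continuous_funcomp _ R I _ (@clamp R)); last exact: clamp_continuous.
  move=> u; apply: cvgD; apply: cvgM.
  + by apply: cvgB; [exact: cvg_cst | exact: c2].
  + exact: (continuous_funcomp c1 cf).
  + exact: c2.
  + exact: (continuous_funcomp c1 cg).
- by move=> t; rewrite unitI_val0 subr0 mul1r mul0r addr0 pE.
- by move=> t; rewrite unitI_val1 subrr mul1r mul0r add0r qE.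
- move=> s; rewrite unitI_val0 unitI_val1 -fg0 -fg1 -!mulrDl subrK !mul1r.
  rewrite -unitI_val0 -pE -unitI_val1 -pE path_zero path_one //.
Qed.


Let min_fun_continuous (f g : R -> R) :
  continuous f -> continuous g -> continuous (fun t => Num.min (f t) (g t)).
Proof.
move=> cf cg t.
by apply: (@continuous_min R R f g); [exact: cf | exact: cg].
Qed.

Let max_fun_continuous (f g : R -> R) :
  continuous f -> continuous g -> continuous (fun t => Num.max (f t) (g t)).
Proof.
move=> cf cg t.
by apply: (@continuous_max R R f g); [exact: cf | exact: cg].
Qed.

Let affine_continuous (a b : R) : continuous (fun t : R => a * t + b).
Proof.
by move=> t; apply: cvgD; [apply: cvgM; [exact: cvg_cst | exact: cvg_id]
                          | exact: cvg_cst].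
Qed.

Let assoc_reparamE (u : R) :
  Num.min (2 * u + 0) (Num.min (1 * u + 4^-1) (2^-1 * u + 2^-1)) =
  if u <= 2^-1 then if u <= 4^-1 then 2 * u else u + 4^-1
  else 2^-1 * u + 2^-1.
Proof.
rewrite mul1r addr0; case: (leP (u + 4^-1) (2^-1 * u + 2^-1)) => h1.
  case: (leP (2 * u) (u + 4^-1)) => h2;
    case: (leP u 2^-1) => h3; case: (leP u 4^-1) => h4; lra.
case: (leP (2 * u) (2^-1 * u + 2^-1)) => h2;
  case: (leP u 2^-1) => h3; case: (leP u 4^-1) => h4; lra.
Qed.

Lemma path_catA (x y z w : T) (p : {path I from x to y in T})
    (q : {path I from y to z in T}) (r : {path I from z to w in T}) :
  path_homotopic (path_cat p (path_cat q r)) (path_cat (path_cat p q) r).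
Proof.
apply: (@path_reparam_homotopic _ _ _ _ (path_cat p (path_cat q r))
          (fun t => 1 * t + 0)
          (fun t => Num.min (2 * t + 0)
                      (Num.min (1 * t + 4^-1) (2^-1 * t + 2^-1)))).
- exact: affine_continuous.
- by do 2?[apply: min_fun_continuous]; exact: affine_continuous.
- by rewrite assoc_reparamE; do ?[case: leP => ?]; lra.
- by rewrite assoc_reparamE; do ?[case: leP => ?]; lra.
- by move=> t; rewrite mul1r addr0 clamp_val.
move=> t; have /andP[t0 t1] := unitI_val_itv t.
rewrite assoc_reparamE.
rewrite /= /mk_path /path_cat_fun; case: (leP (unitI_val t) 2^-1) => t2.
  rewrite /= /mk_path /path_cat_fun clampE; last by apply/andP; split; lra.
  case: (leP (unitI_val t) 4^-1) => t4.
    rewrite ifT; last by lra.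
    by rewrite clampE ?ifT //; [lra | apply/andP; split; lra].
  rewrite ifF; last by apply/negbTE; rewrite -ltNge; lra.
  rewrite clampE; last by apply/andP; split; lra.
  rewrite ifF; last by apply/negbTE; rewrite -ltNge; lra.
  rewrite /= /mk_path /path_cat_fun clampE; last by apply/andP; split; lra.
  rewrite ifT; last by lra.
  by congr (q (clamp _)); lra.
rewrite clampE; last by apply/andP; split; lra.
rewrite ifF; last by apply/negbTE; rewrite -ltNge; lra.
rewrite /= /mk_path /path_cat_fun clampE; last by apply/andP; split; lra.
rewrite ifF; last by apply/negbTE; rewrite -ltNge; lra.
by congr (r (clamp _)); lra.
Qed.

Lemma path_cat_cstl (x y : T) (p : {path I from x to y in T}) :
  path_homotopic (path_cat (path_cst x) p) p.
Proof.
apply: (@path_reparam_homotopic _ _ _ _ p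
          (fun t => Num.max (0 * t + 0) (2 * t + -1)) (fun t => 1 * t + 0)).
- by apply: max_fun_continuous; exact: affine_continuous.
- exact: affine_continuous.
- by rewrite ?minEle ?maxEle; case: ifP => [|/negbT]; rewrite -?ltNge; lra.
- by rewrite ?minEle ?maxEle; case: ifP => [|/negbT]; rewrite -?ltNge; lra.
- move=> t; rewrite /= /mk_path /path_cat_fun; case: leP => t2.
    by rewrite max_l; [rewrite mul0r addr0 [RHS]path_zero | lra].
  by rewrite max_r //; lra.
- by move=> t; rewrite mul1r addr0 clamp_val.
Qed.

Lemma path_cat_cstr (x y : T) (p : {path I from x to y in T}) :
  path_homotopic (path_cat p (path_cst y)) p.
Proof.
apply: (@path_reparam_homotopic _ _ _ _ p
          (fun t => Num.min (2 * t + 0) (0 * t + 1)) (fun t => 1 * t + 0)).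
- by apply: min_fun_continuous; exact: affine_continuous.
- exact: affine_continuous.
- by rewrite ?minEle ?maxEle; case: ifP => [|/negbT]; rewrite -?ltNge; lra.
- by rewrite ?minEle ?maxEle; case: ifP => [|/negbT]; rewrite -?ltNge; lra.
- move=> t; rewrite /= /mk_path /path_cat_fun; case: leP => t2.
    by rewrite min_l ?addr0 //; lra.
  by rewrite min_r; [rewrite mul0r add0r [RHS]path_one | lra].
- by move=> t; rewrite mul1r addr0 clamp_val.
Qed.

Lemma path_cat_revr (x y : T) (p : {path I from x to y in T}) :
  path_homotopic (path_cat p (path_rev p)) (path_cst x).
Proof.
apply: (@path_reparam_homotopic _ _ _ _ p
          (fun t => Num.min (2 * t + 0) (- 2 * t + 2)) (fun t => 0 * t + 0)).
- by apply: min_fun_continuous; exact: affine_continuous.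
- exact: affine_continuous.
- by rewrite ?minEle ?maxEle; case: ifP => [|/negbT]; rewrite -?ltNge; lra.
- by rewrite ?minEle ?maxEle; case: ifP => [|/negbT]; rewrite -?ltNge; lra.
- move=> t; have /andP[t0 t1] := unitI_val_itv t.
  rewrite /= /mk_path /path_cat_fun; case: leP => t2.
    by rewrite min_l ?addr0 //; lra.
  rewrite min_r; last by lra.
  rewrite /= /mk_path /path_rev_fun clampE; last by apply/andP; split; lra.
  by congr (p (clamp _)); lra.
- by move=> t; rewrite mul0r addr0 [RHS]path_zero.
Qed.

Lemma path_cat_revl (x y : T) (p : {path I from x to y in T}) :
  path_homotopic (path_cat (path_rev p) p) (path_cst y).
Proof.
apply: (@path_reparam_homotopic _ _ _ _ p
          (fun t => Num.max (- 2 * t + 1) (2 * t + -1)) (fun t => 0 * t + 1)).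
- by apply: max_fun_continuous; exact: affine_continuous.
- exact: affine_continuous.
- by rewrite ?minEle ?maxEle; case: ifP => [|/negbT]; rewrite -?ltNge; lra.
- by rewrite ?minEle ?maxEle; case: ifP => [|/negbT]; rewrite -?ltNge; lra.
- move=> t; have /andP[t0 t1] := unitI_val_itv t.
  rewrite /= /mk_path /path_cat_fun; case: leP => t2.
    rewrite max_l; last by lra.
    rewrite /= /mk_path /path_rev_fun clampE; last by apply/andP; split; lra.
    by congr (p (clamp _)); lra.
  by rewrite max_r //; lra.
- by move=> t; rewrite mul0r add0r [RHS]path_one.
Qed.

End Paths.

Section FundamentalGroup.
Variables (R : realType) (T : topologicalType) (b : T).
Local Notation loop := {path (unitI R) from b to b in T}.

Definition loop_homotopic (p q : loop) : bool := `[< path_homotopic p q >].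

Lemma loop_homotopic_refl : reflexive loop_homotopic.
Proof. by move=> p; apply/asboolP; exact: path_homotopic_refl. Qed.

Lemma loop_homotopic_sym : symmetric loop_homotopic.
Proof.
by move=> p q; apply/asboolP/asboolP; exact: path_homotopic_sym.
Qed.

Lemma loop_homotopic_trans : transitive loop_homotopic.
Proof.
move=> q p r /asboolP pq /asboolP qr; apply/asboolP.
exact: path_homotopic_trans pq qr.
Qed.

Canonical loop_equiv :=
  EquivRel loop_homotopic
    loop_homotopic_refl loop_homotopic_sym loop_homotopic_trans.

Definition pi1 : Type := {eq_quot loop_equiv}.

HB.instance Definition _ := Choice.on pi1.
HB.instance Definition _ := EqQuotient.on pi1.

Definition pi1_class (p : loop) : pi1 := \pi_pi1 p.

Lemma pi1_classP (p q : loop) : pi1_class p = pi1_class q <-> path_homotopic p q.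
Proof. by split=> [/eqmodP/asboolP | pq] //; apply/eqmodP/asboolP. Qed.

Lemma pi1_classK (g : pi1) : pi1_class (repr g) = g.
Proof. exact: reprK. Qed.

Definition pi1_mul (g h : pi1) : pi1 := pi1_class (path_cat (repr g) (repr h)).
Definition pi1_one : pi1 := pi1_class (path_cst R b).
Definition pi1_inv (g : pi1) : pi1 := pi1_class (path_rev (repr g)).

Lemma pi1_mulE (p q : loop) :
  pi1_mul (pi1_class p) (pi1_class q) = pi1_class (path_cat p q).
Proof.
by apply/pi1_classP/path_cat_homotopic; apply/pi1_classP; rewrite pi1_classK.
Qed.

Lemma pi1_invE (p : loop) : pi1_inv (pi1_class p) = pi1_class (path_rev p).
Proof.
by apply/pi1_classP/path_rev_homotopic; apply/pi1_classP; rewrite pi1_classK.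
Qed.

Lemma pi1_mulA : associative pi1_mul.
Proof.
move=> g h k; rewrite -(pi1_classK g) -(pi1_classK h) -(pi1_classK k) !pi1_mulE.
exact/pi1_classP/path_catA.
Qed.

Lemma pi1_mul1 : left_id pi1_one pi1_mul.
Proof.
by move=> g; rewrite -(pi1_classK g) pi1_mulE; exact/pi1_classP/path_cat_cstl.
Qed.

Lemma pi1_mulr1 : right_id pi1_one pi1_mul.
Proof.
by move=> g; rewrite -(pi1_classK g) pi1_mulE; exact/pi1_classP/path_cat_cstr.
Qed.

Lemma pi1_mulV : left_inverse pi1_one pi1_inv pi1_mul.
Proof.
move=> g; rewrite -(pi1_classK g) pi1_invE pi1_mulE.
exact/pi1_classP/path_cat_revl.
Qed.

Lemma pi1_mulrV : right_inverse pi1_one pi1_inv pi1_mul.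
Proof.
move=> g; rewrite -(pi1_classK g) pi1_invE pi1_mulE.
exact/pi1_classP/path_cat_revr.
Qed.

HB.instance Definition _ := isGroup.Build pi1
  pi1_mulA pi1_mul1 pi1_mulr1 pi1_mulV pi1_mulrV.

End FundamentalGroup.

Arguments pi1 R {T} b.

Section DerivedSeries.
Local Open Scope group_scope.
Variable G : groupType.

Definition subgroup_set (A : set G) : Prop := group_closed (fun x => x \in A).

Lemma subgroup_setP (A : set G) :
  subgroup_set A <-> A 1 /\ forall x y, A x -> A y -> A (x / y).
Proof.
split=> [[A1 AF]|[A1 AF]].
  split=> [|x y Ax Ay]; first exact: set_mem.
  by apply/set_mem/AF; exact: mem_set.
split=> [|x y /set_mem Ax /set_mem Ay]; first exact: mem_set.
exact/mem_set/AF.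
Qed.

Lemma subgroup_setM (A : set G) (x y : G) :
  subgroup_set A -> A x -> A y -> A (x * y).
Proof.
move=> /subgroup_setP[A1 AF] Ax Ay; rewrite -(invgK y); apply: (AF) => //.
by rewrite -(div1g y); exact: AF.
Qed.

Definition generated (A : set G) : set G := smallest subgroup_set A.

Lemma generated_subgroup (A : set G) : subgroup_set (generated A).
Proof.
apply/subgroup_setP; split=> [H [/subgroup_setP[]]//|x y Ax Ay H HA].
by have [_] := (subgroup_setP H).1 HA.1; apply; [exact: Ax | exact: Ay].
Qed.

Fixpoint derived_series (i : nat) : set G :=
  if i is i.+1
  then generated [set [~ x, y] | x in derived_series i & y in derived_series i]
  else setT.

Lemma derived_series_subgroup (i : nat) : subgroup_set (derived_series i).
Proof.
case: i => [|i]; last exact: generated_subgroup.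
exact/subgroup_setP.
Qed.

Lemma derived_series_comm (i : nat) (x y : G) :
  derived_series i x -> derived_series i y -> derived_series i.+1 [~ x, y].
Proof. by move=> Dx Dy; apply: sub_gen_smallest; exists x => //; exists y. Qed.

Definition derived_group (i : nat) : Type := set_type (derived_series i).

HB.instance Definition _ (i : nat) := SubChoice.on (derived_group i).
HB.instance Definition _ (i : nat) :=
  SubChoice_isSubGroup.Build G (fun x => x \in derived_series i)
    (derived_group i) (derived_series_subgroup i).

End DerivedSeries.

Arguments derived_series G i : clear implicits.

Record normal_subgroup (G : groupType) := NormalSubgroup {
  normal_set : set G;
  normal_set_subgroup : subgroup_set normal_set;
  normal_setJ : forall x y : G, normal_set x -> normal_set (x ^ y)%g }.

Section QuotientGroup.
Local Open Scope group_scope.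
Variables (G : groupType) (K : normal_subgroup G).
Local Notation N := (normal_set K).

Let N1 : N 1.
Proof. by have /subgroup_setP[] := normal_set_subgroup K. Qed.

Let NF (x y : G) : N x -> N y -> N (x / y).
Proof. by have /subgroup_setP[_] := normal_set_subgroup K; apply. Qed.

Let NM (x y : G) : N x -> N y -> N (x * y).
Proof. exact: (subgroup_setM (normal_set_subgroup K)). Qed.

Let NV (x : G) : N x -> N x^-1.
Proof. by move=> Nx; rewrite -div1g; exact: NF. Qed.

Definition coset_rel (x y : G) : bool := x^-1 * y \in N.

Lemma coset_rel_refl : reflexive coset_rel.
Proof. by move=> x; rewrite /coset_rel mulVg; exact: mem_set. Qed.

Lemma coset_rel_sym : symmetric coset_rel.
Proof.
have impl x y : coset_rel x y -> coset_rel y x.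
  by move=> /set_mem/NV; rewrite invgM invgK => ?; exact: mem_set.
by move=> x y; apply/idP/idP; exact: impl.
Qed.

Lemma coset_rel_trans : transitive coset_rel.
Proof.
move=> y x z /set_mem xy /set_mem yz; apply: mem_set.
by have := NM xy yz; rewrite mulgA mulgK.
Qed.

Canonical coset_equiv :=
  EquivRel coset_rel coset_rel_refl coset_rel_sym coset_rel_trans.

Definition quotient_group : Type := {eq_quot coset_equiv}.

HB.instance Definition _ := Choice.on quotient_group.
HB.instance Definition _ := EqQuotient.on quotient_group.

Definition coset_class (x : G) : quotient_group := \pi_quotient_group x.

Lemma coset_classP (x y : G) : coset_class x = coset_class y <-> N (x^-1 * y).
Proof.
by split=> [/eqmodP/set_mem | Nxy] //; apply/eqmodP; exact: mem_set.
Qed.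

Lemma coset_classK (g : quotient_group) : coset_class (repr g) = g.
Proof. exact: reprK. Qed.

Definition coset_mul (g h : quotient_group) : quotient_group :=
  coset_class (repr g * repr h).
Definition coset_one : quotient_group := coset_class 1.
Definition coset_inv (g : quotient_group) : quotient_group :=
  coset_class (repr g)^-1.

Lemma coset_mulE (x y : G) :
  coset_mul (coset_class x) (coset_class y) = coset_class (x * y).
Proof.
set x' := repr (coset_class x); set y' := repr (coset_class y).
have Nx : N (x'^-1 * x) by apply/coset_classP; rewrite coset_classK.
have Ny : N (y'^-1 * y) by apply/coset_classP; rewrite coset_classK.
apply/coset_classP; rewrite -/x' -/y'.
have := NM (normal_setJ y' Nx) Ny.
by rewrite conjgE invgM !mulgA mulgK.
Qed.

Lemma coset_invE (x : G) : coset_inv (coset_class x) = coset_class x^-1.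
Proof.
set x' := repr (coset_class x).
have Nx : N (x'^-1 * x) by apply/coset_classP; rewrite coset_classK.
apply/coset_classP; rewrite -/x' invgK.
have := normal_setJ x^-1 (NV Nx).
by rewrite conjgE !invgM !invgK !mulgA mulgV mul1g.
Qed.

Lemma coset_mulA : associative coset_mul.
Proof.
move=> g h k; rewrite -(coset_classK g) -(coset_classK h) -(coset_classK k).
by rewrite !coset_mulE mulgA.
Qed.

Lemma coset_mul1 : left_id coset_one coset_mul.
Proof. by move=> g; rewrite -(coset_classK g) coset_mulE mul1g. Qed.

Lemma coset_mulr1 : right_id coset_one coset_mul.
Proof. by move=> g; rewrite -(coset_classK g) coset_mulE mulg1. Qed.

Lemma coset_mulV : left_inverse coset_one coset_inv coset_mul.
Proof.
by move=> g; rewrite -(coset_classK g) coset_invE coset_mulE mulVg.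
Qed.

Lemma coset_mulrV : right_inverse coset_one coset_inv coset_mul.
Proof.
by move=> g; rewrite -(coset_classK g) coset_invE coset_mulE mulgV.
Qed.

HB.instance Definition _ := isGroup.Build quotient_group
  coset_mulA coset_mul1 coset_mulr1 coset_mulV coset_mulrV.

End QuotientGroup.

Section DerivedQuotient.
Local Open Scope group_scope.
Variables (G : groupType) (i : nat).

Let derived_val1 : \val (1 : derived_group G i) = 1.
Proof. by []. Qed.

Let derived_valM (x y : derived_group G i) : \val (x * y) = \val x * \val y.
Proof. by []. Qed.

Let derived_valV (x : derived_group G i) : \val x^-1 = (\val x)^-1.
Proof. by []. Qed.

(* G^(i+1), as a subset of the group G^(i). *)
Definition derived_next_set : set (derived_group G i) :=
  [set u | derived_series G i.+1 (\val u)].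

Lemma derived_next_subgroup : subgroup_set derived_next_set.
Proof.
have /subgroup_setP[D1 DF] := derived_series_subgroup G i.+1.
apply/subgroup_setP; split=> [|x y Dx Dy]; rewrite /derived_next_set /mkset.
  by rewrite derived_val1.
by rewrite derived_valM derived_valV; exact: DF.
Qed.

Lemma derived_nextJ (x y : derived_group G i) :
  derived_next_set x -> derived_next_set (x ^ y).
Proof.
rewrite /derived_next_set /mkset => Dx.
rewrite conjgE !derived_valM derived_valV -conjgE.
rewrite -[_ ^ _](mulKg (\val x)^-1) invgK -commgEl.
apply: (subgroup_setM (derived_series_subgroup G i.+1)) => //.
by apply: derived_series_comm; exact: set_mem (valP _).
Qed.

Definition derived_next : normal_subgroup (derived_group G i) :=
  NormalSubgroup derived_next_subgroup derived_nextJ.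

Definition derived_quotient : groupType := quotient_group derived_next.

End DerivedQuotient.

Definition group_isomorphic (G H : groupType) : Prop :=
  exists f : {multiplicative G -> H}, bijective f.

Section Configurations.
Variables (m : nat) (M : topologicalType).

Definition config_set : set {ptws 'I_m -> M} :=
  [set y | forall i j, i != j -> y i <> y j].

Definition config : Type := set_type config_set.

HB.instance Definition _ := Topological.on config.

Definition config_orbit (y z : config) : bool :=
  `[< exists s : 'S_m, forall i, (\val z : 'I_m -> M) i = \val y (s i) >].

Lemma config_orbit_refl : reflexive config_orbit.
Proof. by move=> y; apply/asboolP; exists 1%g => i; rewrite perm1. Qed.

Lemma config_orbit_sym : symmetric config_orbit.
Proof.
have impl y z : config_orbit y z -> config_orbit z y.
  move=> /asboolP[s yz]; apply/asboolP; exists s^-1%g => i.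
  by rewrite yz permKV.
by move=> y z; apply/idP/idP; exact: impl.
Qed.

Lemma config_orbit_trans : transitive config_orbit.
Proof.
move=> z y w /asboolP[s yz] /asboolP[t zw]; apply/asboolP.
by exists (t * s)%g => i; rewrite zw yz permM.
Qed.

Canonical config_equiv :=
  EquivRel config_orbit config_orbit_refl config_orbit_sym config_orbit_trans.

(* F_m(M) / S_m with the quotient topology. *)
Definition unordered_config : topologicalType :=
  quotient_topology {eq_quot config_equiv}.

End Configurations.

(* B_m(M) = pi_1(F_m(M) / S_m, b); up to isomorphism it does not depend on b
   when M is a connected surface. *)
Definition braid_group (R : realType) (m : nat) (M : topologicalType)
  (b : unordered_config m M) : groupType := pi1 R b.

Definition sphere2 (R : realType) : topologicalType :=
  set_type [set v : 'rV[R]_3 | \sum_(i < 3) v ord0 i ^+ 2 = 1].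

Definition punctured_sphere2 (R : realType) (x1 x2 : sphere2 R) :
  topologicalType := set_type (~` [set x1; x2]).

(* Main.v *)
(* The sphere minus two points is the punctured plane. Order the points of the
   plane lexicographically, height first. A configuration near z reorders only
   points of z at equal height, and their first coordinates fix the direction
   in which they pass each other: locally, only positive permutation braids on
   four strands (the three points and the puncture) occur, and under further
   perturbation their lengths add up. Convex regions of configurations give the
   corresponding homotopies, so the group is generated by these braids and
   satisfies the relations of the Artin group of type B_3: generators T, s, r
   with srs = rsr, Tr = rT, TsTs = sTsT. With rho = Tsr, conjugation by rho
   permutes s, r, c cyclically and G' is generated modulo G'' by the four
   elements s/r, r/c and their conjugates by s, since conjugation by s acts on
   them as a root of t^2 - t + 1. Conversely, any function on permutation braids
   that is multiplicative when lengths add defines a local cocycle, whose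
   holonomy is a homomorphism on the fundamental group; two such homomorphisms
   to the affine group of Z[t]/(t^2 - t + 1) show that the four generators are
   independent. *)
From HB Require Import structures.
Require Import Defs.
From mathcomp Require Import all_boot all_order all_algebra perm.
From mathcomp Require Import all_classical all_reals all_analysis.
From mathcomp Require Import homotopy zify ring lra.

Set Implicit Arguments.
Unset Strict Implicit.
Unset Printing Implicit Defensive.

Import Order.TTheory GRing.Theory Num.Theory.

Local Open Scope ring_scope.

(** * An affine quotient of the braid group *)

(** No presentation of the group is established. The derived quotient is squeezed between relations,
    which bound it above by four generators, and homomorphisms, which bound it below. Two
    homomorphisms appear for the following reason. On G'/G'' conjugation by rho sends s/r to r/c and
    r/c to the inverse of their product, so it is a root of x^2 + x + 1, and it commutes with
    conjugation by s, the root t of t^2 - t + 1. Over Z[t]/(t^2 - t + 1) the polynomial x^2 + x + 1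
    splits with roots t^2 and t^4, and each root gives one map. A single map has translations in a
    lattice of rank 2, too small for four independent generators. The position of the puncture among
    the four points varies, so positive braids form a groupoid with four objects. Declaring trivial
    the crossings that carry the puncture from i to i + 1 collapses it to a group; geometric braids
    and their affine values are normalised in the same way. The points have no global labelling, so
    constructions are made on labelled lifts and shown invariant under relabelling. *)

(* The ring Z[t]/(t^2 - t + 1) as pairs (x, y) = x + y t; [turn] multiplies by t. *)
Definition turn (v : int * int) : int * int := (- v.2, v.1 + v.2).

Lemma turnD : {morph turn : u v / u + v}.
Proof. by move=> [a b] [c d]; congr (_, _) => /=; ring. Qed.

Lemma iter_turnD n : {morph iter n turn : u v / u + v}.
Proof. by elim: n => // n IH u v /=; rewrite IH turnD. Qed.

(** Since t^2 = t - 1, one has t^3 = -1. This is why linear parts can be kept in ['Z_6]. *)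
Lemma turn6 v : iter 6 turn v = v.
Proof. by case: v => a b; rewrite /turn; congr (_, _) => /=; ring. Qed.

Lemma iter_turn_mod n v : iter (n %% 6) turn v = iter n turn v.
Proof.
rewrite [in RHS](divn_eq n 6) addnC iterD; congr (iter _ _ _).
by elim: (n %/ 6)%N => // m IH; rewrite mulSn iterD -IH turn6.
Qed.

(* Affine maps v |-> t^k v + u of that ring, under composition. *)
Definition affine6 : Type := ('Z_6 * (int * int))%type.

HB.instance Definition _ := Choice.on affine6.

Definition affine6_mul (x y : affine6) : affine6 :=
  (x.1 + y.1, x.2 + iter x.1 turn y.2).
Definition affine6_one : affine6 := (0, (0, 0)).
Definition affine6_inv (x : affine6) : affine6 :=
  (- x.1, iter (- x.1)%R turn (- x.2)).

Lemma iter_turn_Zp (k l : 'Z_6) v :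
  iter (k + l)%R turn v = iter k turn (iter l turn v).
Proof. by rewrite -iterD /= iter_turn_mod. Qed.

Lemma iter_turn0 n : iter n turn (0, 0) = (0, 0).
Proof. by elim: n => //= n ->. Qed.

Lemma affine6_mulA : associative affine6_mul.
Proof.
move=> [k u] [l v] [m w]; rewrite /affine6_mul /=.
by rewrite iter_turn_Zp iter_turnD !addrA.
Qed.

Lemma affine6_mul1 : left_id affine6_one affine6_mul.
Proof. by move=> [k [a b]]; rewrite /affine6_mul /= add0r; congr (_, (_, _));
  rewrite /= add0r. Qed.

Lemma affine6_mulV : left_inverse affine6_one affine6_inv affine6_mul.
Proof.
move=> [k u]; rewrite /affine6_mul [LHS]/= addNr -iter_turnD addNr.
by rewrite -[0 : int * int]/(0, 0) iter_turn0.
Qed.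

Lemma affine6_mulr1 : right_id affine6_one affine6_mul.
Proof.
move=> [k u]; rewrite /affine6_mul [LHS]/= addr0 iter_turn0.
by rewrite -[(0, 0)]/(0 : int * int) addr0.
Qed.

Lemma affine6_mulrV : right_inverse affine6_one affine6_inv affine6_mul.
Proof.
move=> [k u]; rewrite -[LHS]/(k - k, u + iter k turn (iter (- k)%R turn (- u))).
by rewrite -iter_turn_Zp !subrr.
Qed.

HB.instance Definition _ := isGroup.Build affine6
  affine6_mulA affine6_mul1 affine6_mulr1 affine6_mulV affine6_mulrV.

(* A list w stands for the permutation i |-> nth 0 w i of {0, 1, 2, 3}. *)
Definition is_perm4 (w : seq nat) := perm_eq w (iota 0 4).

(** Diagram order: [w] acts before [w'], as in the concatenation of braids. *)
Definition perm4_comp (w w' : seq nat) : seq nat := [seq nth 0 w' i | i <- w].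

(* Every inversion of w persists in the composite, i.e. the lengths add. *)
Definition inversions_add (w w' : seq nat) : bool :=
  all (fun i => all (fun k =>
    (i < k) && (nth 0 w k < nth 0 w i) ==>
    (nth 0 w' (nth 0 w k) < nth 0 w' (nth 0 w i)))%N (iota 0 4)) (iota 0 4).

Definition adj_swap (i k : nat) : nat :=
  if k == i then i.+1 else if k == i.+1 then i else k.

Definition adj_perm (i : nat) : seq nat := map (adj_swap i) (iota 0 4).

Definition inversion_count (w : seq nat) : nat :=
  sumn [seq count (fun k => (i < k) && (nth 0 w k < nth 0 w i))%N (iota 0 4) | i <-
    iota 0 4].

Lemma perm4_descent_test : all (fun w => (w == iota 0 4) ||
  has (fun i => let w' := perm4_comp (adj_perm i) w in
    [&& is_perm4 w', perm4_comp (adj_perm i) w' == w,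
        inversions_add (adj_perm i) w' & (inversion_count w' < inversion_count w)%N])
    (iota 0 3)) (permutations (iota 0 4)).
Proof. by vm_compute. Qed.

(** The induction step that turns a permutation braid into a product of crossings: undoing a descent
    shortens the permutation. *)
Lemma perm4_descent w : is_perm4 w -> w <> iota 0 4 ->
  exists i w', [/\ (i < 3)%N, is_perm4 w', perm4_comp (adj_perm i) w' = w,
    inversions_add (adj_perm i) w' & (inversion_count w' < inversion_count w)%N].
Proof.
move=> pw /eqP/negPf wid; have /allP/(_ w) := perm4_descent_test.
rewrite mem_permutations wid => /(_ pw) /hasP[i]; rewrite mem_iota /= => i3.
by case/and4P=> pw' /eqP ww' ad lt; exists i, (perm4_comp (adj_perm i) w).
Qed.

(** * Affine values of the positive permutation braids *)

Section Crossings.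
Local Open Scope group_scope.
Variable e : bool.

Let s : affine6 := (1, (0, 0))%R.
Let r : affine6 := (1, (1, 0))%R.
(* [rho] cyclically permutes, by conjugation, [s], [r] and a third generator. *)
Let rho : affine6 := (if e then 2 else 4, (0, 1))%R.
(** The image of T, solved from rho = Tsr. *)
Let u : affine6 := rho / (s * r).

(* The positive crossing of the strands at positions i and i + 1 when the
   marked strand (the puncture) is at position j. *)
Definition crossing (j i : nat) : affine6 :=
  match j, i with
  | 1, 0 => u | 2, 1 => s^-1 * u * s | 3, 2 => (s * r)^-1 * u * (s * r)
  | 0, 1 | 2, 0 | 3, 0 => s
  | 0, 2 | 1, 2 | 3, 1 => r
  | _, _ => 1
  end.

(** One particular reduced word of [w], obtained by always removing the first descent; [find]
    returns 3 when none is left. The argument [j] follows the puncture through the crossings. *)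
Fixpoint braid_value_rec (n j : nat) (w : seq nat) : affine6 :=
  if n is n.+1 then
    let i := find (fun i => nth 0 w i.+1 < nth 0 w i)%N (iota 0 3) in
    if (i < 3)%N then
      crossing j i * braid_value_rec n (adj_swap i j) (perm4_comp (adj_perm i) w)
    else 1
  else 1.

(** The longest permutation of four positions has six inversions, so the fuel suffices. *)
Definition braid_value := braid_value_rec 6.

End Crossings.

(** The exhaustive check takes the place of verifying the braid relations for [crossing] and of the
    independence from the reduced word. *)
Lemma braid_value_test : all (fun e => all (fun j => all (fun w => all (fun w' =>
  inversions_add w w' ==>
  (braid_value e j (perm4_comp w w') ==
   braid_value e j w * braid_value e (nth 0 w j) w')%g)
  (permutations (iota 0 4))) (permutations (iota 0 4))) (iota 0 4)) [:: true; false].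
Proof. by vm_compute. Qed.

Lemma braid_valueM e j w w' : (j < 4)%N -> is_perm4 w -> is_perm4 w' ->
  inversions_add w w' ->
  braid_value e j (perm4_comp w w') =
  (braid_value e j w * braid_value e (nth 0 w j) w')%g.
Proof.
move=> j4 pw pw' ww'; apply/eqP.
have /allP/(_ e) := braid_value_test; rewrite (_ : e \in _); last by case: e.
move=> /(_ isT) /allP/(_ j); rewrite mem_iota => /(_ j4) /allP/(_ w).
rewrite mem_permutations => /(_ pw) /allP/(_ w').
by rewrite mem_permutations => /(_ pw'); rewrite ww'.
Qed.

(** * Rankings of the four points *)

(* Three moving points, labelled [Some i], and the puncture [None] at the origin. *)
Definition label := option 'I_3.

Definition ranking (r : label -> nat) := injective r /\ forall a, (r a < 4)%N.

Lemma card_label : #|{: label}| = 4%N.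
Proof. by rewrite card_option card_ord. Qed.

Lemma ranking_onto r i : ranking r -> (i < 4)%N -> exists a, r a = i.
Proof.
move=> [ri r4] i4; pose f (a : label) : 'I_4 := Ordinal (r4 a).
have fi : injective f by move=> a b /(congr1 val) /ri.
have fb : bijective f by apply: inj_card_bij fi _; rewrite card_label card_ord.
by case: fb => g _ gK; exists (g (Ordinal i4)); have /(congr1 val) := gK (Ordinal i4).
Qed.

Lemma ranking_count r a : ranking r -> #|[set b : label | (r b < r a)%N]| = r a.
Proof.
move=> rr; have [ri r4] := rr; pose f (a : label) : 'I_4 := Ordinal (r4 a).
have fi : injective f by move=> x y /(congr1 val) /ri.
rewrite -(card_imset _ fi).
have -> : f @: [set b | (r b < r a)%N] = [set i : 'I_4 | (i < r a)%N].
  apply/setP => i; rewrite inE; apply/imsetP/idP => [[b]|ia];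
    first by rewrite inE => ? ->.
  by have [b rb] := ranking_onto rr (ltn_ord i); exists b;
    [rewrite inE rb | apply/val_inj].
rewrite -sum1dep_card big_mkcond /=.
by move: (r a) (r4 a) => n; rewrite !big_ord_recl big_ord0; case: n => [|[|[|[|//]]]].
Qed.

Definition unrank (r : label -> nat) (i : nat) : label :=
  odflt None [pick a | r a == i].

Lemma unrankK r a : ranking r -> unrank r (r a) = a.
Proof.
by move=> [ri _]; rewrite /unrank; case: pickP => [b /eqP /ri //|/(_ a)]; rewrite eqxx.
Qed.

Lemma rankK r i : ranking r -> (i < 4)%N -> r (unrank r i) = i.
Proof. by move=> rr i4; have [a <-] := ranking_onto rr i4; rewrite unrankK. Qed.

Definition rank_perm (r r' : label -> nat) : seq nat :=
  [seq r' (unrank r i) | i <- iota 0 4].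

Lemma nth_rank_perm r r' i : (i < 4)%N -> nth 0%N (rank_perm r r') i = r' (unrank r i).
Proof. by move=> i4; rewrite (nth_map 0%N) ?size_iota // nth_iota. Qed.

Lemma nth_rank_permE r r' a : ranking r -> nth 0%N (rank_perm r r') (r a) = r' a.
Proof. by move=> rr; rewrite nth_rank_perm ?unrankK //; case: rr. Qed.

Lemma rank_perm_eq r r' s s' : r =1 s -> r' =1 s' -> rank_perm r r' = rank_perm s s'.
Proof.
move=> rs rs'; apply: eq_map => i; rewrite rs' /unrank; congr (s' (odflt _ _)).
by apply: eq_pick => a; rewrite rs.
Qed.

Lemma rank_perm_perm4 r r' : ranking r -> ranking r' -> is_perm4 (rank_perm r r').
Proof.
move=> rr [r'i r'4].
have u : uniq (rank_perm r r').
  rewrite map_inj_in_uniq ?iota_uniq // => i j; rewrite !mem_iota /= => i4 j4 /r'i.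
  by move/(congr1 r); rewrite !rankK.
rewrite /is_perm4; apply: uniq_perm; rewrite ?iota_uniq // => i.
have [] := uniq_min_size u (s2 := iota 0 4).
- by move=> j /mapP[k _ ->]; rewrite mem_iota r'4.
- by rewrite size_map.
- by move=> _ ->.
Qed.

Lemma rank_perm_comp r r' r'' : ranking r -> ranking r' -> ranking r'' ->
  rank_perm r r'' = perm4_comp (rank_perm r r') (rank_perm r' r'').
Proof.
move=> rr rr' rr''; rewrite /perm4_comp -map_comp; apply/eq_in_map => i.
by rewrite mem_iota => i4 /=; rewrite nth_rank_permE.
Qed.

(** The condition under which the permutation braids from r to r' and from r' to r'' compose to the
    one from r to r'': no pair crosses twice. *)
Definition additive_ranks (r r' r'' : label -> nat) :=
  forall a b, (r a < r b -> r' b < r' a -> r'' b < r'' a)%N.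

Lemma rank_perm_add r r' r'' : ranking r -> ranking r' -> ranking r'' ->
  additive_ranks r r' r'' -> inversions_add (rank_perm r r') (rank_perm r' r'').
Proof.
move=> rr rr' rr'' ad; apply/allP => i; rewrite mem_iota => i4.
apply/allP => k; rewrite mem_iota => k4; apply/implyP => /andP[].
have [[a <-] [b <-]] := (ranking_onto rr i4, ranking_onto rr k4).
rewrite !nth_rank_permE //; exact: ad.
Qed.

(** [bump j] skips the value j, so the moving points fill, in the order of their labels, the
    positions left free by the puncture. *)
Definition std_rank (j : nat) (a : label) : nat := if a is Some i then bump j i else j.

Lemma std_rankP j : (j < 4)%N -> ranking (std_rank j).
Proof.
move=> j4; split=> [[a|] [b|] //=|[a|//]] /=.
- by move/(can_inj (bumpK j))/val_inj => ->.
- by move=> e; have := neq_bump j a; rewrite e eqxx.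
- by move=> e; have := neq_bump j b; rewrite -e eqxx.
- by rewrite /bump; have := ltn_ord a; case: (j <= a)%N; rewrite ?add1n ?add0n //;
  move/leqW.
Qed.

Definition relabel (s : 'S_3) (a : label) : label := omap s a.

(** Listing the moving points by increasing rank gives the relabelling. Up to labels, a ranking
    retains only the position of the puncture. *)
Lemma relabel_std r : ranking r ->
  exists s : 'S_3, forall a, r (relabel s a) = std_rank (r None) a.
Proof.
move=> rr; have [ri r4] := rr; have srr := std_rankP (r4 None).
have H (i : 'I_3) : exists k : 'I_3, r (Some k) == std_rank (r None) (Some i).
  have [[k|] e] := ranking_onto rr (srr.2 (Some i)); first by exists k; rewrite e.
  by have := neq_bump (r None) i; rewrite -[bump _ _]e eqxx.
pose f i := xchoose (H i).
have fE i : r (Some (f i)) = std_rank (r None) (Some i) by apply/eqP/(xchooseP (H i)).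
have fi : injective f by move=> i k e; have /srr.1[] :=
  etrans (esym (fE i)) (etrans (congr1 (r \o Some) e) (fE k)).
by exists (perm fi) => -[i|] //=; rewrite permE fE.
Qed.

Lemma relabelK (s : 'S_3) : cancel (relabel s) (relabel s^-1).
Proof. by case=> //= i; rewrite permK. Qed.

Lemma ranking_relabel r (s : 'S_3) : ranking r -> ranking (r \o relabel s).
Proof. by move=> [ri r4]; split=> [a b /ri /(can_inj (relabelK s))|a] //=. Qed.

Lemma rank_perm_relabel r r' (s : 'S_3) : ranking r -> ranking r' ->
  rank_perm (r \o relabel s) (r' \o relabel s) = rank_perm r r'.
Proof.
move=> rr rr'; have rs := ranking_relabel s rr; apply/eq_in_map => i.
rewrite mem_iota /= => i4; congr r'.
apply: rr.1; rewrite rankK // -[RHS](rankK rs i4) //=.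
Qed.

(** * Lexicographically ordered configurations *)

Lemma finite_radius (R : realType) (T : finType) (P : T -> R -> Prop) :
  (forall t e e', 0 < e' -> e' <= e -> P t e -> P t e') ->
  (forall t, exists2 e, 0 < e & P t e) -> exists2 e, 0 < e & forall t, P t e.
Proof.
move=> Pmono Pex.
suff [e e0 Pe] : exists2 e, 0 < e & forall t, t \in enum T -> P t e.
  by exists e => // t; apply: Pe; rewrite mem_enum.
elim: (enum T) => [|t s [e e0 IH]]; first by exists 1.
have [e' e'0 Pt] := Pex t.
have m0 : 0 < Num.min e e' by rewrite lt_min e0.
exists (Num.min e e') => // u; rewrite inE => /orP[/eqP ->|us].
  by apply: Pmono Pt; rewrite ?ge_min ?lexx ?orbT.
by apply: Pmono (IH _ us); rewrite ?ge_min ?lexx.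
Qed.

Section Lex.
Variable R : realType.
Implicit Types (p q : R * R) (z : 'I_3 -> R * R) (a b : label).

Definition lexlt p q := (p.2 < q.2) || ((p.2 == q.2) && (p.1 < q.1)).

Lemma lexltxx p : lexlt p p = false.
Proof. by rewrite /lexlt !ltxx andbF. Qed.

Lemma lexlt_trans : transitive lexlt.
Proof.
move=> [b b'] [a a'] [c c'] /orP[/= h|/= /andP[/eqP h h1]] /orP[/= k|/= /andP[/eqP k
  k1]];
  rewrite /lexlt /=; apply/orP; [left|left|left|right]; try lra.
Qed.

Lemma lexlt_total p q : p <> q -> lexlt p q || lexlt q p.
Proof.
case: p q => [x y] [x' y'] ne; rewrite /lexlt /=.
have [//|//|yy /=] := ltgtP y y'; rewrite ?orbT //.
by have [//|//|xx] := ltgtP x x'; case: ne; rewrite xx yy.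
Qed.

Lemma lexlt_asym p q : lexlt p q -> lexlt q p = false.
Proof. by move=> pq; apply/negP => qp; have := lexlt_trans pq qp; rewrite lexltxx. Qed.

Definition segpt (t : R) p q : R * R := ((1 - t) * p.1 + t * q.1,
  (1 - t) * p.2 + t * q.2).

Lemma segment_lt (t x y x' y' : R) : 0 <= t <= 1 -> x < y -> x' < y' ->
  (1 - t) * x + t * x' < (1 - t) * y + t * y'.
Proof.
move=> /andP[t0 t1] xy xy'.
have h1 : 0 <= (1 - t) * (y - x) by rewrite mulr_ge0; lra.
have h2 : 0 <= t * (y' - x') by rewrite mulr_ge0; lra.
have [h|h] : 0 < t \/ 0 < 1 - t by have [|] := ltP 0 t; [left | right; lra].
  by have : 0 < t * (y' - x') by [rewrite mulr_gt0 //; lra]; lra.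
by have : 0 < (1 - t) * (y - x) by [rewrite mulr_gt0 //; lra]; lra.
Qed.

(** The lexicographically positive vectors form a convex cone. *)
Lemma lexlt_seg t p q p' q' : 0 <= t <= 1 -> lexlt p q -> lexlt p' q' ->
  lexlt (segpt t p p') (segpt t q q').
Proof.
(* At the two ends a weight vanishes and scaling no longer preserves strict inequalities, so they
   are settled apart. *)
move=> t01; have [->|t0] := eqVneq t 0.
  by rewrite /lexlt /segpt /= !subr0 !mul1r !mul0r !addr0.
have [->|t1] := eqVneq t 1.
  by rewrite /lexlt /segpt /= !subrr !mul1r !mul0r !add0r.
have s0 : 0 < t by rewrite lt0r t0; lra.
have s1 : t < 1 by rewrite lt_neqAle t1; lra.
have r0 : 0 < 1 - t by rewrite subr_gt0.
have m (w x y : R) : 0 < w -> x < y -> w * x < w * y by move=> *; rewrite ltr_pM2l.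
case/orP => [h|/andP[/eqP h h1]] /orP[k|/andP[/eqP k k1]]; apply/orP => /=.
- by left; apply: ltrD; exact: m.
- by left; rewrite k ltrD2r; exact: m.
- by left; rewrite h ltrD2l; exact: m.
- by right; rewrite h k eqxx /=; apply: ltrD; exact: m.
Qed.

Definition pt z a : R * R := if a is Some i then z i else (0, 0).

Definition valid z := injective (pt z).

Definition segz (t : R) z z' (i : 'I_3) : R * R := segpt t (z i) (z' i).

Lemma pt_segz t z z' a : pt (segz t z z') a = segpt t (pt z a) (pt z' a).
Proof. by case: a => //=; rewrite /segpt /= !mulr0 addr0. Qed.

Definition rk z a : nat := #|[set b | lexlt (pt z b) (pt z a)]|.

Lemma rk_lt z a b : valid z -> (rk z a < rk z b)%N = lexlt (pt z a) (pt z b).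
Proof.
have mono c e : lexlt (pt z c) (pt z e) -> (rk z c < rk z e)%N.
  move=> ce; apply: proper_card; apply/properP; split.
    by apply/fintype.subsetP => x; rewrite !inE => xc; exact: lexlt_trans xc ce.
  by exists c; rewrite !inE ?lexltxx.
move=> vz; apply/idP/idP => [ab|]; last exact: mono.
have [e|ne] := pselect (a = b); first by rewrite e ltnn in ab.
have /lexlt_total/orP[//|/mono ba] : pt z a <> pt z b by move/vz.
by have := ltn_trans ab ba; rewrite ltnn.
Qed.

Lemma rk_ranking z : valid z -> ranking (rk z).
Proof.
move=> vz; split=> [a b e|a].
  have [//|ne] := pselect (a = b).
  have /lexlt_total/orP[] : pt z a <> pt z b by move/vz.
    by rewrite -rk_lt // e ltnn.
  by rewrite -rk_lt // e ltnn.
rewrite -card_label; apply: proper_card; apply/properP; split;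
  first exact/fintype.subsetP.
by exists a; rewrite ?inE ?lexltxx.
Qed.

Lemma pt_relabel z (s : 'S_3) a : pt (z \o s) a = pt z (relabel s a).
Proof. by case: a. Qed.

Lemma valid_relabel z (s : 'S_3) : valid z -> valid (z \o s).
Proof. by move=> vz a b; rewrite !pt_relabel => /vz /(can_inj (relabelK s)). Qed.

Lemma rk_relabel z (s : 'S_3) a : rk (z \o s) a = rk z (relabel s a).
Proof.
rewrite /rk -[RHS](card_preimset _ (can_inj (relabelK s))); congr #|pred_of_set _|.
by apply/setP => b; rewrite !inE !pt_relabel.
Qed.

(* Regions are convex, so straight-line homotopies stay inside them. *)
Definition region (o K : label -> label -> bool) z :=
  forall a b, o a b -> if K a b then (pt z a).1 < (pt z b).1 else lexlt (pt z a) (pt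
    z b).

Definition total_on_labels (o : label -> label -> bool) := forall a b, a <> b ->
  o a b || o b a.

Lemma region_valid o K z : total_on_labels o -> region o K z -> valid z.
Proof.
move=> ot rz a b ab; have [//|ne] := pselect (a = b).
by case/orP: (ot _ _ ne) => /rz; rewrite ab; case: ifP => _; rewrite ?ltxx ?lexltxx.
Qed.

Lemma region_segz o K t z z' : 0 <= t <= 1 -> region o K z -> region o K z' ->
  region o K (segz t z z').
Proof.
move=> t01 rz rz' a b oab; move: (rz _ _ oab) (rz' _ _ oab); rewrite !pt_segz.
by case: ifP => _; [exact: segment_lt | exact: lexlt_seg].
Qed.

Definition rank_order (r : label -> nat) a b := (r a < r b)%N.

Lemma rank_order_total r : ranking r -> total_on_labels (rank_order r).
Proof.
move=> [ri _] a b ab; rewrite /rank_order -neq_ltn; by apply/eqP => /ri.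
Qed.

(* The subtractions put the puncture at the origin. *)
Definition gridz (r r' : label -> nat) (i : 'I_3) : R * R :=
  ((r (Some i))%:R - (r None)%:R, (r' (Some i))%:R - (r' None)%:R).

Lemma pt_gridz r r' a : pt (gridz r r') a = ((r a)%:R - (r None)%:R,
  (r' a)%:R - (r' None)%:R).
Proof. by case: a => //=; rewrite !subrr. Qed.

Lemma gridz_lt1 r r' a b : ((pt (gridz r r') a).1 < (pt (gridz r r') b).1) =
  (r a < r b)%N.
Proof. by rewrite !pt_gridz /= ltrD2r ltr_nat. Qed.

Lemma gridz_lexlt r r' a b : ranking r' ->
  lexlt (pt (gridz r r') a) (pt (gridz r r') b) = (r' a < r' b)%N.
Proof.
move=> [ri _]; rewrite !pt_gridz /lexlt /= ltrD2r ltr_nat.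
rewrite (inj_eq (addIr _)) eqr_nat ltrD2r ltr_nat.
case: (ltngtP (r' a) (r' b)) => //= /ri ->; by rewrite ltnn.
Qed.

Lemma gridz_valid r r' : ranking r' -> valid (gridz r r').
Proof.
move=> rr; apply: (@region_valid (rank_order r') (fun _ _ => false)).
  exact: rank_order_total.
by move=> a b; rewrite gridz_lexlt.
Qed.

Lemma rk_gridz r r' a : ranking r' -> rk (gridz r r') a = r' a.
Proof.
move=> rr; rewrite -[RHS](ranking_count a rr); congr #|pred_of_set _|.
by apply/setP => b; rewrite !inE gridz_lexlt.
Qed.

Lemma gridz_relabel r r' (s : 'S_3) : gridz (r \o relabel s) (r' \o relabel s) =
  gridz r r' \o s.
Proof. exact/funext. Qed.

(** The combinatorial trace of a small perturbation: ties in a coordinate may be broken either way,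
    strict inequalities survive. *)
Definition refines z z' := forall a b,
  ((pt z a).1 < (pt z b).1 -> (pt z' a).1 < (pt z' b).1) /\
  ((pt z a).2 < (pt z b).2 -> (pt z' a).2 < (pt z' b).2).

(* Labels inverted between z and z' have the same height in z, so their first
   coordinates determine the direction of the exchange. *)
Lemma refines_inversion z z' a b : refines z z' ->
  lexlt (pt z a) (pt z b) -> lexlt (pt z' b) (pt z' a) ->
  (pt z a).1 < (pt z b).1 /\ (pt z' b).2 < (pt z' a).2.
Proof.
move=> /(_ a b)[ref1 ref2] /orP[/ref2 h|/andP[_ h]] /orP[k|/andP[/eqP k k1]] //.
- by have := lt_trans h k; rewrite ltxx.
- by rewrite k ltxx in h.
- by have := lt_trans (ref1 h) k1; rewrite ltxx.
Qed.

(** Distinct points differ strictly in some coordinate, and that difference is kept. *)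
Lemma refines_valid z z' : valid z -> refines z z' -> valid z'.
Proof.
move=> vz ref a b ab; have [//|ne] := pselect (a = b).
have zab : pt z a <> pt z b by move/vz.
have [h1 h2] := ref a b; have [k1 k2] := ref b a; move: h1 h2 k1 k2; rewrite ab !ltxx.
move=> h1 h2 k1 k2; case: zab.
rewrite [LHS]surjective_pairing [RHS]surjective_pairing; congr (_, _); apply/eqP;
  rewrite eq_le !leNgt; apply/andP; split; apply/negP.
- by move/k1.
- by move/h1.
- by move/k2.
- by move/h2.
Qed.

Definition near (e : R) z z' := forall i,
  `|(z' i).1 - (z i).1| < e /\ `|(z' i).2 - (z i).2| < e.

Lemma near_le e e' z z' : e <= e' -> near e z z' -> near e' z z'.
Proof. by move=> ee h i; have [h1 h2] := h i; split; exact: lt_le_trans ee. Qed.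

Lemma near_pt e z z' a : 0 < e -> near e z z' ->
  `|(pt z' a).1 - (pt z a).1| < e /\ `|(pt z' a).2 - (pt z a).2| < e.
Proof. by move=> e0; case: a => [i|] //= _; rewrite subrr normr0. Qed.

(* By the last clause, a configuration within this distance is determined by its
   unordered set of points. *)
Definition good_radius z e := [/\ 0 < e, forall z', near e z z' -> refines z z' &
  forall i j, `|(z i).1 - (z j).1| < 2 * e -> `|(z i).2 - (z j).2| < 2 * e -> i = j].

Lemma good_radius_ex z : valid z -> exists e, good_radius z e.
Proof.
move=> vz.
(* A margin e on either side absorbs displacements of both points by less than e. *)
have gap (x y : R) : exists2 e, 0 < e & (x < y -> x + e <= y - e).
  have [xy|yx] := ltP x y; last by exists 1.
  by exists ((y - x) / 2); [rewrite divr_gt0 // subr_gt0 | lra].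
have gapmono (x y e e' : R) : 0 < e' -> e' <= e -> (x < y -> x + e <= y - e) ->
  (x < y -> x + e' <= y - e').
  by move=> e0 ee h /h; lra.
have [e1 e10 H1] := @finite_radius R (label * label)%type
  (fun u e => (pt z u.1).1 < (pt z u.2).1 -> (pt z u.1).1 + e <= (pt z u.2).1 - e)
  (fun _ _ _ => gapmono _ _ _ _) (fun _ => gap _ _).
have [e2 e20 H2] := @finite_radius R (label * label)%type
  (fun u e => (pt z u.1).2 < (pt z u.2).2 -> (pt z u.1).2 + e <= (pt z u.2).2 - e)
  (fun _ _ _ => gapmono _ _ _ _) (fun _ => gap _ _).
have m0 : 0 < Num.min e1 e2 by rewrite lt_min e10.
have m1 : Num.min e1 e2 <= e1 by rewrite ge_min lexx.
have m2 : Num.min e1 e2 <= e2 by rewrite ge_min lexx orbT.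
exists (Num.min e1 e2); split=> //.
  move=> z' nz a b; have [na1 na2] := near_pt a m0 nz; have [nb1 nb2] :=
    near_pt b m0 nz.
  move: na1 na2 nb1 nb2; rewrite !ltr_norml => na1 na2 nb1 nb2.
  by split=> [/(H1 (a, b))|/(H2 (a, b))] /=; lra.
move=> i j; rewrite !ltr_norml => hij1 hij2.
suff /vz[] : pt z (Some i) = pt z (Some j) by [].
rewrite /= [z i]surjective_pairing [z j]surjective_pairing; congr (_, _); apply/eqP;
  rewrite eq_le !leNgt;
  apply/andP; split; apply/negP.
- by move/(H1 (Some j, Some i)) => /=; lra.
- by move/(H1 (Some i, Some j)) => /=; lra.
- by move/(H2 (Some j, Some i)) => /=; lra.
- by move/(H2 (Some i, Some j)) => /=; lra.
Qed.

(** The point [z' (s i)] lies within e of both [z i] and [z (s i)], so these are within 2e of each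
    other and separation gives [s i = i]. *)
Lemma near_unique z e z' (s : 'S_3) : good_radius z e -> near e z z' ->
  near e z (z' \o s) -> z' \o s = z'.
Proof.
move=> [_ _ sep] n1 n2; apply/funext => i /=; congr z'; apply: sep.
- by have [+ _] := n1 (s i); have [+ _] := n2 i; rewrite /= !ltr_norml; lra.
- by have [_ +] := n1 (s i); have [_ +] := n2 i; rewrite /= !ltr_norml; lra.
Qed.

Lemma near_segz e z z1 z2 t : 0 <= t <= 1 -> near e z z1 -> near e z z2 ->
  near e z (segz t z1 z2).
Proof.
have conv (x y w : R) : 0 <= t <= 1 -> `|x - w| < e -> `|y - w| < e ->
    `|(1 - t) * x + t * y - w| < e.
  move=> t01; rewrite !ltr_norml => /andP[x1 x2] /andP[y1 y2].
  have := @segment_lt t (w - e) x (w - e) y t01; have :=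
    @segment_lt t x (w + e) y (w + e) t01.
  rewrite -!mulrDl subrK !mul1r => h1 h2.
  have /h1 k1 : x < w + e by lra.
  have /h2 k2 : w - e < x by lra.
  have /k1 l1 : y < w + e by lra.
  have /k2 l2 : w - e < y by lra.
  by lra.
by move=> t01 n1 n2 i; have [n11 n12] := n1 i; have [n21 n22] := n2 i; split;
  exact: conv.
Qed.

Lemma near_triangle e e' z z' z'' : near e z z' -> near e' z' z'' ->
  near (e + e') z z''.
Proof.
move=> n1 n2 i; have [n11 n12] := n1 i; have [n21 n22] := n2 i.
by move: n11 n12 n21 n22; rewrite !ltr_norml => *; split; lra.
Qed.

Lemma near_relabel e z z' (s : 'S_3) : near e z z' -> near e (z \o s) (z' \o s).
Proof. by move=> n i; exact: n. Qed.

Lemma nearxx e z : 0 < e -> near e z z.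
Proof. by move=> e0 i; rewrite !subrr normr0. Qed.

End Lex.

Arguments gridz {R} r r' i.
Arguments gridz_lt1 {R}.
Arguments gridz_lexlt {R}.
Arguments gridz_valid {R}.
Arguments rk_gridz {R}.
Arguments gridz_relabel {R}.

(** * The derived quotient of a group generated by positive braids *)

Section SubgroupSets.
Local Open Scope group_scope.
Variable G : groupType.
Implicit Types (A H : set G) (x y : G).

Lemma subgroup_set1 A : subgroup_set A -> A 1.
Proof. by case/subgroup_setP. Qed.

Lemma subgroup_setV A x : subgroup_set A -> A x -> A x^-1.
Proof.
by move=> sA Ax; rewrite -div1g; apply: (proj2 ((subgroup_setP A).1 sA)) => //;
  exact: subgroup_set1.
Qed.

Lemma subgroup_setMV A : A 1 -> (forall x y, A x -> A y -> A (x * y)) ->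
  (forall x, A x -> A x^-1) -> subgroup_set A.
Proof. by move=> A1 AM AV; apply/subgroup_setP; split=> // x y Ax Ay; apply/AM/AV. Qed.

Lemma generated_min A H : subgroup_set H -> (A `<=` H)%classic ->
  (generated A `<=` H)%classic.
Proof. by move=> sH AH x; apply. Qed.

Lemma sub_generated A : (A `<=` generated A)%classic.
Proof. by move=> x Ax H [_]; apply. Qed.

(** Normality in the whole of G, whereas [derived_nextJ] concerns conjugation inside G^(i). *)
Lemma derived_series_conj i x y : derived_series G i x ->
  derived_series G i (y * x * y^-1).
Proof.
elim: i x y => [//|i IH] x y.
apply: (@generated_min _ (fun x => derived_series G i.+1 (y * x * y^-1))) x => [|x [u
  Du [v Dv <-]]].
  apply: subgroup_setMV => [|x z Dx Dz|x Dx].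
  - by rewrite mulg1 mulgV; apply: subgroup_set1; exact: derived_series_subgroup.
  - rewrite (_ : _ * _ = (y * x * y^-1) * (y * z * y^-1)); last by rewrite ?gnorm.
    exact: (subgroup_setM (derived_series_subgroup G i.+1)).
  - rewrite (_ : _ * _ = (y * x * y^-1)^-1); last by rewrite ?gnorm.
    exact: (subgroup_setV (derived_series_subgroup G i.+1)).
rewrite (_ : _ * _ = [~ y * u * y^-1, y * v * y^-1]); last first.
  by rewrite /commg; rewrite ?gnorm.
by apply: derived_series_comm; exact: IH.
Qed.

Definition zpow x (n : int) : G := match n with Posz n => x ^+ n | Negz n => x ^-
  n.+1 end.

Lemma zpowD x : {morph zpow x : m n / (m + n)%R >-> m * n}.
Proof.
have zB (m n : nat) : zpow x (m%:Z - n%:Z)%R = x ^+ m * x ^- n.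
  have [nm|mn] := leqP n m; first by rewrite subzn //= expgnFr.
  rewrite -opprB subzn ?(ltnW mn) //.
  have -> : (- (n - m)%N%:Z)%R = Negz (n - m).-1 by rewrite NegzE prednK // subn_gt0.
  rewrite /= prednK ?subn_gt0 // expgnFr ?(ltnW mn) // invgF.
  by [].
move=> [m|m] [n|n] /=.
- exact: expgnDr.
- by rewrite NegzE -zB.
- have /commuteV xmn : commute (x ^+ n) (x ^+ m.+1).
    by apply: commuteX2; exact: commute_refl.
  by rewrite NegzE addrC zB -xmn.
- by rewrite -invgM -expgnDr addSn addnS addnC.
Qed.

End SubgroupSets.

Section ZpowMorphism.
Local Open Scope group_scope.
Variables (G H : groupType) (f : G -> H).
Hypothesis fM : {morph f : x y / x * y}.

Lemma morph1 : f 1 = 1.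
Proof. by apply: (mulgI (f 1)); rewrite -fM !mulg1. Qed.

Lemma morphV : {morph f : x / x^-1}.
Proof. by move=> x; apply: (mulgI (f x)); rewrite -fM !mulgV morph1. Qed.

Lemma zpow_morph x n : f (zpow x n) = zpow (f x) n.
Proof.
have fX m : f (x ^+ m) = f x ^+ m.
  by elim: m => [|m IH]; rewrite ?expg0 ?morph1 // !expgS fM IH.
by case: n => n /=; rewrite ?morphV fX.
Qed.

End ZpowMorphism.

Definition translations6 (a b c d : int) : affine6 * affine6 :=
  ((0, (a, b)), (0, (c, d))).

Lemma translations6M a b c d a' b' c' d' :
  (translations6 a b c d * translations6 a' b' c' d')%g =
  translations6 (a + a') (b + b') (c + c') (d + d').
Proof.
rewrite /translations6 -[LHS]/(((0 + 0, (a + a', b + b')), (0 + 0, (c + c',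
  d + d'))) : affine6 * affine6).
by rewrite addr0.
Qed.

Lemma zpow_translations6 a b c d n :
  zpow (translations6 a b c d) n = translations6 (a * n) (b * n) (c * n) (d * n).
Proof.
have tX m : (translations6 a b c d ^+ m)%g =
    translations6 (a * m%:Z) (b * m%:Z) (c * m%:Z) (d * m%:Z).
  elim: m => [|m IH]; first by rewrite expg0 !mulr0.
  by rewrite expgS IH translations6M intS !mulrDr !mulr1.
case: n => n /=; rewrite tX // NegzE !mulrN.
set x := a * _; set y := b * _; set z := c * _; set t := d * _.
rewrite /translations6 -[LHS]/(((- 0, (- x, - y)), (- 0, (- z, - t))) :
  affine6 * affine6).
by rewrite oppr0.
Qed.

(** * Four generators of G' modulo G'' *)

Section DerivedGeneration.
Local Open Scope group_scope.
Variables (G : groupType) (rho s r c e0 e1 f0 f1 : G).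
Hypothesis rho_s : rho * s = r * rho.
Hypothesis rho_r : rho * r = c * rho.
Hypothesis rho_c : rho * c = s * rho.
Hypothesis srs : s * r * s = r * s * r.
Hypothesis gen : forall A : set G, subgroup_set A -> A rho -> A s -> forall x, A x.
Hypotheses (e0E : e0 = s * r^-1) (e1E : e1 = r * c^-1).
Hypotheses (f0E : f0 = s * e0 * s^-1) (f1E : f1 = s * e1 * s^-1).

Let J (y x : G) := y * x * y^-1.
Let JM y x z : J y (x * z) = J y x * J y z.
Proof. by rewrite /J; rewrite ?gnorm. Qed.
Let JV y x : J y x^-1 = (J y x)^-1.
Proof. by rewrite /J; rewrite ?gnorm. Qed.
Let J2 y z x : J y (J z x) = J (y * z) x.
Proof. by rewrite /J; rewrite ?gnorm. Qed.
Let J1 x : J 1 x = x.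
Proof. by rewrite /J; rewrite ?gnorm. Qed.

Let Jrho_s : J rho s = r. Proof. by rewrite /J rho_s mulgK. Qed.
Let Jrho_r : J rho r = c. Proof. by rewrite /J rho_r mulgK. Qed.
Let Jrho_c : J rho c = s. Proof. by rewrite /J rho_c mulgK. Qed.

Let rcr : r * c * r = c * r * c.
Proof. by rewrite -Jrho_s -Jrho_r -!JM srs. Qed.

(* The braid relation x y x = y x y says that conjugation by x acts on x / y
   as a root of t^2 - t + 1. *)
Let braid_conj x y : x * y * x = y * x * y ->
  J x (J x (x * y^-1)) = J x (x * y^-1) * (x * y^-1)^-1.
Proof.
move=> xyx; have xyV : x * y^-1 * x^-1 = y^-1 * x^-1 * y.
  have -> : x * y^-1 * x^-1 = y^-1 * x^-1 * (x * y * x) * (y^-1 * x^-1).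
    by rewrite ?gnorm.
  by rewrite xyx; rewrite ?gnorm.
rewrite (_ : J x _ = x * x * (x * y^-1 * x^-1) * x^-1); last by rewrite /J;
  rewrite ?gnorm.
by rewrite xyV /J; rewrite ?gnorm.
Qed.

(** The aim is that [N] is normal with commutative quotient, which forces it to contain G'. *)
Let N := generated ([set e0; e1; f0; f1] `|` derived_series G 2)%classic.

Let sN : subgroup_set N. Proof. exact: generated_subgroup. Qed.
Let N1 : N 1. Proof. exact: subgroup_set1. Qed.
Let NM x y : N x -> N y -> N (x * y). Proof. exact: subgroup_setM. Qed.
Let NV x : N x -> N x^-1. Proof. exact: subgroup_setV. Qed.
Let Ne0 : N e0. Proof. by apply: sub_generated; left; left; left; left. Qed.
Let Ne1 : N e1. Proof. by apply: sub_generated; left; left; left; right. Qed.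
Let Nf0 : N f0. Proof. by apply: sub_generated; left; left; right. Qed.
Let Nf1 : N f1. Proof. by apply: sub_generated; left; right. Qed.
Let ND x : derived_series G 2 x -> N x. Proof. by move=> Dx; apply: sub_generated;
  right. Qed.
Let NJ x y : N x -> N y -> N (J y x). Proof. by move=> Nx Ny; rewrite /J;
  do ?apply: NM => //; exact: NV. Qed.

Let stable y : N (J y e0) -> N (J y e1) -> N (J y f0) -> N (J y f1) ->
  forall x, N x -> N (J y x).
Proof.
move=> y0 y1 z0 z1; apply: generated_min => [|x [[[[|]|]|]|Dx]]; try by move->.
  apply: subgroup_setMV => [|x z Nx Nz|x Nx].
  - by rewrite /J mulg1 mulgV.
  - by rewrite JM; exact: NM.
  - by rewrite JV; exact: NV.
by apply: ND; exact: derived_series_conj.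
Qed.

Let sE : s = e0 * r. Proof. by rewrite e0E mulgVK. Qed.
Let f0J : f0 = J s e0. Proof. by rewrite f0E. Qed.
Let f1J : f1 = J s e1. Proof. by rewrite f1E. Qed.

Let Jsf0 : J s f0 = f0 * e0^-1.
Proof. by rewrite f0J e0E (braid_conj srs). Qed.

Let Jre1 : J r e1 = J e0^-1 f1.
Proof. by rewrite f1J J2 sE mulKg. Qed.

Let NJre1 : N (J r e1). Proof. by rewrite Jre1; apply: NJ => //; exact: NV. Qed.

Let JrJre1 : J r (J r e1) = J r e1 * e1^-1.
Proof. by rewrite e1E (braid_conj rcr). Qed.

Let stable_s x : N x -> N (J s x).
Proof.
apply: stable; rewrite -?f0J -?f1J //.
- by rewrite Jsf0; apply: NM => //; exact: NV.
(* From [s = e0 * r] one gets s^2 = e0 (r e0 r^-1) r^2; conjugation by r^2 is then covered by the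
   quadratic relation of r on [e1]. *)
- have -> : J s f1 = J e0 (J (J r e0) (J r (J r e1))).
    rewrite f1J !J2; congr (J _ e1); rewrite sE /J; rewrite ?gnorm.
    by [].
  have Ns y : N y -> N (J e0 y) by move=> Ny; exact: NJ.
  have NJre0 : N (J r e0).
    have -> : J r e0 = J e0^-1 f0 by rewrite f0J J2 sE mulKg.
    by apply: NJ => //; exact: NV.
  apply: Ns; apply: NJ => //; rewrite JrJre1; apply: NM => //; exact: NV.
Qed.

(** Conjugation by s could a priori map [N] onto a proper subgroup, so its inverse needs an
    argument. The constant term of t^2 - t + 1 is a unit, which expresses [e0] through [f0] and its
    conjugate by s. *)
Let stable_sV x : N x -> N (J s^-1 x).
Proof.
have JsVf0 : J s^-1 f0 = e0 by rewrite f0J J2 mulVg J1.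
have JsVf1 : J s^-1 f1 = e1 by rewrite f1J J2 mulVg J1.
have NsV : N (J s^-1 e0).
  have -> : e0 = (J s f0)^-1 * f0 by rewrite Jsf0; rewrite ?gnorm.
  by rewrite JM JV J2 mulVg J1 JsVf0; apply: NM => //; exact: NV.
apply: stable; rewrite ?JsVf0 ?JsVf1 //.
(* Again from [s = e0 * r]: s^-1 = (s^-1 e0 s)^-1 r^-1. *)
have rVsV : J s^-1 e1 = J (J s^-1 e0)^-1 (J r^-1 e1).
  by rewrite J2 /J; rewrite ?gnorm; rewrite e0E; rewrite ?gnorm.
rewrite rVsV; apply: NJ; last exact: NV.
have -> : J r^-1 e1 = (J r e1)^-1 * e1.
  have := congr1 (J r^-1) JrJre1.
  by rewrite JM JV [J r^-1 (J r (J r e1))]J2 [J r^-1 (J r e1)]J2 mulVg !J1 => ->;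
    rewrite ?gnorm.
by apply: NM => //; exact: NV.
Qed.

Let Jrho_e1 : J rho e1 = (e0 * e1)^-1.
Proof. by rewrite e1E JM JV Jrho_r Jrho_c e0E; rewrite ?gnorm. Qed.

Let stable_rho x : N x -> N (J rho x).
Proof.
have Jrho_e0 : J rho e0 = e1 by rewrite e0E JM JV Jrho_s Jrho_r e1E.
have JrhoJs y : J rho (J s y) = J r (J rho y) by rewrite !J2 rho_s.
apply: stable.
- by rewrite Jrho_e0.
- by rewrite Jrho_e1; apply: NV; exact: NM.
- by rewrite f0J JrhoJs Jrho_e0.
- rewrite f1J JrhoJs Jrho_e1 JV JM; apply: NV; apply: NM => //.
  have -> : J r e0 = J e0^-1 f0 by rewrite f0J J2 sE mulKg.
  by apply: NJ => //; exact: NV.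
Qed.

(** Conjugation by [rho] has period 3 on s, r, c, so rho^3 commutes with the generators [rho] and
    [s]. Conjugation by rho^-1 is therefore conjugation by rho^2. *)
Let rho3_comm x : J (rho * rho * rho) x = x.
Proof.
apply: (gen (A := fun x => J (rho * rho * rho) x = x)).
- apply: subgroup_setMV => [|y z yE zE|y yE]; first by rewrite /J mulg1 mulgV.
    by rewrite JM yE zE.
  by rewrite JV yE.
- by rewrite /J; rewrite ?gnorm.
- by rewrite -!J2 Jrho_s Jrho_r Jrho_c.
Qed.

Let stable_rhoV x : N x -> N (J rho^-1 x).
Proof.
move=> Nx; rewrite -[x]rho3_comm J2 (_ : _ * _ = rho * rho); last by rewrite ?gnorm.
by rewrite -J2; do 2!apply: stable_rho.
Qed.

Let normal_N x y : N x -> N (J y x).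
Proof.
move: x; pose A y := forall x, (N x -> N (J y x)) /\ (N x -> N (J y^-1 x)).
suff: A y by move=> Ay x; case: (Ay x).
apply: (gen (A := A)) => [||x]; last 2 first.
- by move=> x; split; [exact: stable_rho | exact: stable_rhoV].
- by split; [exact: stable_s | exact: stable_sV].
apply: subgroup_setMV => [x|u v Au Av x|u Au x]; first by rewrite invg1 J1.
  rewrite invgM -!J2; split=> Nx.
    by apply: (Au _).1; apply: (Av _).1.
  by apply: (Av _).2; apply: (Au _).2.
by rewrite invgK; case: (Au x).
Qed.

Let normal_NJ x y : N x -> N (x ^ y)%g.
Proof. by move=> Nx; have := normal_N y^-1 Nx; rewrite /J invgK conjgE mulgA. Qed.

Let K := NormalSubgroup sN normal_NJ.
Let q (x : G) : quotient_group K := coset_class K x.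
Let qM : {morph q : x y / x * y}. Proof. by move=> x y; rewrite /q -coset_mulE. Qed.
Let qV : {morph q : x / x^-1}. Proof. by move=> x; rewrite /q -coset_invE. Qed.
Let q1 : q 1 = 1. Proof. by []. Qed.

(** It is enough that the two generators commute modulo [N]; centralizers being subgroups, this
    spreads to one argument and then to the other. *)
Let quotient_comm x y : commute (q x) (q y).
Proof.
have comm_sub z : subgroup_set (fun y => commute (q z) (q y)).
  apply: subgroup_setMV => [|u v|u]; rewrite ?q1 ?qM ?qV.
  - exact: commute1.
  - exact: commuteM.
  - exact: commuteV.
have rs : commute (q rho) (q s).
  rewrite /commute -!qM; apply/coset_classP => /=.
  (* Both sides are s^-1 c. *)
  have -> : (rho * s)^-1 * (s * rho) = J s^-1 (J rho e1).
    rewrite e1E JM JV Jrho_r Jrho_c -(mulKg rho c) rho_c /J; rewrite ?gnorm.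
    by [].
  exact: (@normal_N (J rho e1) s^-1 (@normal_N e1 rho Ne1)).
have rx z : commute (q rho) (q z) by apply: (gen (A := fun z => commute (q rho) (q z))).
have sx z : commute (q s) (q z).
  by apply: (gen (A := fun z => commute (q s) (q z))) => //; exact: commute_sym.
by apply: (gen (A := fun y => commute (q x) (q y))) => //; exact: commute_sym.
Qed.

Lemma derived1_sub : (derived_series G 1 `<=`
  generated ([set e0; e1; f0; f1] `|` derived_series G 2))%classic.
Proof.
apply: generated_min => // x [u _ [v _ <-]].
have : q 1 = q [~ u, v].
  by rewrite q1 /commg !qM !qV; have /commgP/eqP/esym := quotient_comm u v.
by move/coset_classP; rewrite invg1 mul1g.
Qed.

Lemma derived1_gens : [/\ derived_series G 1 e0, derived_series G 1 e1,
  derived_series G 1 f0 & derived_series G 1 f1].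
Proof.
have D0 : derived_series G 1 e0.
  rewrite e0E (_ : _ * _ = [~ s^-1, rho^-1]); first exact: derived_series_comm.
  by rewrite -Jrho_s /J /commg; rewrite ?gnorm.
have D1 : derived_series G 1 e1.
  suff -> : e1 = rho * e0 * rho^-1 by exact: derived_series_conj.
  by rewrite -[RHS]/(J rho e0) e0E JM JV Jrho_s Jrho_r e1E.
by split=> //; rewrite ?f0E ?f1E; exact: derived_series_conj.
Qed.

End DerivedGeneration.

(** * Relations between positive braids and the isomorphism with Z^4 *)

Section AlgebraicPart.
Local Open Scope group_scope.
Variables (G : groupType) (b : nat -> seq nat -> G).
Hypothesis bM : forall j w w', (j < 4)%N -> is_perm4 w -> is_perm4 w' ->
  inversions_add w w' -> b j (perm4_comp w w') = b j w * b (nth 0 w j) w'.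
Hypothesis b_gauge : forall i, (i < 3)%N -> b i (adj_perm i) = 1.
Hypothesis b_gen : forall A : set G, subgroup_set A ->
  (forall j w, (j < 4)%N -> is_perm4 w -> A (b j w)) -> forall x, A x.

(** In the groupoid of puncture positions this is a morphism from j to [adj_swap i j]. Relations
    hold between composable morphisms; the gauge turns them into relations between s, r and T. *)
Let sg j i := b j (adj_perm i).
Let s := sg 0 1.
Let r := sg 0 2.
Let T := sg 1 0.

Let bM3 j w1 w2 w3 : (j < 4)%N -> is_perm4 w1 -> is_perm4 w2 -> is_perm4 w3 ->
  is_perm4 (perm4_comp w2 w3) ->
  inversions_add w1 (perm4_comp w2 w3) -> inversions_add w2 w3 ->
  (nth 0 w1 j < 4)%N ->
  b j (perm4_comp w1 (perm4_comp w2 w3)) =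
  b j w1 * b (nth 0 w1 j) w2 * b (nth 0 w2 (nth 0 w1 j)) w3.
Proof. by move=> *; rewrite !bM // mulgA. Qed.

(** The reversal of three consecutive positions has two reduced words, and multiplicativity
    evaluates [b] along both. *)
Let sg_braid (j i k : nat) : (j < 4)%N -> (i, k) \in [:: (0, 1); (1, 2)]%N ->
  sg j i * sg (adj_swap i j) k * sg (adj_swap k (adj_swap i j)) i =
  sg j k * sg (adj_swap k j) i * sg (adj_swap i (adj_swap k j)) k.
Proof.
move=> j4; rewrite !inE => /orP[] /eqP[-> ->].
  have := @bM3 j (adj_perm 0) (adj_perm 1) (adj_perm 0) j4 isT isT isT isT isT isT.
  have := @bM3 j (adj_perm 1) (adj_perm 0) (adj_perm 1) j4 isT isT isT isT isT isT.
  by case: j j4 => [|[|[|[|//]]]] _ /(_ isT) <- /(_ isT) <-.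
have := @bM3 j (adj_perm 1) (adj_perm 2) (adj_perm 1) j4 isT isT isT isT isT isT.
have := @bM3 j (adj_perm 2) (adj_perm 1) (adj_perm 2) j4 isT isT isT isT isT isT.
by case: j j4 => [|[|[|[|//]]]] _ /(_ isT) <- /(_ isT) <-.
Qed.

Let sg_comm j : (j < 4)%N ->
  sg j 0 * sg (adj_swap 0 j) 2 = sg j 2 * sg (adj_swap 2 j) 0.
Proof.
move=> j4; have := @bM j (adj_perm 0) (adj_perm 2) j4 isT isT isT.
have := @bM j (adj_perm 2) (adj_perm 0) j4 isT isT isT.
by case: j j4 => [|[|[|[|//]]]] _ <- <-.
Qed.

Let sg00 : sg 0 0 = 1. Proof. exact: (b_gauge (i := 0)). Qed.
Let sg11 : sg 1 1 = 1. Proof. exact: (b_gauge (i := 1)). Qed.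
Let sg22 : sg 2 2 = 1. Proof. exact: (b_gauge (i := 2)). Qed.

(** With the gauge crossings equal to 1, the braid relations at the various puncture positions
    reduce every [sg j i] to s, r, T or a conjugate of T. The table [crossing] has the same form. *)
Let sg20 : sg 2 0 = s.
Proof. by have := @sg_braid 0 0 1 isT isT; rewrite /= sg00 sg11 !mulg1 !mul1g. Qed.
Let sg12 : sg 1 2 = r.
Proof. by have := @sg_comm 0 isT; rewrite /= sg00 mulg1 mul1g. Qed.
Let sg31 : sg 3 1 = r.
Proof. by have := @sg_braid 1 1 2 isT isT; rewrite /= sg11 sg22 sg12 !mulg1 !mul1g. Qed.
Let sg30 : sg 3 0 = s.
Proof. by have := @sg_comm 2 isT; rewrite /= sg22 sg20 mulg1 mul1g. Qed.
Let sg21 : s * sg 2 1 = T * s.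
Proof. by have := @sg_braid 1 0 1 isT isT; rewrite /= sg11 sg00 sg20 mulg1 mul1g. Qed.
Let sg32 : r * sg 3 2 = sg 2 1 * r.
Proof. by have := @sg_braid 2 1 2 isT isT;
  rewrite /= sg11 sg22 sg12 sg31 mulg1 mul1g. Qed.

Let srs : s * r * s = r * s * r.
Proof. by have := @sg_braid 0 1 2 isT isT. Qed.
Let Tr : T * r = r * T.
Proof. by have := @sg_comm 1 isT; rewrite /= sg12. Qed.
Let sTsT : s * T * s * T = T * s * T * s.
Proof.
(* The braid relation with the puncture at position 2, multiplied by s on the left; [sg21] then
   removes [sg 2 1]. *)
have := @sg_braid 2 0 1 isT isT; rewrite /= sg20 -/T -/s => e.
by rewrite -(mulgA s T) -sg21 -!mulgA (mulgA s (sg 2 1)) e !mulgA sg21.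
Qed.

Let b_id j : (j < 4)%N -> b j (iota 0 4) = 1.
Proof.
move=> j4; have := @bM j (iota 0 4) (iota 0 4) j4 isT isT isT.
by rewrite nth_iota // -[X in X = _]mulg1 => /mulgI.
Qed.

Let gen3 (A : set G) : subgroup_set A -> A T -> A s -> A r -> forall x, A x.
Proof.
move=> sA AT As Ar; apply: b_gen => // j w j4.
have A1 := subgroup_set1 sA; have AM := subgroup_setM sA.
have AV x := @subgroup_setV _ _ x sA.
have A21 : A (sg 2 1) by rewrite -(mulKg s (sg 2 1)) sg21; apply: (AM _ _ (AV _ As));
  exact: AM.
have Asg k i : (k < 4)%N -> (i < 3)%N -> A (sg k i).
  move: k i => [|[|[|[|//]]]] [|[|[|//]]] _ _ //;
    rewrite ?sg00 ?sg11 ?sg22 ?sg20 ?sg12 ?sg31 ?sg30 //.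
  by rewrite -(mulKg r (sg 3 2)) sg32; apply: (AM _ _ (AV _ Ar)); exact: AM.
have [n] := ubnP (inversion_count w); elim: n => // n IH in j j4 w * => wn pw.
have [->|/eqP wid] := eqVneq w (iota 0 4); first by rewrite b_id.
have [i [w' [i3 pw' ww' ad lt]]] := perm4_descent pw wid.
have pi : is_perm4 (adj_perm i) by case: i i3 {ww' ad} => [|[|[|//]]].
rewrite -ww' bM //; apply: AM; first exact: Asg.
apply: IH => //; last exact: leq_trans lt _.
by case: i i3 {ww' ad pi} => [|[|[|//]]] _; case: j j4 => [|[|[|[|//]]]].
Qed.

Let rho := b 1 (adj_perm 0) * b 0 (adj_perm 1) * b 0 (adj_perm 2).
Let c := rho * r * rho^-1.

Let rho_s : rho * s = r * rho.
Proof.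
by rewrite /rho -/T -/s -/r -!mulgA (mulgA s r s) srs -!mulgA (mulgA T) Tr -!mulgA.
Qed.

Let rho_c : rho * c = s * rho.
Proof.
(* After multiplication by [rho] on the right the claim reads rho^2 r = s rho^2, which this form of
   rho^2 reduces to [sTsT] and [srs]. *)
have rho2 : rho * rho = T * s * T * (s * (r * s)).
  by rewrite (mulgA s) srs /rho -/T -/s -/r -!mulgA (mulgA r T) -Tr -!mulgA.
apply: (mulIg rho); rewrite -[in LHS]mulgA [c * rho]mulgVK mulgA rho2.
rewrite -(mulgA s rho) rho2 !mulgA sTsT -!mulgA; do 4!congr (_ * _).
by rewrite !mulgA srs.
Qed.

Let e0 := s * r^-1.
Let e1 := r * c^-1.
Let f0 := s * e0 * s^-1.
Let f1 := s * e1 * s^-1.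

Let gen2 (A : set G) : subgroup_set A -> A rho -> A s -> forall x, A x.
Proof.
move=> sA Arho As.
have rE : r = rho * s * rho^-1 by rewrite rho_s mulgK.
have Ar : A r.
  by rewrite rE; do 2?[apply: subgroup_setM => //]; exact: subgroup_setV.
apply: gen3 => //.
have -> : T = rho * (s * r)^-1 by rewrite -[rho]/(T * s * r) -(mulgA T s r) mulgK.
by apply: subgroup_setM => //; apply: subgroup_setV => //; exact: subgroup_setM.
Qed.

Let rho_r : rho * r = c * rho. Proof. by rewrite /c mulgVK. Qed.

Let D1sub := derived1_sub rho_s rho_r rho_c srs gen2 erefl erefl erefl erefl.
Let Dgens := derived1_gens rho_s rho_r (erefl : e0 = _) (erefl : e1 = _) (erefl :
  f0 = _) (erefl : f1 = _).

Let A := derived_quotient G 1.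
Let lift x (Dx : derived_series G 1 x) : derived_group G 1 := SigSub (mem_set Dx).
Let cls (x : derived_group G 1) : A := coset_class (derived_next G 1) x.
Let clsM : {morph cls : x y / x * y}. Proof. by move=> x y; rewrite /cls -coset_mulE.
  Qed.

Let A_comm (x y : A) : commute x y.
Proof.
rewrite -(coset_classK x) -(coset_classK y) -[coset_class _ (repr x)]/(cls _)
  -[coset_class _ (repr y)]/(cls _).
rewrite /commute -!clsM; apply/coset_classP => /=.
move: (repr x) (repr y) => u v.
rewrite /derived_next_set /mkset (_ : \val _ = [~ \val v, \val u]).
  by apply: derived_series_comm; exact: set_mem (valP _).
rewrite -[LHS]/((\val u * \val v)^-1 * (\val v * \val u)).
by rewrite invgM /commg conjgE !mulgA.
Qed.

Let De0 : derived_series G 1 e0. Proof. by case: Dgens. Qed.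
Let De1 : derived_series G 1 e1. Proof. by case: Dgens. Qed.
Let Df0 : derived_series G 1 f0. Proof. by case: Dgens. Qed.
Let Df1 : derived_series G 1 f1. Proof. by case: Dgens. Qed.

Let word (H : groupType) (a b c d : H) (v : 'rV[int]_4) : H :=
  zpow a (v ord0 (inord 0)) * zpow b (v ord0 (inord 1)) * zpow c (v ord0 (inord 2)) *
    zpow d (v ord0 (inord 3)).

Let word_morph (H K : groupType) (f : H -> K) (x y z t : H) v : {morph f :
  x y / x * y} ->
  f (word x y z t v) = word (f x) (f y) (f z) (f t) v.
Proof. by move=> fM; rewrite /word !fM !(zpow_morph fM). Qed.

Let X v := word (lift De0) (lift De1) (lift Df0) (lift Df1) v.
Let psi (v : 'rV[int]_4) : A := cls (X v).

Let psiE v : psi v = word (cls (lift De0)) (cls (lift De1)) (cls (lift Df0)) (cls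
  (lift Df1)) v.
Proof. exact: word_morph. Qed.

Let psiM v w : psi (v + w)%R = psi v * psi w.
Proof.
have ACA (x y z t : A) : (x * y) * (z * t) = (x * z) * (y * t).
  by rewrite !mulgA -(mulgA x) (A_comm y z) mulgA.
rewrite !psiE /word !mxE !zpowD [RHS]ACA; congr (_ * _).
by rewrite [RHS]ACA; congr (_ * _); rewrite [RHS]ACA.
Qed.

Let psi0 : psi 0%R = 1.
Proof. by apply: (mulgI (psi 0%R)); rewrite -psiM addr0 mulg1. Qed.

Let psiV v : psi (- v)%R = (psi v)^-1.
Proof. by apply: (mulgI (psi v)); rewrite -psiM addrN mulgV psi0. Qed.

Let word_delta (H : groupType) (x y z t : H) :
  let w i := word x y z t (delta_mx ord0 (inord i)) in
  [/\ w 0%N = x, w 1%N = y, w 2%N = z & w 3%N = t].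
Proof.
have e (i j : nat) : (i < 4)%N -> (j < 4)%N -> (delta_mx ord0 (inord j) :
  'rV[int]_4) ord0 (inord i) = (i == j)%:R%R.
  by move=> i4 j4; rewrite mxE /= -val_eqE /= !inordK.
by split; rewrite /word !e //= ?expg0 ?expg1 ?mulg1 ?mul1g.
Qed.

Let psi_surj a : exists v, psi v = a.
Proof.
(* The membership proof is bundled into the predicate because the class of x in [A] can only be
   formed from it. *)
pose B x := exists2 Dx : derived_series G 1 x, True & exists v, psi v = cls (lift Dx).
suff BD x : derived_series G 1 x -> B x.
  rewrite -(coset_classK a); case: (repr a) => x px.
  have [Dx _ [v vE]] := BD _ (set_mem px); exists v; rewrite vE.
  by congr (cls _); exact: val_inj.
move=> /D1sub; apply: generated_min x => [|x].
  have sD := derived_series_subgroup G 1.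
  apply: subgroup_setMV => [|x y [Dx _ [v vE]] [Dy _ [w wE]]|x [Dx _ [v vE]]].
  - exists (subgroup_set1 sD) => //; exists 0%R; rewrite psi0.
    by rewrite -(morph1 clsM); congr (cls _); exact: val_inj.
  - exists (subgroup_setM sD Dx Dy) => //; exists (v + w)%R; rewrite psiM vE wE -clsM.
    by congr (cls _); exact: val_inj.
  - exists (subgroup_setV sD Dx) => //; exists (- v)%R; rewrite psiV vE -(morphV clsM).
    by congr (cls _); exact: val_inj.
have [d0 d1 d2 d3] := word_delta (cls (lift De0)) (cls (lift De1)) (cls (lift Df0))
  (cls (lift Df1)).
case=> [[[[|]|]|]|D2].
- by move=> ->; exists De0 => //; exists (delta_mx ord0 (inord 0)); rewrite psiE d0.
- by move=> ->; exists De1 => //; exists (delta_mx ord0 (inord 1)); rewrite psiE d1.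
- by move=> ->; exists Df0 => //; exists (delta_mx ord0 (inord 2)); rewrite psiE d2.
- by move=> ->; exists Df1 => //; exists (delta_mx ord0 (inord 3)); rewrite psiE d3.
have D1 : derived_series G 1 x.
  apply: generated_min D2 => [|y [u _ [v _ <-]]]; first exact: generated_subgroup.
  exact: derived_series_comm.
exists D1 => //; exists 0%R; rewrite psi0 -(morph1 clsM).
by apply/coset_classP; rewrite invg1 mul1g.
Qed.

Variable Phi : G -> affine6 * affine6.
Hypothesis PhiM : {morph Phi : x y / x * y}.
Hypothesis Phi_b : forall j w, (j < 4)%N -> is_perm4 w ->
  Phi (b j w) = (braid_value true j w, braid_value false j w).

(** In both factors [e0] goes to -1; [e1] is its image under t^2, respectively t^4, and [f0], [f1]
    are the t-multiples of [e0], [e1]. *)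
Let Phi_gens :
  [/\ Phi e0 = translations6 (-1) 0 (-1) 0, Phi e1 = translations6 1 (-1) 0 1,
      Phi f0 = translations6 0 (-1) 0 (-1) & Phi f1 = translations6 1 0 (-1) 1].
Proof.
have PV := morphV PhiM.
rewrite /f1 /f0 /e1 /e0 /c /rho /s /r /sg !(PhiM, PV) !Phi_b //.
by split; apply/eqP; vm_compute.
Qed.

Let lin (x : affine6 * affine6) : 'Z_6 * 'Z_6 := (x.1.1, x.2.1).
Let linM x y : lin (x * y) = (lin x + lin y)%R. Proof. by []. Qed.
Let linV x : lin x^-1 = (- lin x)%R. Proof. by []. Qed.

(** Linear parts form an abelian group, so G' lands in the translations; as these commute, G'' is
    killed. *)
Let Phi_D1 x : derived_series G 1 x -> lin (Phi x) = 0%R.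
Proof.
apply: (@generated_min _ _ (fun x => lin (Phi x) = 0%R)) x => [|x [u _ [v _ <-]]].
  apply: subgroup_setMV => [|x y|x].
  - by rewrite (morph1 PhiM).
  - by rewrite PhiM linM => -> ->; rewrite addr0.
  - by rewrite (morphV PhiM) linV => ->; rewrite oppr0.
rewrite /commg conjgE !PhiM !(morphV PhiM) !linM !linV.
by rewrite (addrCA (- lin (Phi v))%R) !addrA addNr add0r addNr.
Qed.

Let Phi_D2 x : derived_series G 2 x -> Phi x = 1.
Proof.
apply: (@generated_min _ _ (fun x => Phi x = 1)) x => [|x [u Du [v Dv <-]]].
  apply: subgroup_setMV => [|x y|x].
  - by rewrite (morph1 PhiM).
  - by rewrite PhiM => -> ->; rewrite mulg1.
  - by rewrite (morphV PhiM) => ->; rewrite invg1.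
suff : commute (Phi u) (Phi v) by move/commgP/eqP; rewrite /commg !PhiM !(morphV PhiM).
move/Phi_D1: Du; move/Phi_D1: Dv.
case: (Phi u) (Phi v) => [[d p] [d' p']] [[l q] [l' q']] [-> ->] [-> ->].
by congr ((_, _), (_, _)); rewrite /= addrC.
Qed.

Let psi_inj : injective psi.
Proof.
have [P0 P1 P2 P3] := Phi_gens.
have PX v : Phi (\val (X v)) = word (Phi e0) (Phi e1) (Phi f0) (Phi f1) v.
  by rewrite -[LHS]/((Phi \o \val) (X v)); apply: word_morph => x y /=; rewrite -PhiM.
move=> v w /coset_classP /=; rewrite /derived_next_set /mkset => /Phi_D2.
rewrite -[X in Phi X]/((\val (X v))^-1 * \val (X w)) PhiM (morphV PhiM).
move=> /mulg1_eq; rewrite invgK !PX P0 P1 P2 P3 => vw.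
move: vw; rewrite /word !zpow_translations6 !translations6M;
  rewrite /translations6 => -[E1 E2 E3 E4].
(* The four image vectors have determinant 3 up to sign: they are independent but span only a
   sublattice of index 3, so this map serves injectivity alone. *)
have [F0 F1 F2 F3] : [/\ v ord0 (inord 0) = w ord0 (inord 0), v ord0 (inord 1) =
  w ord0 (inord 1),
    v ord0 (inord 2) = w ord0 (inord 2) & v ord0 (inord 3) = w ord0 (inord 3)].
  by split; lia.
apply/matrixP => i j; rewrite (ord1 i) -[j]inord_val.
by case: j => -[|[|[|[|//]]]].
Qed.

Lemma derived_quotient_braid :
  group_isomorphic (derived_quotient G 1) (Algebra.to_multiplicative 'rV[int]_4).
Proof.
have [f fK] := choice psi_surj.
have psiK : cancel psi f by move=> v; exact/psi_inj/fK.
have fM (x y : A) : f (x * y) = (f x + f y)%R.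
  by apply: psi_inj; rewrite fK psiM !fK.
pose m := isMultiplicative.Build A (Algebra.to_multiplicative 'rV[int]_4) f fM.
pose F : {multiplicative A -> Algebra.to_multiplicative 'rV[int]_4} := HB.pack f m.
by exists F; exists psi.
Qed.

End AlgebraicPart.

(** * Holonomy of a local cocycle *)

Import numFieldNormedType.Exports.
Local Open Scope classical_set_scope.

(** A substitute for compactness: the supremum of the points reachable from l is itself reachable
    and cannot lie below u. Local intervals contain their centre x, which suits data that can only
    be compared with a centre. *)
Lemma interval_induction (R : realType) (Q : R -> R -> Prop) (l u : R) : l <= u ->
  (forall a b c, a <= b -> b <= c -> Q a b -> Q b c -> Q a c) ->
  (forall x, l <= x <= u -> exists2 e, 0 < e & forall a b,
     l <= a -> a <= x -> x <= b -> b <= u -> x - e < a -> b < x + e -> Q a b) ->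
  Q l u.
Proof.
move=> lu Qtrans Qloc; pose S := [set x | l <= x <= u /\ Q l x].
have Sl : S l.
  split; first by rewrite lexx.
  have [|e e0 H] := Qloc l; first by rewrite lexx.
  by apply: H => //; rewrite ?ltrBlDr ?ltrDl.
have hS : has_sup S by split; [exists l | exists u => x [/andP[]]].
have ls : l <= sup S by exact: (sup_upper_bound hS).
have su : sup S <= u by apply: ge_sup; [exists l | move=> x [/andP[]]].
have [|e e0 H] := Qloc (sup S); first by rewrite ls.
have [y [/andP[ly yu] Qy] sy] := sup_adherent e0 hS.
have ys : y <= sup S by apply: (sup_upper_bound hS); split=> //; rewrite ly.
have ext b : sup S <= b -> b <= u -> b < sup S + e -> Q l b.
  by move=> sb bu be; apply: (Qtrans _ y) => //; [exact: le_trans sb | exact: H].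
have [us|us] := leP u (sup S); first by apply: ext => //;
  rewrite (le_lt_trans us) // ltrDl.
pose b := Num.min u (sup S + e / 2).
have sb : sup S < b by rewrite lt_min us ltrDl divr_gt0.
have bu : b <= u by rewrite ge_min lexx.
suff : b <= sup S by rewrite leNgt sb.
apply: (sup_upper_bound hS).
split; first by rewrite (le_trans ls) ?bu // ltW.
apply: ext => //; first exact: ltW.
by rewrite gt_min; apply/orP; right; rewrite ltrD2l; lra.
Qed.

(** * Parallel transport along a local cocycle *)

Section Parallel.
Local Open Scope group_scope.
Variables (R : realType) (X : topologicalType) (Gam : groupType) (c : X -> X -> Gam).
Local Notation I := (unitI R).

(** [c x x'] is meaningful for x' close to x, with a closeness that depends on x. Hence v is
    compared with the centre u, never the other way round. *)
Definition parallel (T : topologicalType) (f : T -> X) (D : set T) (g : T -> Gam) :=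
  forall u, D u -> \forall v \near u, D v -> g v = g u * c (f u) (f v).

Lemma parallelS (T : topologicalType) (f : T -> X) (D D' : set T) g :
  D' `<=` D -> parallel f D g -> parallel f D' g.
Proof.
by move=> DD p u /DD /p; apply: filterS => v H /DD.
Qed.

(** Near each point both functions are multiplied on the right by the same factor, so their ratio is
    locally constant. *)
Lemma parallel_ratio (T : topologicalType) (f : T -> X) (D : set T) g1 g2
    (s : R -> T) (l u : R) : continuous s -> (l <= u)%R ->
  (forall t, (l <= t <= u)%R -> D (s t)) ->
  parallel f D g1 -> parallel f D g2 ->
  g1 (s l) / g2 (s l) = g1 (s u) / g2 (s u).
Proof.
move=> cs lu sD p1 p2.
apply: (interval_induction (Q := fun a b => g1 (s a) / g2 (s a) =
  g1 (s b) / g2 (s b))) => //.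
  by move=> x y z _ _ -> ->.
move=> x xlu.
have : \forall y \near x, D (s y) -> g1 (s y) / g2 (s y) = g1 (s x) / g2 (s x).
  near=> y => Dy.
  have -> : g1 (s y) = g1 (s x) * c (f (s x)) (f (s y)).
    by move: Dy; near: y; exact: (cs x _ (p1 _ (sD _ xlu))).
  have -> : g2 (s y) = g2 (s x) * c (f (s x)) (f (s y)).
    by move: Dy; near: y; exact: (cs x _ (p2 _ (sD _ xlu))).
  rewrite invgM.
  by rewrite !mulgA mulgK.
move=> /nbhs_ballP[e /= e0 H]; exists e => // a b la ax xb bu ea be.
rewrite !H //; try by apply: sD; lra.
all: by rewrite /ball /= ltr_norml; lra.
Unshelve. all: by end_near.
Qed.

(** Left multiplication preserves parallelism, so a single constant matches the two pieces along the
    wall k = b. *)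
Lemma parallel_glue (T : topologicalType) (f : T -> X) (D : set T) (k : T ->
  R) (b : R) g1 g2 :
  continuous k ->
  parallel f [set u | D u /\ (k u <= b)%R] g1 ->
    parallel f [set u | D u /\ (b <= k u)%R] g2 ->
  (forall u v, D u -> D v -> k u = b -> k v = b -> g1 u / g2 u = g1 v / g2 v) ->
  exists g, parallel f D g.
Proof.
move=> ck p1 p2 rat.
pose w := xget 1 [set w : Gam | forall u, D u -> k u = b -> g1 u = w * g2 u].
have wE u : D u -> k u = b -> g1 u = w * g2 u.
  move=> Du ku; apply: (@xgetPex _ _ [set w : Gam | forall u, D u -> k u = b ->
    g1 u = w * g2 u]) => //.
  by exists (g1 u / g2 u) => v Dv kv; rewrite (rat u v) // mulgVK.
exists (fun u => if (k u <= b)%R then g1 u else w * g2 u) => u Du.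
have [ku|ku|ku] := ltgtP (k u) b.
- have near1 : \forall v \near u, (k v < b)%R by exact: (ck u _ (lt_nbhsl ku)).
  near=> v => Dv; have kv : (k v < b)%R by near: v.
  rewrite (ltW kv); have : [set u | D u /\ (k u <= b)%R] v by split=> //; exact: ltW.
  by near: v; apply: p1; split=> //; exact: ltW.
- have near1 : \forall v \near u, (b < k v)%R by exact: (ck u _ (lt_nbhsr ku)).
  near=> v => Dv; have kv : (b < k v)%R by near: v.
  rewrite leNgt kv /= -mulgA; congr (w * _).
  have : [set u | D u /\ (b <= k u)%R] v by split=> //; exact: ltW.
  by near: v; apply: p2; split=> //; exact: ltW.
- near=> v => Dv; case: ifPn => kv.
    have : [set u | D u /\ (k u <= b)%R] v by [].
    by near: v; apply: p1; rewrite /= ku.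
  rewrite (wE u) // -mulgA; congr (_ * _).
  have : [set u | D u /\ (b <= k u)%R] v by split=> //; rewrite ltW // ltNge.
  by near: v; apply: p2; rewrite /= ku.
Unshelve. all: by end_near.
Qed.

Hypothesis c_local : forall x, \forall x' \near x, \forall x'' \near x',
  c x x'' = c x x' * c x' x''.
Hypothesis c_diag : forall x, c x x = 1.

Let rect (a b l u : R) := [set v : R * R | (a <= v.1 <= b)%R /\ (l <= v.2 <= u)%R].

(** The local cocycle identity says that [c (f (x, y))] composed with [f] is parallel near (x, y).
    Gluing proceeds in height over a column of positive width, then across columns. *)
Lemma parallel_square (f : R * R -> X) : continuous f ->
  exists g, parallel f (rect 0 1 0 1)%R g.
Proof.
move=> cf.
have c1 : continuous (@fst R R) by exact: continuous_fst.
have c2 : continuous (@snd R R) by exact: continuous_snd.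
pose Q x1 x2 y1 y2 := (x1 <= x2 -> y1 <= y2 ->
  exists g, parallel f (rect x1 x2 y1 y2) g)%R.
have loc x y : exists2 e, (0 < e)%R & forall a b a' b', (a <= x -> x <= b ->
  a' <= y -> y <= b' ->
    x - e < a -> b < x + e -> y - e < a' -> b' < y + e -> Q a b a' b')%R.
  have /nbhs_ballP[e /= e0 H] : \forall v \near (x, y), \forall w \near v,
      c (f (x, y)) (f w) = c (f (x, y)) (f v) * c (f v) (f w).
    have h : nbhs (x, y) (f @^-1` _) := cf (x, y) _ (c_local (f (x, y))).
    by apply: filterS h => v /= Hv; exact: cf v _ Hv.
  exists e => // a b a' b' *; move=> _ _; exists (fun v => c (f (x, y)) (f v)).
  move=> v [/andP[v1 v2] /andP[v3 v4]].
  have : ball (x, y) e v by split; rewrite /ball /= ltr_norml; lra.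
  by move=> /H; apply: filterS.
have min2 (e e' : R) : (0 < e -> 0 < e' -> exists m, [/\ 0 < m, m <= e & m <= e'])%R.
  by move=> e0 e'0; exists (Num.min e e'); rewrite lt_min !ge_min e0 e'0 !lexx orbT.
have col x : exists2 e, (0 < e)%R & forall a b, (a <= x -> x <= b ->
    x - e < a -> b < x + e -> Q a b 0 1)%R.
  apply: (interval_induction (Q := fun l u => exists2 e, (0 < e)%R & forall a b,
    (a <= x -> x <= b ->
    x - e < a -> b < x + e -> Q a b l u)%R)) => // [l m u lm mu [e e0 H] [e' e'0
      H']|y _].
    have [e'' [e''0 le le']] := min2 _ _ e0 e'0.
    exists e'' => // a b ax xb ea eb ab lu.
    have [||||g1 p1] := H a b ax xb; [lra|lra|by []|by []|].
    have [||||g2 p2] := H' a b ax xb; [lra|lra|by []|by []|].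
    apply: (@parallel_glue _ f (rect a b l u) snd m g1 g2) => //.
    - by apply: parallelS p1 => v [[v1 /andP[v2 v3]] v4]; split=> //; rewrite v2.
    - by apply: parallelS p2 => v [[v1 /andP[v2 v3]] v4]; split=> //; rewrite v4.
    - have ratio w : (a <= w <= b)%R -> g1 (a, m) / g2 (a, m) = g1 (w, m) / g2 (w, m).
        move=> /andP[aw wb].
        apply: (@parallel_ratio _ f (rect a b m m) g1 g2 (fun t => (t, m)) a w) => //.
        + by apply: continuous_pair => t;
          [exact: cvg_id | exact: (@cst_continuous _ _ _ t)].
        + by move=> t /andP[ta tw]; split; rewrite /= ?lexx // ta (le_trans tw).
        + by apply: parallelS p1 => v [v1 /andP[v2 v3]]; split=> //;
          rewrite (le_trans lm).
        + by apply: parallelS p2 => v [v1 /andP[v2 v3]]; split=> //;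
          rewrite v2 (le_trans v3).
      move=> [u1 u2] [v1 v2] [/= u1ab _] [/= v1ab _] -> ->.
      by rewrite -!ratio.
  have [e e0 H] := loc x y; exists e => // l u _ ly yu _ el eu.
  by exists e => // a b ax xb ea eb; exact: (H a b l u ax xb ly yu ea eb el eu).
apply: (interval_induction (Q := fun a b => Q a b 0 1)%R) => // [a m b am mb H H'|x
  _]; last first.
  by have [e e0 H] := col x; exists e => // a b _ ax xb _ ea eb;
    exact: (H a b ax xb ea eb).
move=> ab l01.
have [||g1 p1] := H; [lra|lra|]; have [||g2 p2] := H'; [lra|lra|].
apply: (@parallel_glue _ f (rect a b 0 1)%R fst m g1 g2) => //.
- by apply: parallelS p1 => v [[/andP[v1 v2] v3] v4]; split=> //; rewrite v1.
- by apply: parallelS p2 => v [[/andP[v1 v2] v3] v4]; split=> //; rewrite v4.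
- have ratio w : (0 <= w <= 1)%R -> g1 (m, 0%R) / g2 (m, 0%R) = g1 (m, w) / g2 (m, w).
    move=> /andP[w0 w1].
    apply: (@parallel_ratio _ f (rect m m 0 1)%R g1 g2 (fun t => (m, t)) 0%R w) => //.
    + by apply: continuous_pair => t; [exact: (@cst_continuous _ _ _ t) | exact:
      cvg_id].
    + by move=> t /andP[t0 tw]; split; rewrite /= ?lexx // t0 (le_trans tw).
    + by apply: parallelS p1 => v [/andP[v1 v2] v3]; split=> //; rewrite (le_trans am).
    + by apply: parallelS p2 => v [/andP[v1 v2] v3]; split=> //;
      rewrite v1 (le_trans v2).
  move=> [u1 u2] [v1 v2] [/= _ u2ab] [/= _ v2ab] -> ->.
  by rewrite -!ratio.
Qed.

(** Independent of the parallel function chosen, by [parallel_ratio]. *)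
Definition holonomy (p : I -> X) : Gam :=
  let g := xget (fun=> 1) [set g | parallel p setT g] in (g zero)^-1 * g one.

Lemma holonomyE (p : I -> X) g : parallel p setT g -> holonomy p = (g zero)^-1 * g one.
Proof.
move=> pg; rewrite /holonomy.
set h := xget _ _; have ph : parallel p setT h.
  by apply: (@xgetPex _ _ [set g | parallel p setT g]); exists g.
have := @parallel_ratio _ p setT h g (@clamp R) 0%R 1%R (@clamp_continuous R) ler01
  (fun _ _ => Logic.I) ph pg.
rewrite -[clamp 0]/zero -[clamp 1]/one => e.
apply: (mulgI (h zero)); rewrite mulVKg mulgA e mulgVK.
by [].
Qed.

Lemma parallel_comp (S T : topologicalType) (s : S -> T) (f : T -> X) g :
  continuous s -> parallel f setT g -> parallel (f \o s) setT (g \o s).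
Proof. by move=> cs p u _; have := cs u _ (p (s u) Logic.I). Qed.

Lemma parallel_unit2 (f : I * I -> X) : continuous f -> exists g, parallel f setT g.
Proof.
move=> cf; pose s (u : R * R) : I * I := (clamp u.1, clamp u.2).
pose k (u : I * I) : R * R := (unitI_val u.1, unitI_val u.2).
have cs : continuous s.
  apply: continuous_pair; apply: continuous_funcomp (@clamp_continuous R).
    exact: continuous_fst.
  exact: continuous_snd.
have ck : continuous k.
  apply: continuous_pair; apply: continuous_funcomp (@unitI_val_continuous R).
    exact: continuous_fst.
  exact: continuous_snd.
have sk u : s (k u) = u by case: u => x y; rewrite /s /= !clamp_val.
have [g pg] := parallel_square (continuous_funcomp cs cf).
exists (g \o k) => u _.
have rk v : rect 0%R 1%R 0%R 1%R (k v) by split; exact: unitI_val_itv.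
have h : nbhs u (k @^-1` _) := ck u _ (pg (k u) (rk u));
  apply: filterS h => v /= /(_ (rk v)).
by rewrite !sk => H _.
Qed.

Lemma parallel_unit (f : I -> X) : continuous f -> exists g, parallel f setT g.
Proof.
move=> cf.
have [g pg] := parallel_unit2 (continuous_funcomp (@continuous_fst I I) cf).
exists (fun t => g (t, zero)).
apply: (@parallel_comp I (I * I)%type (fun t => (t, zero)) _ _ _ pg).
by apply: continuous_pair => t; [exact: cvg_id | exact: (@cst_continuous _ _ _ t)].
Qed.

Lemma parallel_const (f : I -> X) g x : (forall t, f t = x) -> parallel f setT g ->
  g zero = g one.
Proof.
move=> fx pg.
have p1 : parallel f setT (fun=> 1).
  by move=> u _; near=> v => _; rewrite !fx c_diag mulg1.
have := @parallel_ratio _ f setT g (fun=> 1) (@clamp R) 0%R 1%R (@clamp_continuous R)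
  ler01 (fun _ _ => Logic.I) pg p1.
by rewrite !invg1 !mulg1.
Unshelve. all: by end_near.
Qed.

(** A parallel function on the square of the homotopy restricts to parallel functions on its four
    sides, and it takes equal values at the two ends of each side on which the homotopy is fixed. *)
Lemma holonomy_homotopic x y (p q : {path I from x to y in X}) :
  path_homotopic p q -> holonomy p = holonomy q.
Proof.
move=> [H [cH Hp Hq Hb]]; have [g pg] := parallel_unit2 cH.
have pp : parallel p setT (fun t => g (t, zero)).
  rewrite (_ : (p : I -> X) = H \o (fun t => (t, zero))); last by apply/funext => t;
    rewrite /= Hp.
  apply: (parallel_comp _ pg).
  by apply: continuous_pair => t; [exact: cvg_id | exact: (@cst_continuous _ _ _ t)].
have pq : parallel q setT (fun t => g (t, one)).
  rewrite (_ : (q : I -> X) = H \o (fun t => (t, one))); last by apply/funext => t;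
    rewrite /= Hq.
  apply: (parallel_comp _ pg).
  by apply: continuous_pair => t; [exact: cvg_id | exact: (@cst_continuous _ _ _ t)].
have side (e : I) z : (forall s, H (e, s) = z) -> g (e, zero) = g (e, one).
  move=> Hz; apply: (@parallel_const (H \o (fun s => (e, s))) (fun s => g (e, s)) z Hz).
  apply: (parallel_comp _ pg).
  by apply: continuous_pair => t; [exact: (@cst_continuous _ _ _ t) | exact: cvg_id].
rewrite (holonomyE pp) (holonomyE pq) (side zero x) ?(side one y) // => s.
  by case: (Hb s).
by case: (Hb s).
Qed.

Lemma holonomy_cat x y z (p : {path I from x to y in X}) (q :
  {path I from y to z in X}) :
  holonomy (path_cat p q) = holonomy p * holonomy q.
Proof.
have [g pg] := parallel_unit (@cts_fun _ _ (path_cat p q)).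
pose h1 (t : I) : I := clamp (2^-1 * unitI_val t)%R.
pose h2 (t : I) : I := clamp (2^-1 + 2^-1 * unitI_val t)%R.
have ch1 : continuous h1.
  apply: (@continuous_funcomp I R I (fun t => 2^-1 * unitI_val t)%R);
    last exact: clamp_continuous.
  apply: (@continuous_funcomp I R R _ (fun t => 2^-1 * t)%R);
    first exact: unitI_val_continuous.
  by move=> t; apply: cvgM; [exact: cvg_cst | exact: cvg_id].
have ch2 : continuous h2.
  apply: (@continuous_funcomp I R I (fun t => 2^-1 + 2^-1 * unitI_val t)%R);
    last exact: clamp_continuous.
  apply: (@continuous_funcomp I R R _ (fun t => 2^-1 + 2^-1 * t)%R);
    first exact: unitI_val_continuous.
  move=> t; apply: cvgD; first exact: cvg_cst.
  by apply: cvgM; [exact: cvg_cst | exact: cvg_id].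
have p1 : (p : I -> X) = path_cat p q \o h1.
  apply/funext => t; have := unitI_val_itv t => t01.
  rewrite /= /mk_path /path_cat_fun clampE; last by lra.
  rewrite ifT; last by lra.
  by rewrite mulrA divff ?pnatr_eq0 // mul1r clamp_val.
have q1 : (q : I -> X) = path_cat p q \o h2.
  apply/funext => t; have := unitI_val_itv t => t01.
  rewrite /= /mk_path /path_cat_fun clampE; last by lra.
  case: ifPn => [t0|_].
    have t0' : unitI_val t = 0%R by lra.
    have -> : t = zero by apply: unitI_val_inj; rewrite t0' unitI_val0.
    rewrite unitI_val0 mulr0 addr0 divff ?pnatr_eq0 // [RHS]path_one.
    exact: path_zero.
  rewrite -{1}[t]clamp_val; congr (q (clamp _)); lra.
have pp : parallel p setT (g \o h1) by rewrite p1; exact: parallel_comp.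
have pq : parallel q setT (g \o h2) by rewrite q1; exact: parallel_comp.
rewrite (holonomyE pp) (holonomyE pq) (holonomyE pg) /h1 /h2 /= !unitI_val0 !unitI_val1.
rewrite mulr0 addr0 mulr1 -[clamp 0]/zero (_ : 2^-1 + 2^-1 = 1)%R; last lra.
by rewrite -[clamp 1]/one !mulgA mulgK.
Qed.

Definition pi1_holonomy (b : X) (a : pi1 R b) : Gam :=
  holonomy (repr a : {path I from b to b in X}).

Lemma pi1_holonomyE (b : X) (p : {path I from b to b in X}) :
  pi1_holonomy (pi1_class p) = holonomy p.
Proof. by apply: holonomy_homotopic; apply/pi1_classP; exact: pi1_classK. Qed.

Lemma pi1_holonomyM (b : X) : {morph @pi1_holonomy b : x y / x * y}.
Proof.
move=> x y; rewrite -{1}(pi1_classK x) -{1}(pi1_classK y).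
by rewrite -[_ * _]/(pi1_mul _ _) pi1_mulE pi1_holonomyE holonomy_cat.
Qed.

End Parallel.

(** * Classes of paths *)

Section ClosedUpPaths.
Local Open Scope group_scope.
Variables (R : realType) (X : topologicalType) (b : X).
Local Notation I := (unitI R).
Local Notation G := (pi1 R b).
Variable d : forall x, {path I from b to x in X}.

Definition close_up x y (p : {path I from x to y in X}) : G :=
  pi1_class (path_cat (path_cat (d x) p) (path_rev (d y))).

(* The class of an arbitrary path, closed up to a loop at b; working with bare
   functions avoids transporting paths along equalities of endpoints. *)
Definition path_class (f : I -> X) : G :=
  if pselect (continuous f) is left cf
  then close_up (mk_path cf erefl erefl : {path I from f zero to f one in X}) else 1.

Lemma close_up_ext x y x' y' (p : {path I from x to y in X}) (p' :
  {path I from x' to y' in X}) :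
  p =1 p' -> close_up p = close_up p'.
Proof.
move=> pp'.
have ex : x = x' by rewrite -[x](@path_zero _ _ _ _ p) pp' [LHS]path_zero.
have ey : y = y' by rewrite -[y](@path_one _ _ _ _ p) pp' [LHS]path_one.
by subst x' y'; congr close_up; apply/path_eqP.
Qed.

Lemma path_classE x y (p : {path I from x to y in X}) : path_class p = close_up p.
Proof.
rewrite /path_class; case: pselect => [cp|/(_ (@cts_fun _ _ p))//].
exact: close_up_ext.
Qed.

Lemma close_up_homotopic x y (p q : {path I from x to y in X}) :
  path_homotopic p q -> close_up p = close_up q.
Proof.
move=> pq; apply/pi1_classP/path_cat_homotopic; last exact: path_homotopic_refl.
by apply: path_cat_homotopic => //; exact: path_homotopic_refl.
Qed.

Lemma close_up_cat x y z (p : {path I from x to y in X}) (q :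
  {path I from y to z in X}) :
  close_up (path_cat p q) = close_up p * close_up q.
Proof.
rewrite -[RHS]/(pi1_mul _ _) pi1_mulE; apply/pi1_classP.
have refl := path_homotopic_refl.
set dp := path_cat (d x) p; set qd := path_cat q (path_rev (d z)).
have h1 : path_homotopic (path_cat (path_cat (d x) (path_cat p q)) (path_rev (d z)))
    (path_cat dp qd).
  apply: path_homotopic_trans (path_homotopic_sym (path_catA _ _ _)).
  by apply: path_cat_homotopic => //; exact: path_catA.
apply: path_homotopic_trans h1 _; apply: path_homotopic_sym.
apply: path_homotopic_trans (path_homotopic_sym (path_catA _ _ _)) _.
apply: path_cat_homotopic => //.
apply: (@path_homotopic_trans _ _ _ _ _ (path_cat (path_rev (d y)) (path_cat (d y)
  qd))).
  by apply: path_cat_homotopic => //; apply: path_homotopic_sym; exact: path_catA.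
apply: path_homotopic_trans (path_catA _ _ _) _.
apply: (@path_homotopic_trans _ _ _ _ _ (path_cat (path_cst R y) qd)).
  by apply: path_cat_homotopic => //; exact: path_cat_revl.
exact: path_cat_cstl.
Qed.

Lemma path_class_homotopy (f g : I -> X) (H : I * I -> X) : continuous H ->
  (forall t, H (t, zero) = f t) -> (forall t, H (t, one) = g t) ->
  (forall s, H (zero, s) = f zero) -> (forall s, H (one, s) = f one) ->
  path_class f = path_class g.
Proof.
move=> cH Hf Hg H0 H1.
have c1 (e : I) : continuous (fun t => H (t, e)).
  apply: (@continuous_funcomp _ _ _ (fun t : I => (t, e)) H) => //.
  by apply: continuous_pair => t; [exact: cvg_id | exact: (@cst_continuous _ _ _ t)].
have cf : continuous f by rewrite (_ : f = fun t => H (t, zero)) //; apply/funext.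
have cg : continuous g by rewrite (_ : g = fun t => H (t, one)) //; apply/funext.
have g0 : g zero = f zero by rewrite -Hg H0.
have g1 : g one = f one by rewrite -Hg H1.
rewrite -[f]/(mk_path cf erefl erefl : I -> X) -[g]/(mk_path cg g0 g1 : I -> X).
rewrite [LHS]path_classE [RHS]path_classE; apply: close_up_homotopic.
by exists H; split.
Qed.

Lemma path_class_cat (f g h : I -> X) : continuous f -> continuous g ->
  f one = g zero ->
  (forall t, h t = if (unitI_val t <= 2^-1)%R then f (clamp (2 * unitI_val t)%R)
                   else g (clamp (2 * unitI_val t - 1)%R)) ->
  path_class h = path_class f * path_class g.
Proof.
move=> cf cg fg hE.
pose p : {path I from f zero to f one in X} := mk_path cf erefl erefl.
pose q : {path I from f one to g one in X} := mk_path cg (esym fg) erefl.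
rewrite (_ : h = path_cat p q :> (I -> X)); last exact/funext.
by rewrite path_classE close_up_cat -!path_classE.
Qed.

(** The path [d b] is an arbitrary loop, hence the conjugation. *)
Lemma path_class_loop (p : {path I from b to b in X}) :
  path_class p = pi1_class (d b) * pi1_class p * (pi1_class (d b))^-1.
Proof.
rewrite path_classE -[_^-1]/(pi1_inv _) pi1_invE.
rewrite -[_ * pi1_class p]/(pi1_mul _ _) pi1_mulE.
by rewrite -[RHS]/(pi1_mul _ _) pi1_mulE.
Qed.

Lemma path_class_reparam (f : R -> X) (u v : I -> R) : continuous f ->
  continuous u -> continuous v ->
  u zero = v zero -> u one = v one -> path_class (f \o u) = path_class (f \o v).
Proof.
move=> cf cu cv uv0 uv1.
pose H (x : I * I) : X := f ((1 - unitI_val x.2) * u x.1 + unitI_val x.2 * v x.1)%R.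
apply: (@path_class_homotopy _ _ H) => [|t|t|s|s].
- apply: (@continuous_funcomp (I * I)%type R X
    (fun x => (1 - unitI_val x.2) * u x.1 + unitI_val x.2 * v x.1)%R) => //.
  have c1 : continuous (fun x : I * I => unitI_val x.2).
    apply: continuous_funcomp; last exact: unitI_val_continuous.
    exact: continuous_snd.
  have cu' := continuous_funcomp (@continuous_fst I I) cu.
  have cv' := continuous_funcomp (@continuous_fst I I) cv.
  move=> x; apply: cvgD; apply: cvgM; [|exact: cu'|exact: c1|exact: cv'].
  by apply: cvgB; [exact: cvg_cst | exact: c1].
- by rewrite /H /= unitI_val0 subr0 mul1r mul0r addr0.
- by rewrite /H /= unitI_val1 subrr mul0r mul1r add0r.
- by rewrite /H /= -uv0 -mulrDl subrK mul1r.
- by rewrite /H /= -uv1 -mulrDl subrK mul1r.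
Qed.

Definition subpath (f : R -> X) (x y : R) (t : I) : X :=
  f (x + (y - x) * unitI_val t)%R.

Let affine_unitI_continuous (x y : R) : continuous (fun t : I => x + y * unitI_val t)%R.
Proof.
apply: (@continuous_funcomp I R R _ (fun t => x + y * t)%R);
  first exact: unitI_val_continuous.
move=> t; apply: cvgD; first exact: cvg_cst.
by apply: cvgM; [exact: cvg_cst | exact: cvg_id].
Qed.

Lemma subpath_continuous (f : R -> X) x y : continuous f -> continuous (subpath f x y).
Proof. by move=> cf; exact: (continuous_funcomp (@affine_unitI_continuous x (y -
  x)%R) cf). Qed.

Lemma path_class_subpath (f : R -> X) (x y z : R) : continuous f ->
  path_class (subpath f x z) = path_class (subpath f x y) * path_class (subpath f y z).
Proof.
move=> cf.
pose v (t : I) : R := if (unitI_val t <= 2^-1)%R then (x + (y - x) * (2 * unitI_val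
  t))%R
  else (y + (z - y) * (2 * unitI_val t - 1))%R.
have cv : continuous v.
  apply: (@paste_continuous R I R _ _ (fun t => x + (y - x) * (2 * unitI_val t))%R
           (fun t => y + (z - y) * (2 * unitI_val t - 1))%R).
  - exact: unitI_val_continuous.
  - rewrite (_ : (fun t => _) = fun t => (x + ((y - x) * 2) * unitI_val t)%R);
    first exact: affine_unitI_continuous.
    by apply/funext => t; rewrite mulrA.
  - rewrite (_ : (fun t => _) = fun t => ((y - (z - y)) + ((z - y) * 2) * unitI_val
    t)%R); first exact: affine_unitI_continuous.
    by apply/funext => t; lra.
  - by move=> t ->; lra.
have -> : path_class (subpath f x z) = path_class (f \o v).
  apply: (@path_class_reparam f (fun t => x + (z - x) * unitI_val t)%R v) => //.
  - by rewrite /v unitI_val0 ifT; lra.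
  - by rewrite /v unitI_val1 ifF; [lra | apply/negbTE; rewrite -ltNge; lra].
apply: path_class_cat; [exact: subpath_continuous | exact: subpath_continuous | | ].
  by rewrite /subpath unitI_val0 unitI_val1; congr f; lra.
move=> t; rewrite /subpath /v /=; have := unitI_val_itv t => t01.
by case: ifPn => t2; rewrite clampE //; lra.
Qed.

(** The factors [h] cancel between consecutive pieces, which makes the property concatenate over
    intervals. *)
Lemma path_class_generated (S : set G) (h : X -> G) (f : R -> X) : subgroup_set S ->
  continuous f ->
  (forall t, exists2 e, (0 < e)%R & forall x y,
     (x <= t)%R -> (t <= y)%R -> (t - e < x)%R -> (y < t + e)%R ->
     S (h (f x) * path_class (subpath f x y) * (h (f y))^-1)) ->
  S (h (f 0%R) * path_class (f \o @unitI_val R) * (h (f 1%R))^-1).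
Proof.
move=> sS cf loc.
have -> : f \o @unitI_val R = subpath f 0%R 1%R.
  by apply/funext => t; rewrite /subpath /= subr0 mul1r add0r.
apply: (interval_induction (Q := fun x y => S (h (f x) * path_class (subpath f x y) *
  (h (f y))^-1))).
- exact: ler01.
- move=> x y z _ _ Sxy Syz; rewrite (path_class_subpath x y z cf).
  have := subgroup_setM sS Sxy Syz; rewrite !mulgA mulgVK.
  by [].
- move=> t _; have [e e0 H] := loc t; exists e => // x y _ xt ty _; exact: H.
Qed.

End ClosedUpPaths.

Section HolonomyOfClosedUpPaths.
Local Open Scope group_scope.
Variables (R : realType) (X : topologicalType) (b : X).
Local Notation I := (unitI R).
Variable d : forall x, {path I from b to x in X}.
Variables (Gam : groupType) (c : X -> X -> Gam).
Hypothesis c_local : forall x, \forall x' \near x, \forall x'' \near x',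
  c x x'' = c x x' * c x' x''.
Hypothesis c_diag : forall x, c x x = 1.

Lemma holonomy_rev x y (p : {path I from x to y in X}) :
  holonomy c (path_rev p) = (holonomy c p)^-1.
Proof.
apply: (mulgI (holonomy c p)); rewrite mulgV -(holonomy_cat c_local).
rewrite (holonomy_homotopic c_local c_diag (path_cat_revr p)).
rewrite (@holonomyE _ _ _ _ _ (fun=> 1)) ?mulgV //; first by rewrite invg1 mulg1.
by move=> u _; near=> v => _; rewrite c_diag mulg1.
Unshelve. all: by end_near.
Qed.

Lemma pi1_holonomy_path_class (f : I -> X) : continuous f ->
  pi1_holonomy c (path_class d f) =
  holonomy c (d (f zero)) * holonomy c f * (holonomy c (d (f one)))^-1.
Proof.
move=> cf; rewrite -[f in LHS]/(mk_path cf erefl erefl : I -> X) path_classE.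
by rewrite pi1_holonomyE // !holonomy_cat // holonomy_rev.
Qed.

End HolonomyOfClosedUpPaths.

(** * Three unordered points in the punctured plane *)

Lemma segpt_continuous (R : realType) (T : topologicalType) (u : T -> R) (p q : T ->
  R * R) :
  continuous u -> continuous p -> continuous q ->
    continuous (fun t => segpt (u t) (p t) (q t)).
Proof.
move=> cu cp cq.
have c1 (f : T -> R * R) : continuous f -> continuous (fun t => (f t).1).
  by move=> cf; apply: continuous_funcomp cf _; exact: continuous_fst.
have c2 (f : T -> R * R) : continuous f -> continuous (fun t => (f t).2).
  by move=> cf; apply: continuous_funcomp cf _; exact: continuous_snd.
have lin (x y : T -> R) : continuous x -> continuous y ->
    continuous (fun t => (1 - u t) * x t + u t * y t).
  move=> cx cy t; apply: cvgD; apply: cvgM; [|exact: cx|exact: cu|exact: cy].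
  by apply: cvgB; [exact: cvg_cst | exact: cu].
by apply: continuous_pair; apply: lin; auto.
Qed.

Section Core.
Local Open Scope group_scope.
Variables (R : realType) (X : topologicalType).
Local Notation I := (unitI R).
Local Notation conf := ('I_3 -> R * R).
(** The interface to the configuration space: on valid labelled configurations [Q] is continuous,
    surjective and open, with the orbits of the symmetric group as fibres. *)
Variable Q : conf -> X.
Hypothesis Q_cont : forall (T : topologicalType) (F : T -> conf),
  (forall i, continuous (fun t => F t i)) -> (forall t, valid (F t)) ->
  continuous (fun t => Q (F t)).
Hypothesis Q_surj : forall x, exists2 z, valid z & Q z = x.
Hypothesis Q_perm : forall z z', valid z -> valid z' -> Q z = Q z' ->
  exists s : 'S_3, z' = z \o s.
Hypothesis Q_permE : forall z (s : 'S_3), valid z -> Q (z \o s) = Q z.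
Hypothesis Q_open : forall z e, valid z -> (0 < e)%R ->
  \forall x \near Q z, exists z', [/\ valid z', near e z z' & Q z' = x].

Definition seg (z z' : conf) (t : I) : X := Q (segz (unitI_val t) z z').

Lemma segz0 (z z' : conf) : segz 0%R z z' = z.
Proof.
apply/funext => i; rewrite /segz /segpt !mul0r !addr0 subr0 !mul1r.
by case: (z i).
Qed.

Lemma segz1 (z z' : conf) : segz 1%R z z' = z'.
Proof.
apply/funext => i; rewrite /segz /segpt subrr !mul0r !add0r !mul1r.
by case: (z' i).
Qed.

Lemma segz_relabel t (z z' : conf) (s : 'S_3) :
  segz t (z \o s) (z' \o s) = segz t z z' \o s.
Proof. by []. Qed.

Lemma segz_continuous (u : I -> R) (z z' : conf) i : continuous u ->
  continuous (fun t => segz (u t) z z' i).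
Proof.
by move=> cu; apply: (@segpt_continuous R I u (fun=> z i) (fun=> z' i)) => // t;
  exact: (@cst_continuous _ _ _ t).
Qed.

Definition convex_set (D : conf -> Prop) := (forall z, D z -> valid z) /\
  forall t z z', (0 <= t <= 1)%R -> D z -> D z' -> D (segz t z z').

Lemma region_convex o K : total_on_labels o -> convex_set (@region R o K).
Proof.
move=> ot; split=> [z|t z z']; [exact: region_valid | exact: region_segz].
Qed.

Lemma ball_convex (z : conf) e : valid z -> good_radius z e -> convex_set (near e z).
Proof.
move=> vz [_ ref _]; split=> [z' /ref|t z1 z2];
  [exact: refines_valid | exact: near_segz].
Qed.

Lemma seg_continuous D (z z' : conf) : convex_set D -> D z -> D z' ->
  continuous (seg z z').
Proof.
move=> [Dv Ds] Dz Dz'; apply: Q_cont => [i|t].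
  by apply: segz_continuous; exact: unitI_val_continuous.
by apply/Dv/Ds => //; exact: unitI_val_itv.
Qed.

Lemma seg_zero z z' : seg z z' zero = Q z.
Proof. by rewrite /seg unitI_val0 segz0. Qed.

Lemma seg_one z z' : seg z z' one = Q z'.
Proof. by rewrite /seg unitI_val1 segz1. Qed.

(** A canonical configuration for the ranking of z, on the diagonal. In [mixz] the horizontal order
    comes from z and the heights from z': it is the midpoint of the braid from z to z'. *)
Definition stz (z : conf) : conf := gridz (rk z) (rk z).
Definition mixz (z z' : conf) : conf := gridz (rk z) (rk z').

Lemma stz_valid z : valid z -> valid (stz z).
Proof. by move=> vz; apply: gridz_valid; exact: rk_ranking. Qed.

Lemma stz_relabel z (s : 'S_3) : stz (z \o s) = stz z \o s.
Proof.
rewrite /stz -gridz_relabel; congr gridz; apply/funext => a; exact: rk_relabel.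
Qed.

Lemma mixz_relabel z z' (s : 'S_3) : mixz (z \o s) (z' \o s) = mixz z z' \o s.
Proof.
rewrite /mixz -gridz_relabel; congr gridz; apply/funext => a; exact: rk_relabel.
Qed.

Lemma seg_relabel D z z' (s : 'S_3) : convex_set D -> D z -> D z' ->
  seg (z \o s) (z' \o s) = seg z z'.
Proof.
move=> [Dv Ds] Dz Dz'; apply/funext => t; rewrite /seg segz_relabel Q_permE //.
by apply/Dv/Ds => //; exact: unitI_val_itv.
Qed.

Definition chamber (z : conf) := @region R (rank_order (rk z)) (fun _ _ => false).

Lemma chamber_convex z : valid z -> convex_set (chamber z).
Proof. by move=> vz; apply/region_convex/rank_order_total/rk_ranking. Qed.

Lemma chamber_self z : valid z -> chamber z z.
Proof. by move=> vz a b; rewrite /rank_order rk_lt. Qed.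

Lemma chamber_grid z r : valid z -> chamber z (gridz r (rk z)).
Proof. by move=> vz a b; rewrite gridz_lexlt //; exact: rk_ranking. Qed.

Arguments chamber_grid {z} r _ a b _.

Lemma chamber_rk z y a : valid z -> chamber z y -> rk y a = rk z a.
Proof.
move=> vz cy; have vy := (chamber_convex vz).1 _ cy.
rewrite -[RHS](ranking_count a (rk_ranking vz)); congr #|pred_of_set _|.
apply/setP => b; rewrite !inE; apply/idP/idP => [ba|]; last exact: cy.
rewrite rk_lt //; have [e|ne] := pselect (b = a); first by rewrite e lexltxx in ba.
have /lexlt_total/orP[//|] : pt z b <> pt z a by move/vz.
by rewrite -rk_lt // => /cy; rewrite lexlt_asym.
Qed.

(** Heights are free: with distinct first coordinates the points cannot collide. *)
Definition slab (z : conf) := @region R (rank_order (rk z)) (fun _ _ => true).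

Lemma slab_convex z : valid z -> convex_set (slab z).
Proof. by move=> vz; apply/region_convex/rank_order_total/rk_ranking. Qed.

Lemma slab_grid z r : slab z (gridz (rk z) r).
Proof. by move=> a b; rewrite gridz_lt1. Qed.

Arguments slab_grid z r a b _ : clear implicits.

(* Contains the moves of the positive braid exchanging the pairs inverted
   between z and z'. *)
Definition crossing_region (z z' : conf) :=
  @region R (rank_order (rk z)) (fun a b => (rk z' b < rk z' a)%N).

Lemma crossing_convex z z' : valid z -> convex_set (crossing_region z z').
Proof. by move=> vz; apply/region_convex/rank_order_total/rk_ranking. Qed.

Lemma crossing_grid z z' r r' : valid z -> valid z' -> ranking r' ->
  (forall a b, (rk z a < rk z b -> rk z' b < rk z' a -> r a < r b)%N) ->
  (forall a b, (rk z a < rk z b -> rk z' a < rk z' b -> r' a < r' b)%N) ->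
  crossing_region z z' (gridz r r').
Proof.
move=> vz vz' rr' h h' a b ab; case: ifPn => ba; first by rewrite gridz_lt1; exact: h.
rewrite gridz_lexlt //; apply: h' => //.
rewrite ltn_neqAle leqNgt ba andbT; apply/eqP => /(rk_ranking vz').1 e.
by move: ab; rewrite /rank_order e ltnn.
Qed.

Lemma crossing_refines z z' : valid z -> valid z' -> refines z z' ->
  crossing_region z z' z /\ crossing_region z z' z'.
Proof.
move=> vz vz' ref; split=> a b; rewrite /rank_order !rk_lt // => ab;
  case: ifPn => // ba.
- by have [] := refines_inversion ref ab ba.
- by have [/(proj1 (ref a b))] := refines_inversion ref ab ba.
- have [e|ne] := pselect (a = b); first by rewrite e lexltxx in ab.
  have /lexlt_total/orP[//|] : pt z' a <> pt z' b by move/vz'.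
  by rewrite (negPf ba).
Qed.

(** * Positive braids as classes of straight paths, and generation by them *)

Section WithBase.
Variables (b0 : X) (d : forall x, {path I from b0 to x in X}).

Lemma path_class_convex D (F F' : I -> conf) : convex_set D ->
  (forall i, continuous (fun t => F t i)) -> (forall i, continuous (fun t => F' t i)) ->
  (forall t, D (F t)) -> (forall t, D (F' t)) -> F zero = F' zero -> F one = F' one ->
  path_class d (fun t => Q (F t)) = path_class d (fun t => Q (F' t)).
Proof.
move=> [Dv Ds] cF cF' DF DF' F0 F1.
have sxx (t : R) (z : conf) : segz t z z = z.
  apply/funext => i; rewrite /segz /segpt -!mulrDl subrK !mul1r.
  by case: (z i).
apply: (@path_class_homotopy _ _ _ _ _ _ (fun x => Q (segz (unitI_val x.2) (F x.1)
  (F' x.1)))).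
- apply: Q_cont => [i|x]; last by apply/Dv/Ds => //; exact: unitI_val_itv.
  apply: segpt_continuous.
  + by apply: continuous_funcomp (@unitI_val_continuous R); exact: continuous_snd.
  + by apply: continuous_funcomp (cF i); exact: continuous_fst.
  + by apply: continuous_funcomp (cF' i); exact: continuous_fst.
- by move=> t; rewrite unitI_val0 segz0.
- by move=> t; rewrite unitI_val1 segz1.
- by move=> s; rewrite /= -F0 sxx.
- by move=> s; rewrite /= -F1 sxx.
Qed.

Definition sgc z z' := path_class d (seg z z').

Lemma path_class_sgc D (F : I -> conf) : convex_set D ->
  (forall i, continuous (fun t => F t i)) -> (forall t, D (F t)) ->
  path_class d (fun t => Q (F t)) = sgc (F zero) (F one).
Proof.
move=> cD cF DF; apply: (path_class_convex cD) => //.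
- by move=> i; apply: segz_continuous; exact: unitI_val_continuous.
- by move=> t; apply: cD.2 => //; exact: unitI_val_itv.
- by rewrite unitI_val0 segz0.
- by rewrite unitI_val1 segz1.
Qed.

Lemma sgc_triangle D z z' z'' : convex_set D -> D z -> D z' -> D z'' ->
  sgc z z'' = sgc z z' * sgc z' z''.
Proof.
move=> cD Dz Dz' Dz''; have [Dv Ds] := cD.
pose F (t : I) : conf := if (unitI_val t <= 2^-1)%R then segz (2 * unitI_val t)%R z z'
  else segz (2 * unitI_val t - 1)%R z' z''.
have aff (x y : R) : continuous (fun t : I => x * unitI_val t + y)%R.
  apply: (@continuous_funcomp I R R _ (fun t => x * t + y)%R);
    first exact: unitI_val_continuous.
  move=> t; apply: cvgD; last exact: cvg_cst.
  by apply: cvgM; [exact: cvg_cst | exact: cvg_id].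
have cF i : continuous (fun t => F t i).
  rewrite (_ : (fun t => F t i) = fun t => if (unitI_val t <= 2^-1)%R
    then segz (2 * unitI_val t + 0)%R z z' i else segz (2 * unitI_val t - 1)%R z' z''
      i); last first.
    by apply/funext => t; rewrite /F addr0; case: ifP.
  apply: (@paste_continuous R I (R * R)%type _ _ (fun t :
    I => segz (2 * unitI_val t + 0)%R z z' i)
    (fun t : I => segz (2 * unitI_val t - 1)%R z' z'' i)).
  - exact: unitI_val_continuous.
  - exact: segz_continuous.
  - exact: segz_continuous.
  - by move=> t ->; rewrite addr0 divff ?pnatr_eq0 // subrr segz0 segz1.
have DF t : D (F t).
  by have := unitI_val_itv t => t01; rewrite /F; case: ifPn => t2; apply: Ds => //; lra.
transitivity (path_class d (fun t => Q (F t))).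
  rewrite (path_class_sgc cD) // /F unitI_val0 unitI_val1 mulr0 mulr1.
  rewrite ifT ?invr_ge0 ?ler0n // segz0 ifF; last by apply/negbTE; rewrite -ltNge; lra.
  by rewrite (_ : 2 - 1 = 1)%R ?segz1 //; lra.
apply: path_class_cat.
- exact: seg_continuous cD _ _.
- exact: seg_continuous cD _ _.
- by rewrite seg_one seg_zero.
- move=> t; rewrite /F /seg; have := unitI_val_itv t => t01.
  by case: ifPn => t2; rewrite clampE //; lra.
Qed.

Lemma sgcxx D z : convex_set D -> D z -> sgc z z = 1.
Proof.
move=> cD Dz; have := sgc_triangle cD Dz Dz Dz.
by rewrite -{1}[sgc z z]mulg1 => /mulgI.
Qed.

Lemma sgcV D z z' : convex_set D -> D z -> D z' -> sgc z z' = (sgc z' z)^-1.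
Proof.
move=> cD Dz Dz'; apply: (mulgI (sgc z' z)).
by rewrite -(sgc_triangle cD) // (sgcxx cD) // mulgV.
Qed.

(** A vertical move at fixed horizontal positions, where every exchange has the left point rising
    past the right one, followed by a horizontal move within a chamber, where no exchange occurs. *)
Definition braid (z z' : conf) := sgc (stz z) (mixz z z') * sgc (mixz z z') (stz z').

Lemma braid_relabel z z' (s : 'S_3) : valid z -> valid z' ->
  braid (z \o s) (z' \o s) = braid z z'.
Proof.
move=> vz vz'; rewrite /braid /sgc !stz_relabel mixz_relabel.
rewrite (seg_relabel s (slab_convex vz)); [|exact: slab_grid|exact: slab_grid].
by rewrite (seg_relabel s (chamber_convex vz'));
  [|exact: chamber_grid|exact: chamber_grid].
Qed.

Lemma braid_eq_rk (z z' y y' : conf) : rk z =1 rk y -> rk z' =1 rk y' ->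
  braid z z' = braid y y'.
Proof. by move=> /funext e /funext e'; rewrite /braid /stz /mixz e e'. Qed.

Lemma braidM (z z' z'' : conf) : valid z -> valid z' -> valid z'' ->
  additive_ranks (rk z) (rk z') (rk z'') -> braid z z'' = braid z z' * braid z' z''.
Proof.
move=> vz vz' vz'' ad; rewrite /braid.
rewrite (sgc_triangle (slab_convex vz) (slab_grid z (rk z)) (slab_grid z (rk z'))
  (slab_grid z (rk z''))).
rewrite -!mulgA; congr (_ * _).
have g1 := chamber_grid (rk z) vz''; have g2 := chamber_grid (rk z') vz''.
have g3 := chamber_grid (rk z'') vz''.
rewrite (sgc_triangle (chamber_convex vz'') g1 g2 g3) !mulgA; congr (_ * _).
(* The two sides differ by the two ways around the square whose corners have horizontal order from z
   or z' and heights from z' or z''. Additivity puts all four corners in one crossing region. *)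
have cross r r' : (r = rk z \/ r = rk z') -> (r' = rk z' \/ r' = rk z'') ->
    crossing_region z' z'' (gridz r r').
  move=> hr hr'; apply: crossing_grid => //.
  - by case: hr' => ->; exact: rk_ranking.
  - move=> a c ac ca; case: hr => -> //.
    rewrite ltnNge leq_eqVlt negb_or; apply/andP; split.
      by apply/eqP => /(rk_ranking vz).1 e; rewrite e ltnn in ac.
    by apply/negP => /ad /(_ ac); rewrite ltnNge (ltnW ca).
  - by move=> a c ac ac'; case: hr' => ->.
have cc := crossing_convex z'' vz'.
rewrite -!(sgc_triangle cc) //; apply: cross; by [left|right].
Qed.

Definition std_conf (j : nat) : conf := gridz (std_rank j) (std_rank j).
Definition perm_rank (j : nat) (w : seq nat) (a : label) : nat :=
  nth 0%N w (std_rank j a).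
Definition perm_conf (j : nat) (w : seq nat) : conf :=
  gridz (perm_rank j w) (perm_rank j w).

Lemma perm_rankP j w : (j < 4)%N -> is_perm4 w -> ranking (perm_rank j w).
Proof.
move=> j4 pw; have [si s4] := std_rankP j4; have sz := perm_size pw; split=> [a b|a].
  move/eqP; rewrite /perm_rank nth_uniq ?sz // ?(perm_uniq pw) ?iota_uniq // => /eqP.
  exact: si.
have : perm_rank j w a \in w by rewrite mem_nth // sz s4.
by rewrite (perm_mem pw) mem_iota.
Qed.

Lemma std_conf_valid j : (j < 4)%N -> valid (std_conf j).
Proof. by move=> j4; apply: gridz_valid; exact: std_rankP. Qed.

Lemma perm_conf_valid j w : (j < 4)%N -> is_perm4 w -> valid (perm_conf j w).
Proof. by move=> j4 pw; apply: gridz_valid; exact: perm_rankP. Qed.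

Lemma rk_std_conf j : (j < 4)%N -> rk (std_conf j) =1 std_rank j.
Proof. by move=> j4 a; rewrite rk_gridz //; exact: std_rankP. Qed.

Lemma rk_perm_conf j w : (j < 4)%N -> is_perm4 w -> rk (perm_conf j w) =1 perm_rank j w.
Proof. by move=> j4 pw a; rewrite rk_gridz //; exact: perm_rankP. Qed.

Lemma rk_None_lt (z : conf) : valid z -> (rk z None < 4)%N.
Proof. by move=> vz; case: (rk_ranking vz). Qed.

Lemma perm_rank_rank_perm (r r' : label -> nat) (s : 'S_3) : ranking r -> ranking r' ->
  (forall a, r (relabel s a) = std_rank (r None) a) ->
  forall a, perm_rank (r None) (rank_perm r r') a = r' (relabel s a).
Proof. by move=> rr rr' sE a; rewrite /perm_rank -sE nth_rank_permE. Qed.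

Lemma braid_std z z' : valid z -> valid z' ->
  braid z z' = braid (std_conf (rk z None)) (perm_conf (rk z None) (rank_perm (rk z)
    (rk z'))).
Proof.
move=> vz vz'; have rr := rk_ranking vz; have rr' := rk_ranking vz'.
have [s sE] := relabel_std rr.
rewrite -(braid_relabel s vz vz'); apply: braid_eq_rk => a; rewrite rk_relabel.
  by rewrite rk_std_conf ?rk_None_lt // sE.
rewrite rk_perm_conf ?rk_None_lt ?rank_perm_perm4 //.
by rewrite (perm_rank_rank_perm rr rr' sE).
Qed.

Lemma Q_stz z : valid z -> Q (stz z) = Q (std_conf (rk z None)).
Proof.
move=> vz; have [s sE] := relabel_std (rk_ranking vz).
rewrite -(Q_permE s (stz_valid vz)) -stz_relabel /stz /std_conf.
by congr (Q (gridz _ _)); apply/funext => a; rewrite rk_relabel sE.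
Qed.

(** The gauge: it carries the puncture from position 0 up to position j, crossing by crossing, so
    that these crossings become trivial in [std_braid]. *)
Fixpoint chain (j : nat) : pi1 R b0 :=
  if j is j.+1 then chain j * braid (std_conf j) (perm_conf j (adj_perm j)) else 1.

Definition std_braid (j : nat) (w : seq nat) : pi1 R b0 :=
  chain j * braid (std_conf j) (perm_conf j w) * (chain (nth 0%N w j))^-1.

Lemma perm4_lt w j : (j < 4)%N -> is_perm4 w -> (nth 0%N w j < 4)%N.
Proof.
move=> j4 pw; have : nth 0%N w j \in w by rewrite mem_nth // (perm_size pw).
by rewrite (perm_mem pw) mem_iota.
Qed.

Lemma perm4_comp_perm4 w w' : is_perm4 w -> is_perm4 w' -> is_perm4 (perm4_comp w w').
Proof.
move=> pw pw'; have sz := perm_size pw'.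
have e : perm4_comp (iota 0 4) w' = w' by rewrite -[RHS](mkseq_nth 0%N) sz.
by apply: perm_trans pw'; rewrite -[X in perm_eq _ X]e; exact: perm_map.
Qed.

Lemma rank_perm_nth (r : label -> nat) w : ranking r -> is_perm4 w ->
  rank_perm r (fun a => nth 0%N w (r a)) = w.
Proof.
move=> rr pw; apply: (@eq_from_nth _ 0%N);
  rewrite size_map size_iota ?(perm_size pw) //.
by move=> i i4; rewrite nth_rank_perm // rankK.
Qed.

Lemma std_braidM j w w' : (j < 4)%N -> is_perm4 w -> is_perm4 w' ->
  inversions_add w w' ->
  std_braid j (perm4_comp w w') = std_braid j w * std_braid (nth 0%N w j) w'.
Proof.
move=> j4 pw pw' ad; have pww := perm4_comp_perm4 pw pw'.
have j'4 := perm4_lt j4 pw.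
have v1 := std_conf_valid j4; have v2 := perm_conf_valid j4 pw; have v3 :=
  perm_conf_valid j4 pww.
have compE a : perm_rank j (perm4_comp w w') a = nth 0%N w' (perm_rank j w a).
  by rewrite /perm_rank (nth_map 0%N) // (perm_size pw); case: (std_rankP j4).
rewrite /std_braid.
have -> : braid (std_conf j) (perm_conf j (perm4_comp w w')) =
    braid (std_conf j) (perm_conf j w) * braid (std_conf (nth 0%N w j)) (perm_conf
      (nth 0%N w j) w').
  rewrite (braidM v1 v2 v3).
    congr (_ * _); rewrite braid_std // rk_perm_conf //;
      congr (braid _ (perm_conf _ _)).
    rewrite (@rank_perm_eq _ _ (perm_rank j w) (fun a => nth 0%N w' (perm_rank j w a))).
    - by apply: rank_perm_nth => //; exact: perm_rankP.
    - exact: rk_perm_conf.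
    - by move=> a; rewrite rk_perm_conf.
  move=> a c; rewrite !rk_std_conf // !rk_perm_conf // !compE => ac ca.
  have [_ s4] := std_rankP j4.
  have /allP/(_ (std_rank j a)) := ad; rewrite mem_iota => /(_ (s4 a)).
  by move=> /allP/(_ (std_rank j c)); rewrite mem_iota => /(_ (s4 c)); rewrite ac ca.
rewrite (nth_map 0%N) ?(perm_size pw) // !mulgA mulgVK.
by [].
Qed.

Lemma std_braid_gauge i : (i < 3)%N -> std_braid i (adj_perm i) = 1.
Proof.
move=> i3; rewrite /std_braid (_ : nth 0%N (adj_perm i) i = i.+1) /= ?mulgV //.
by case: i i3 => [|[|[|]]].
Qed.

Definition chosen_lift x : conf := xget (fun=> (0, 0)%R) [set z | valid z /\ Q z = x].

Lemma chosen_liftP x : valid (chosen_lift x) /\ Q (chosen_lift x) = x.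
Proof.
rewrite /chosen_lift; case: xgetP => [z _ //|none].
by have [z vz Qz] := Q_surj x; case: (none z).
Qed.

(** It stays in the chamber of z after the gauge, so it jumps where the ranking changes;
    [trail_refines] identifies the jumps with standard braids. *)
Definition trail (z : conf) : pi1 R b0 := chain (rk z None) * sgc (stz z) z.

Lemma trail_relabel z (s : 'S_3) : valid z -> trail (z \o s) = trail z.
Proof.
move=> vz; rewrite /trail rk_relabel /sgc stz_relabel.
by rewrite (seg_relabel s (chamber_convex vz) (chamber_grid _ vz) (chamber_self vz)).
Qed.

Definition base_trail x := trail (chosen_lift x).

Lemma base_trailE z : valid z -> base_trail (Q z) = trail z.
Proof.
move=> vz; have [vl Ql] := chosen_liftP (Q z).
have [s sE] := Q_perm vz vl (esym Ql).
by rewrite /base_trail sE trail_relabel.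
Qed.

(** The configurations z, z', [stz z] and [mixz z z'] share one crossing region, so passing through
    z or through [mixz z z'] gives the same class. *)
Lemma trail_refines z z' : valid z -> refines z z' ->
  trail z * sgc z z' * (trail z')^-1 = std_braid (rk z None) (rank_perm (rk z) (rk z')).
Proof.
move=> vz ref; have vz' := refines_valid vz ref.
have [c1 c2] := crossing_refines vz vz' ref.
have cc := crossing_convex z' vz.
have c3 : crossing_region z z' (stz z).
  by apply: crossing_grid => //; exact: rk_ranking.
have c4 : crossing_region z z' (mixz z z').
  by apply: crossing_grid => //; exact: rk_ranking.
have cz' := chamber_convex vz'.
have k1 := chamber_grid (rk z) vz'; have k2 := chamber_grid (rk z') vz'.
have k3 := chamber_self vz'.
rewrite /std_braid nth_rank_permE; last exact: rk_ranking.
rewrite -braid_std // /braid /trail invgM !mulgA; congr (_ * _).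
rewrite -!mulgA; congr (_ * _); rewrite !mulgA.
rewrite -(sgc_triangle cc c3 c1 c2) (sgc_triangle cc c3 c4 c2) -mulgA; congr (_ * _).
by rewrite -(sgcV cz' k3 k2) -(sgc_triangle cz' k1 k3 k2).
Qed.

(** Lifts chosen pointwise within e / 2 are automatically continuous: a nearby lift supplied by
    openness is still within e of z, so [near_unique] identifies it with the chosen one. *)
Lemma lift_path z e (f : I -> X) : valid z -> good_radius z e -> continuous f ->
  (forall t, exists z', [/\ valid z', near (e / 2)%R z z' & Q z' = f t]) ->
  exists F : I -> conf, [/\ forall i, continuous (fun t => F t i),
    forall t, near e z (F t) & forall t, Q (F t) = f t].
Proof.
move=> vz ge cf /choice[F FP]; have [e0 ref _] := ge.
have e2 : (0 < e / 2)%R by rewrite divr_gt0.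
have Fn t : near e z (F t).
  by have [_ n _] := FP t; apply: near_le n; lra.
exists F; split=> [i t||t]; [|exact: Fn|by case: (FP t)].
have [vF nF QF] := FP t.
move=> A /nbhs_ballP[r /= r0 rA]; pose m := Num.min r (e / 2)%R.
have m0 : (0 < m)%R by rewrite lt_min r0.
have op := Q_open vF m0; rewrite QF in op.
suff H : \forall t' \near t, ball (F t i) r (F t' i).
  by apply: filterS H => t' /rA.
have : \forall t' \near t, exists z', [/\ valid z', near m (F t) z' & Q z' = f t']
  by exact: cf t _ op.
apply: filterS => t' [y [vy ny Qy]].
have ny' : near e z y.
  have me : (m <= e / 2)%R by rewrite ge_min lexx orbT.
  by have := near_triangle nF (near_le me ny); rewrite -splitr.
have [vF' _ QF'] := FP t'.
have [s sE] := Q_perm vy vF' (etrans Qy (esym QF')).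
have Fy : F t' = y.
  by have := Fn t'; rewrite sE => nys; exact: near_unique ge ny' nys.
have [n1 n2] := ny i; have mr : (m <= r)%R by rewrite ge_min lexx.
by rewrite Fy; split; rewrite /ball /= distrC; apply: lt_le_trans mr.
Qed.

Lemma path_class_std_braids (S : set (pi1 R b0)) (f : R -> X) : subgroup_set S ->
  (forall j w, (j < 4)%N -> is_perm4 w -> S (std_braid j w)) -> continuous f ->
  S (base_trail (f 0%R) * path_class d (f \o @unitI_val R) * (base_trail (f 1%R))^-1).
Proof.
move=> sS Sb cf; apply: path_class_generated => // t.
have [vz Qz] := chosen_liftP (f t); set z := chosen_lift (f t) in vz Qz.
have [e ge] := good_radius_ex vz; have [e0 ref _] := ge.
have e2 : (0 < e / 2)%R by rewrite divr_gt0.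
have op := Q_open vz e2; rewrite Qz in op.
have /nbhs_ballP[r /= r0 rP] : \forall t' \near t, exists z', [/\ valid z',
  near (e / 2)%R z z' & Q z' = f t'].
  exact: cf t _ op.
exists r => // x y xt ty rx yr.
have [|F [cF nF QF]] := lift_path vz ge (@subpath_continuous R X f x y cf).
  move=> s; apply: rP; have := unitI_val_itv s => s01.
  have : (0 <= (y - x) * unitI_val s <= y - x)%R by nra.
  by rewrite /ball /= ltr_norml => ?; lra.
have vF s : valid (F s) by apply: refines_valid vz _; exact: ref.
have <- : (fun s => Q (F s)) = subpath f x y by exact/funext.
have F0 : Q (F zero) = f x by rewrite QF /subpath unitI_val0 mulr0 addr0.
have F1 : Q (F one) = f y by rewrite QF /subpath unitI_val1 mulr1 addrC subrK.
rewrite -F0 -F1 !base_trailE //.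
have cb := ball_convex vz ge; have nz := nearxx z e0.
rewrite (path_class_sgc cb) // (sgc_triangle cb (nF zero) nz (nF one)) (sgcV cb (nF
  zero) nz).
(* [F zero] and [F one] both refine z but need not refine one another, so the piece is routed
   through z. *)
have k0 := trail_refines vz (ref _ (nF zero)); have k1 :=
  trail_refines vz (ref _ (nF one)).
have -> : trail (F zero) * ((sgc z (F zero))^-1 * sgc z (F one)) * (trail (F one))^-1 =
  (trail z * sgc z (F zero) * (trail (F zero))^-1)^-1 * (trail z * sgc z (F one) *
    (trail (F one))^-1).
  by rewrite ?gnorm.
have mem s : S (std_braid (rk z None) (rank_perm (rk z) (rk (F s)))).
  by apply: Sb; [exact: rk_None_lt | apply: rank_perm_perm4; exact: rk_ranking].
by rewrite k0 k1; apply: subgroup_setM => //; apply: subgroup_setV.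
Qed.

Lemma std_braids_generate (S : set (pi1 R b0)) : subgroup_set S ->
  (forall j w, (j < 4)%N -> is_perm4 w -> S (std_braid j w)) -> forall x, S x.
Proof.
(* The loop represents a conjugate of x chosen so that the trail and [d b0] cancel at the end. *)
move=> sS Sb x; pose k := base_trail b0 * pi1_class (d b0).
pose p : {path I from b0 to b0 in X} := repr (k^-1 * x * k).
have cf : continuous (fun t : R => p (clamp t)).
  by apply: continuous_funcomp (@clamp_continuous R) _; exact: cts_fun.
have := path_class_std_braids sS Sb cf.
rewrite -[clamp 0]/zero -[clamp 1]/one path_zero path_one.
rewrite (_ : _ \o _ = p); last by apply/funext => t; rewrite /= clamp_val.
rewrite path_class_loop pi1_classK.
rewrite (_ : _ * _ = k * (k^-1 * x * k) * k^-1); last by rewrite /k; rewrite ?gnorm.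
by rewrite (_ : k * _ * _ = x) //; rewrite ?gnorm.
Qed.

(** * The local cocycle of a multiplicative function on permutation braids *)

Section Cocycle.
Variables (Gam : groupType) (gt : nat -> seq nat -> Gam).
Hypothesis gtM : forall j w w', (j < 4)%N -> is_perm4 w -> is_perm4 w' ->
  inversions_add w w' -> gt j (perm4_comp w w') = gt j w * gt (nth 0%N w j) w'.
Hypothesis gt_gauge : forall i, (i < 3)%N -> gt i (adj_perm i) = 1.

Definition jump (z z' : conf) : Gam := gt (rk z None) (rank_perm (rk z) (rk z')).

Lemma jumpM z z' z'' : valid z -> valid z' -> valid z'' ->
  additive_ranks (rk z) (rk z') (rk z'') -> jump z z'' = jump z z' * jump z' z''.
Proof.
move=> vz vz' vz'' ad; have r := rk_ranking vz; have r' := rk_ranking vz'; have r'' :=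
  rk_ranking vz''.
rewrite /jump (rank_perm_comp r r' r'') gtM ?nth_rank_permE ?rank_perm_perm4
  ?rk_None_lt //.
exact: rank_perm_add.
Qed.

Lemma jump_eq_rk (z z' y y' : conf) : rk z =1 rk y -> rk z' =1 rk y' ->
  jump z z' = jump y y'.
Proof. by move=> /funext e /funext e'; rewrite /jump e e'. Qed.

Lemma jumpxx z : valid z -> jump z z = 1.
Proof.
by move=> vz; apply: (mulgI (jump z z)); rewrite mulg1 -jumpM.
Qed.

Lemma jump_relabel z z' (s : 'S_3) : valid z -> valid z' ->
  jump (z \o s) (z' \o s) = jump z z'.
Proof.
move=> vz vz'; rewrite /jump rk_relabel; congr gt.
rewrite -(rank_perm_relabel s (rk_ranking vz) (rk_ranking vz')).
by apply: rank_perm_eq => a; rewrite rk_relabel.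
Qed.

(** A pair exchanged between z and z' is strictly separated in height in z', and the second
    refinement keeps this. *)
Lemma refines_additive (z z' z'' : conf) : valid z -> valid z' -> valid z'' ->
  refines z z' -> refines z' z'' -> additive_ranks (rk z) (rk z') (rk z'').
Proof.
move=> vz vz' vz'' ref ref' a c; rewrite !rk_lt // => ac ca.
have [_ h] := refines_inversion ref ac ca.
by rewrite /lexlt ((ref' c a).2 h).
Qed.

Lemma refines_jump (z z' z'' : conf) : valid z -> refines z z' -> refines z' z'' ->
  jump z z'' = jump z z' * jump z' z''.
Proof.
move=> vz ref ref'; have vz' := refines_valid vz ref; have vz'' :=
  refines_valid vz' ref'.
by apply: jumpM => //; exact: refines_additive.
Qed.

Definition lift_radius x : R := xget 1%R [set e | good_radius (chosen_lift x) e].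

Lemma lift_radiusP x : good_radius (chosen_lift x) (lift_radius x).
Proof.
by apply: (@xgetPex _ _ [set e | good_radius (chosen_lift x) e]);
  apply: good_radius_ex; case: (chosen_liftP x).
Qed.

(** By [near_unique] there is at most one such lift; the default is taken when x' is too far from
    x. *)
Definition near_lift x x' : conf :=
  xget (chosen_lift x) [set z' | [/\ valid z',
    near (lift_radius x) (chosen_lift x) z' & Q z' = x']].

Definition cocycle x x' : Gam := jump (chosen_lift x) (near_lift x x').

(** Any labelled lift can replace the chosen one, since they differ by a relabelling and [jump] is
    invariant. *)
Lemma cocycle_near z : valid z -> exists2 e, (0 < e)%R &
  forall z', valid z' -> near e z z' -> cocycle (Q z) (Q z') = jump z z'.
Proof.
move=> vz; set x := Q z; have [vl Ql] := chosen_liftP x; have ge := lift_radiusP x.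
have [s sE] := Q_perm vz vl (esym Ql).
have [e0 ref _] := ge; exists (lift_radius x) => // z' vz' nz'.
have ns : near (lift_radius x) (chosen_lift x) (z' \o s) by rewrite sE;
  exact: near_relabel.
have vs := valid_relabel (s := s) vz'.
suff nlE : near_lift x (Q z') = z' \o s by rewrite /cocycle nlE sE jump_relabel.
rewrite /near_lift; case: xgetP => [y _ [vy ny Qy]|/(_ (z' \o s))[]];
  last by split=> //; exact: Q_permE.
have [t tE] := Q_perm vs vy (etrans (Q_permE s vz') (esym Qy)).
by rewrite tE in ny *; exact: near_unique ge ns ny.
Qed.

Lemma cocycle_diag x : cocycle x x = 1.
Proof.
have [z vz <-] := Q_surj x; have [e e0 H] := cocycle_near vz.
by rewrite H ?jumpxx //; exact: nearxx.
Qed.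

Lemma cocycle_local x : \forall x' \near x, \forall x'' \near x',
  cocycle x x'' = cocycle x x' * cocycle x' x''.
Proof.
have [z vz <-] := Q_surj x; have [e e0 H] := cocycle_near vz.
have [r gr] := good_radius_ex vz; have [r0 ref _] := gr.
pose m := Num.min (e / 2)%R r.
have m0 : (0 < m)%R by rewrite lt_min r0 divr_gt0.
have me : (m <= e / 2)%R by rewrite ge_min lexx.
have mr : (m <= r)%R by rewrite ge_min lexx orbT.
apply: filterS (Q_open vz m0) => x' [z' [vz' nz' <-]].
have [e' e'0 H'] := cocycle_near vz'.
have [r' gr'] := good_radius_ex vz'; have [r'0 ref' _] := gr'.
(* The bound e / 2, imposed on both steps, keeps z'' within e of z. *)
pose m' := Num.min (Num.min e' r') (e / 2)%R.
have m'0 : (0 < m')%R by rewrite !lt_min r'0 e'0 divr_gt0.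
have me' : (m' <= e')%R by rewrite !ge_min lexx.
have mr' : (m' <= r')%R by rewrite !ge_min lexx orbT.
have me2 : (m' <= e / 2)%R by rewrite !ge_min lexx !orbT.
apply: filterS (Q_open vz' m'0) => x'' [z'' [vz'' nz'' <-]].
rewrite H // ?H // ?H' //.
- by apply: refines_jump => //; [apply: ref; exact: near_le nz' | apply: ref';
  exact: near_le nz''].
- exact: near_le nz''.
- by apply: near_le nz'; lra.
- by have := near_triangle (near_le me nz') (near_le me2 nz''); rewrite -splitr.
Qed.

Lemma near_continuous (F : I -> conf) u e : (forall i,
  continuous (fun t => F t i)) -> (0 < e)%R ->
  \forall v \near u, near e (F u) (F v).
Proof.
move=> cF e0.
apply: (@filter_forall I 'I_3 (fun i v => `|(F v i).1 - (F u i).1| < e /\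
  `|(F v i).2 - (F u i).2| < e)%R (nbhs u) _) => i.
have : \forall v \near u, ball (F u i) e (F v i)
  by exact: cF i u _ (nbhsx_ballx _ _ e0).
by apply: filterS => v [h1 h2]; rewrite !(distrC (F v i).1) !(distrC (F v i).2).
Qed.

Lemma parallel_conf (F : I -> conf) (g : I -> Gam) :
  (forall i, continuous (fun t => F t i)) -> (forall t, valid (F t)) ->
  (forall u v, refines (F u) (F v) -> g v = g u * jump (F u) (F v)) ->
  parallel cocycle (fun t => Q (F t)) setT g.
Proof.
move=> cF vF H u _; have [e e0 He] := cocycle_near (vF u).
have [r [r0 ref _]] := good_radius_ex (vF u).
near=> v => _; rewrite He //.
  apply: H; apply: ref; near: v; exact: near_continuous.
by near: v; exact: near_continuous.
Unshelve. all: by end_near.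
Qed.

(** In a slab a pair inverted relative to z is strictly inverted in height, and refinements keep
    this. Hence the jump measured from z is parallel along the whole segment. *)
Lemma holonomy_slab z r : valid z -> ranking r ->
  holonomy cocycle (seg (stz z) (gridz (rk z) r)) = jump z (gridz (rk z) r).
Proof.
move=> vz rr; set y := gridz _ _.
have sF t : slab z (segz (unitI_val t) (stz z) y).
  by apply: (slab_convex vz).2; [exact: unitI_val_itv | exact: slab_grid | exact:
    slab_grid].
have vF t := (slab_convex vz).1 _ (sF t).
rewrite (@holonomyE _ _ _ _ _ (fun t => jump z (segz (unitI_val t) (stz z) y))).
  rewrite unitI_val0 unitI_val1 segz0 segz1 (@jump_eq_rk z (stz z) z z) //; last first.
    by move=> a; rewrite rk_gridz //; exact: rk_ranking.
  by rewrite jumpxx // invg1 mul1g.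
apply: parallel_conf => // [i|u v ref].
  by apply: segz_continuous; exact: unitI_val_continuous.
apply: jumpM => // a c ac; rewrite !rk_lt // => ca.
have := sF u _ _ ac => /= ac1.
have h : (pt (segz (unitI_val u) (stz z) y) c).2 < (pt (segz (unitI_val u) (stz z) y)
  a).2.
  by case/orP: ca => // /andP[_ /lt_trans/(_ ac1)]; rewrite ltxx.
by rewrite /lexlt ((ref c a).2 h).
Qed.

Lemma holonomy_chamber z y y' : valid z -> chamber z y -> chamber z y' ->
  holonomy cocycle (seg y y') = 1.
Proof.
move=> vz cy cy'.
have cF t : chamber z (segz (unitI_val t) y y').
  by apply: (chamber_convex vz).2 => //; exact: unitI_val_itv.
rewrite (@holonomyE _ _ _ _ _ (fun=> 1)) ?invg1 ?mulg1 //.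
apply: parallel_conf => [i|t|u v _].
- by apply: segz_continuous; exact: unitI_val_continuous.
- exact: (chamber_convex vz).1 _ (cF t).
- rewrite mul1g (@jump_eq_rk _ _ z z) ?jumpxx //; by move=> a;
  rewrite (chamber_rk a vz (cF _)).
Qed.

Let Phi := @pi1_holonomy R X Gam cocycle b0.
Let eta (x : X) : Gam := holonomy cocycle (d x).

Let PhiM : {morph Phi : x y / x * y}.
Proof. exact: pi1_holonomyM cocycle_local cocycle_diag _. Qed.

Lemma holonomy_braid z z' : valid z -> valid z' ->
  Phi (braid z z') = eta (Q (stz z)) * jump z z' * (eta (Q (stz z')))^-1.
Proof.
move=> vz vz'; rewrite /braid PhiM /sgc.
have s1 := slab_grid z (rk z); have s2 := slab_grid z (rk z').
have c1 := chamber_grid (rk z) vz'; have c2 := chamber_grid (rk z') vz'.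
have k1 := seg_continuous (slab_convex vz) s1 s2.
have k2 := seg_continuous (chamber_convex vz') c1 c2.
have jE : jump z (gridz (rk z) (rk z')) = jump z z'.
  by apply: jump_eq_rk => a //; apply: rk_gridz; exact: rk_ranking.
have telescope (u v w g : Gam) : u * g * v^-1 * (v * 1 * w^-1) = u * g * w^-1.
  by rewrite ?gnorm.
rewrite /Phi !(pi1_holonomy_path_class _ cocycle_local cocycle_diag) //.
rewrite !seg_zero !seg_one (holonomy_slab vz (rk_ranking vz')) (holonomy_chamber vz'
  c1 c2) jE.
exact: telescope.
Qed.

(** The chains bring both ends back to the standard configuration of position 0, so one conjugating
    factor serves all j and w. *)
Lemma holonomy_std_braid j w : (j < 4)%N -> is_perm4 w ->
  Phi (std_braid j w) = eta (Q (std_conf 0)) * gt j w * (eta (Q (std_conf 0)))^-1.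
Proof.
have B i v : (i < 4)%N -> is_perm4 v -> Phi (braid (std_conf i) (perm_conf i v)) =
    eta (Q (std_conf i)) * gt i v * (eta (Q (std_conf (nth 0%N v i))))^-1.
  move=> i4 pv; have v1 := std_conf_valid i4; have v2 := perm_conf_valid i4 pv.
  have r1 : rk (std_conf i) None = i := rk_std_conf i4 None.
  have r2 : rk (perm_conf i v) None = nth 0%N v i := rk_perm_conf i4 pv None.
  rewrite (holonomy_braid v1 v2) (Q_stz v1) (Q_stz v2) r1 r2.
  congr (_ * _ * _); rewrite /jump r1; congr gt.
  rewrite (@rank_perm_eq _ _ (std_rank i) (perm_rank i v)).
  - by apply: rank_perm_nth => //; exact: std_rankP.
  - exact: rk_std_conf.
  - exact: rk_perm_conf.
have C i : (i < 4)%N -> Phi (chain i) = eta (Q (std_conf 0)) * (eta (Q (std_conf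
  i)))^-1.
  elim: i => [_|i IH i3]; first by rewrite (morph1 PhiM) mulgV.
  have pi : is_perm4 (adj_perm i) by case: i i3 {IH} => [|[|[|]]].
  rewrite -[chain i.+1]/(chain i * braid (std_conf i) (perm_conf i (adj_perm i))).
  rewrite PhiM IH ?(ltnW i3) // B ?(ltnW i3) // gt_gauge //.
  have -> : nth 0%N (adj_perm i) i = i.+1 by case: i i3 {IH pi} => [|[|[|]]].
  have telescope (u v x : Gam) : u * v^-1 * (v * 1 * x^-1) = u * x^-1 by rewrite ?gnorm.
  exact: telescope.
have telescope (u v x g : Gam) : u * v^-1 * (v * g * x^-1) * (u * x^-1)^-1 =
  u * g * u^-1.
  by rewrite ?gnorm.
move=> j4 pw; have j'4 := perm4_lt j4 pw.
rewrite /std_braid PhiM [X in X * _]PhiM (morphV PhiM) (C _ j4) (C _ j'4) (B _ _ j4 pw).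
exact: telescope.
Qed.

End Cocycle.

Lemma derived_quotient_pi1 :
  group_isomorphic (derived_quotient (pi1 R b0) 1) (Algebra.to_multiplicative
    'rV[int]_4).
Proof.
pose gt (j : nat) (w : seq nat) : affine6 * affine6 :=
  (braid_value true j w, braid_value false j w).
have gtM j w w' : (j < 4)%N -> is_perm4 w -> is_perm4 w' -> inversions_add w w' ->
    gt j (perm4_comp w w') = gt j w * gt (nth 0%N w j) w'.
  by move=> j4 pw pw' ad; rewrite /gt !braid_valueM.
have gt_gauge i : (i < 3)%N -> gt i (adj_perm i) = 1.
  by case: i => [|[|[|]]] // _; apply/eqP; vm_compute.
have hol := holonomy_std_braid gtM gt_gauge.
have conjgM' (u x y : affine6 * affine6) : u^-1 * (x * y) * u =
  u^-1 * x * u * (u^-1 * y * u).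
  by rewrite !mulgA mulgK.
have conjgK' (u x : affine6 * affine6) : u^-1 * (u * x * u^-1) * u = x.
  by rewrite !mulgA mulVg mul1g mulgVK.
(* Conjugation by this common factor makes the values equal to [gt], as [derived_quotient_braid]
   requires. *)
set k := holonomy _ _ in hol.
apply: (derived_quotient_braid std_braidM std_braid_gauge std_braids_generate
  (Phi := fun x => k^-1 * @pi1_holonomy R X _ (cocycle gt) b0 x * k)).
- move=> x y; rewrite (pi1_holonomyM (cocycle_local gtM) (cocycle_diag gtM)).
  exact: conjgM'.
- by move=> j w j4 pw; rewrite hol //; exact: conjgK'.
Qed.

End WithBase.

Definition joined (x y : X) := inhabited {path I from x to y in X}.

Lemma joined_sym x y : joined x y -> joined y x.
Proof. by move=> [p]; exact: (inhabits (path_rev p)). Qed.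

Lemma joined_trans x y z : joined x y -> joined y z -> joined x z.
Proof. by move=> [p] [q]; exact: (inhabits (path_cat p q)). Qed.

Lemma joined_seg D z z' : convex_set D -> D z -> D z' -> joined (Q z) (Q z').
Proof.
move=> cD Dz Dz'; pose p : {path I from Q z to Q z' in X} :=
  mk_path (seg_continuous cD Dz Dz') (seg_zero z z') (seg_one z z').
exact: (inhabits p).
Qed.

Lemma joined_stz z z' : valid z -> valid z' -> joined (Q (stz z)) (Q (stz z')).
Proof.
move=> vz vz'.
have s1 := slab_grid z (rk z); have s2 := slab_grid z (rk z').
have c1 := chamber_grid (rk z) vz'; have c2 := chamber_grid (rk z') vz'.
apply: joined_trans (joined_seg (slab_convex vz) s1 s2) _.
exact: (joined_seg (chamber_convex vz') c1 c2).
Qed.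

Lemma path_connected x y : joined x y.
Proof.
have [z vz <-] := Q_surj x; have [z' vz' <-] := Q_surj y.
have J (u : conf) (vu : valid u) : joined (Q u) (Q (stz u)).
  exact: (joined_seg (chamber_convex vu) (chamber_self vu) (chamber_grid (rk u) vu)).
apply: joined_trans (J _ vz) _; apply: joined_trans (joined_sym (J _ vz')).
exact: joined_stz.
Qed.

Theorem derived_quotient_configurations (b0 : X) :
  group_isomorphic (derived_quotient (pi1 R b0) 1) (Algebra.to_multiplicative
    'rV[int]_4).
Proof.
have d x : {path I from b0 to x in X}.
  by apply: (inhabited_witness (path_connected b0 x)).
exact: (derived_quotient_pi1 d).
Qed.

End Core.

Local Open Scope quotient_scope.

Lemma ptws_continuous (T M : topologicalType) (J : Type) (f : T -> {ptws J -> M}) :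
  (forall j, continuous (fun t => f t j)) -> continuous f.
Proof.
move=> cf t; apply/cvg_sup => j A [_ [[B Bop <-] Bft sBA]].
apply: filterS sBA _; exact: cf j t _ (open_nbhs_nbhs (conj Bop Bft)).
Qed.

(** * Unordered configurations of a space homeomorphic to the punctured plane *)

Section PuncturedPlane.
Variables (R : realType) (M : topologicalType) (e : M -> R * R) (phi : R * R -> M).
Hypothesis e_cont : continuous e.
Hypothesis phi_cont : forall p, p <> (0, 0) -> {for p, continuous phi}.
Hypothesis eK : cancel e phi.
Hypothesis phiK : forall p, p <> (0, 0) -> e (phi p) = p.
Hypothesis e_neq0 : forall x, e x <> (0, 0).
Local Notation X := (unordered_config 3 M).
Local Notation conf := ('I_3 -> R * R).

Lemma valid_neq0 (z : conf) i : valid z -> z i <> (0, 0).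
Proof. by move=> vz zi; have := vz (Some i) None zi. Qed.

Lemma valid_config_set (z : conf) : valid z -> config_set (fun i => phi (z i)).
Proof.
move=> vz i j ij /(congr1 e); rewrite !phiK; [|exact: valid_neq0..].
by move=> /(vz (Some i) (Some j))[] ij'; rewrite ij' eqxx in ij.
Qed.

Definition config_of (z : conf) (vz : valid z) : config 3 M :=
  SigSub (mem_set (valid_config_set vz)).

Variable x0 : X.

(** Made total in z so that maps into it carry no validity proofs; [x0] is the value at invalid
    configurations. *)
Definition unordered_of (z : conf) : X :=
  if pselect (valid z) is left vz then \pi_X (config_of vz) else x0.

Lemma unordered_ofE z (vz : valid z) : unordered_of z = \pi_X (config_of vz).
Proof.
rewrite /unordered_of; case: pselect => // vz'.
by congr (\pi_X _); apply: val_inj.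
Qed.

Lemma unordered_of_cont (T : topologicalType) (F : T -> conf) :
  (forall i, continuous (fun t => F t i)) -> (forall t, valid (F t)) ->
  continuous (fun t => unordered_of (F t)).
Proof.
move=> cF vF.
have -> : (fun t => unordered_of (F t)) = fun t => \pi_X (config_of (vF t)).
  by apply/funext => t; exact: unordered_ofE.
apply: (@continuous_funcomp T (config 3 M) X (fun t => config_of (vF t)));
  last exact: pi_continuous.
apply: continuous_comp_initial.
apply: (@ptws_continuous T M 'I_3 (fun t i => phi (F t i))) => i t.
by apply: continuous_comp; [exact: cF | apply: phi_cont; exact: valid_neq0].
Qed.

Lemma piP (x y : config 3 M) : \pi_X x = \pi_X y <->
  exists s : 'S_3, forall i, (\val y : 'I_3 -> M) i = \val x (s i).
Proof. by split=> [/eqmodP/asboolP|h] //; apply/eqmodP/asboolP. Qed.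

Lemma config_of_chart (x : config 3 M) (z : conf) (vz : valid z) (s : 'S_3) :
  (forall i, z i = e ((\val x : 'I_3 -> M) (s i))) -> unordered_of z = \pi_X x.
Proof.
move=> zE; rewrite (unordered_ofE vz); apply/esym/piP; exists s => i.
by rewrite -[LHS]/(phi (z i)) zE eK.
Qed.

Lemma chart_valid (x : config 3 M) (s : 'S_3) : valid (fun i => e ((\val x : 'I_3 ->
  M) (s i))).
Proof.
have xP : config_set (\val x) := set_mem (valP x).
move=> [i|] [j|] //=; last by move/esym/e_neq0.
- have [-> //|ij] := eqVneq i j => /(can_inj eK) xij.
  by case: (xP (s i) (s j)) => //; rewrite (inj_eq perm_inj).
- by move/e_neq0.
Qed.

Arguments chart_valid : clear implicits.

Lemma unordered_of_surj x : exists2 z, valid z & unordered_of z = x.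
Proof.
have v := chart_valid (repr x) 1%g; exists (fun i => e ((\val (repr x) : 'I_3 ->
  M) ((1%g : 'S_3) i))) => //.
by rewrite (config_of_chart v (fun _ => erefl)) reprK.
Qed.

Lemma unordered_of_perm z z' : valid z -> valid z' ->
  unordered_of z = unordered_of z' ->
  exists s : 'S_3, z' = z \o s.
Proof.
move=> vz vz'; rewrite (unordered_ofE vz) (unordered_ofE vz') => /piP[s sE].
exists s; apply/funext => i; have := congr1 e (sE i).
rewrite -[X in e X = _]/(phi (z' i)) -[X in _ = e X]/(phi (z (s i))) !phiK //;
  exact: valid_neq0.
Qed.

Lemma unordered_of_permE z (s : 'S_3) : valid z ->
  unordered_of (z \o s) = unordered_of z.
Proof.
move=> vz; rewrite (unordered_ofE vz) (unordered_ofE (valid_relabel (s := s) vz)).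
by apply/esym/piP; exists s.
Qed.

(** The preimage in the ordered space of the image of a ball is the union of its relabellings; it is
    open, which is openness for the quotient topology. *)
Lemma unordered_of_open z r : valid z -> 0 < r ->
  \forall x \near unordered_of z, exists z', [/\ valid z', near r z z' &
    unordered_of z' = x].
Proof.
move=> vz r0.
pose V : set (config 3 M) := [set y | exists s : 'S_3, near r z (fun i => e ((\val y :
  'I_3 -> M) (s i)))].
pose O : set X := [set x | exists z', [/\ valid z', near r z z' & unordered_of z' = x]].
have VO : \pi_X @^-1` O = V.
  apply/seteqP; split=> y.
    move=> [z' [vz' nz']]; rewrite (unordered_ofE vz') => /esym/piP[s sE].
    exists s => i; rewrite -sE -[\val _ _]/(phi (z' i)) phiK; first exact: nz'.
    exact: valid_neq0.
  move=> [s ns]; exists (fun i => e ((\val y : 'I_3 -> M) (s i))); split=> //.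
    exact: chart_valid.
  by rewrite (config_of_chart (chart_valid y s) (fun _ => erefl)).
have oV : open V.
  rewrite openE => y [s ns].
  suff : \forall y' \near y, near r z (fun i => e ((\val y' : 'I_3 -> M) (s i))).
    by apply: filterS => y' ny'; exists s.
  apply: (@filter_forall (config 3 M) 'I_3 (fun i y' => `|(e ((\val y' : 'I_3 ->
    M) (s i))).1 - (z i).1| < r /\
    `|(e ((\val y' : 'I_3 -> M) (s i))).2 - (z i).2| < r) (nbhs y) _) => i.
  have cy : continuous (fun y' : config 3 M => e ((\val y' : 'I_3 -> M) (s i))).
    apply: continuous_funcomp e_cont.
    apply: (@continuous_funcomp (config 3 M) {ptws 'I_3 ->
      M} M (fun y' => \val y') (fun f => f (s i))).
      exact: initial_continuous.
    exact: (@proj_continuous 'I_3 (fun=> M) (s i)).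
  have ob : open (ball (z i) r : set (R * R)) by exact: ball_open.
  have : \forall y' \near y, ball (z i) r (e ((\val y' : 'I_3 -> M) (s i))).
    apply: cy; apply: open_nbhs_nbhs; split=> //.
    by have [n1 n2] := ns i; split; rewrite /ball /= distrC.
  by apply: filterS => y' [n1 n2]; rewrite !(distrC _ (z i).1) !(distrC _ (z i).2).
have oO : open O by rewrite /open /= /quotient_open VO.
apply: open_nbhs_nbhs; split=> //; exists z; split=> //.
exact: nearxx.
Qed.

Lemma derived_quotient_punctured_plane (b0 : X) :
  group_isomorphic (derived_quotient (pi1 R b0) 1) (Algebra.to_multiplicative
    'rV[int]_4).
Proof.
exact: (derived_quotient_configurations unordered_of_cont unordered_of_surj
  unordered_of_perm unordered_of_permE unordered_of_open).
Qed.

End PuncturedPlane.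

(** * Stereographic projection *)

Lemma row_continuous (R : realType) (T : topologicalType) n (f : T -> 'rV[R]_n) :
  (forall i, continuous (fun t => f t ord0 i)) -> continuous f.
Proof.
move=> cf t A [P fP sPA].
have : \forall t' \near t, forall i, P ord0 i (f t' ord0 i).
  apply: filter_forall => i; exact: cf i t _ (fP ord0 i).
by apply: filterS => t' H; apply: sPA => i j; rewrite (ord1 i); exact: H.
Qed.

Section Stereographic.
Variables (R : realType) (c : 'rV[R]_3) (k : 'I_3).
Hypothesis ck : c ord0 k != 0.
Hypothesis c1 : \sum_(l < 3) c ord0 l ^+ 2 = 1.

Let i : 'I_3 := lift k ord0.
Let j : 'I_3 := lift k ord_max.

Let sum3 (F : 'I_3 -> R) : \sum_l F l = F k + F i + F j.
Proof.
by rewrite (bigD1_ord k) //= !big_ord_recl big_ord0 addr0 addrA;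
  congr (_ + F _ + F _); apply/val_inj.
Qed.

Let coordP (P : 'I_3 -> Prop) : P k -> P i -> P j -> forall l, P l.
Proof.
move=> Pk Pi Pj l; case: (unliftP k l) => [[[|[|//]] m]|] -> //.
  by rewrite (_ : Ordinal m = ord0) //; apply/val_inj.
by rewrite (_ : Ordinal m = ord_max) //; apply/val_inj.
Qed.

Let ik : i == k = false. Proof. by rewrite eq_sym; apply/negbTE/neq_lift. Qed.
Let jk : j == k = false. Proof. by rewrite eq_sym; apply/negbTE/neq_lift. Qed.
Let ji : j == i = false. Proof. by apply/negbTE; rewrite (inj_eq lift_inj). Qed.

Let x := c ord0 i.
Let y := c ord0 j.
Let z := c ord0 k.
Let c1' : z ^+ 2 + x ^+ 2 + y ^+ 2 = 1. Proof. by have := c1; rewrite sum3. Qed.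

Definition sdot (v : 'rV[R]_3) : R := v ord0 k * z + v ord0 i * x + v ord0 j * y.

Lemma sdot_self : sdot c = 1.
Proof. by rewrite /sdot -!expr2. Qed.

(* Stereographic projection from c onto the plane orthogonal to c; that plane is
   coordinatized by forgetting the k-th coordinate, which is possible as c_k <> 0. *)
Definition stereo (v : 'rV[R]_3) : R * R :=
  ((v ord0 i - sdot v * x) / (1 - sdot v), (v ord0 j - sdot v * y) / (1 - sdot v)).

(** The forgotten k-th coordinate, recovered from orthogonality to c. *)
Definition third (p : R * R) : R := - (x * p.1 + y * p.2) / z.
Definition normsq (p : R * R) : R := p.1 ^+ 2 + p.2 ^+ 2 + third p ^+ 2.
Definition unstereo (p : R * R) : 'rV[R]_3 :=
  \row_l ((2 * (if l == k then third p else if l == i then p.1 else p.2)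
           + (normsq p - 1) * c ord0 l) / (normsq p + 1)).

Let thirdE p : x * p.1 + y * p.2 + z * third p = 0.
Proof. by rewrite /third (mulrC z) divfK ?subrr. Qed.

Let normsq1 p : normsq p + 1 != 0.
Proof. by rewrite gt_eqF // ltr_wpDl // !addr_ge0 // sqr_ge0. Qed.

Let unstereo_k p : unstereo p ord0 k = (2 * third p + (normsq p - 1) * z) / (normsq p
  + 1).
Proof. by rewrite mxE eqxx. Qed.
Let unstereo_i p : unstereo p ord0 i = (2 * p.1 + (normsq p - 1) * x) / (normsq p + 1).
Proof. by rewrite mxE ik eqxx. Qed.
Let unstereo_j p : unstereo p ord0 j = (2 * p.2 + (normsq p - 1) * y) / (normsq p + 1).
Proof. by rewrite mxE jk ji. Qed.

Lemma unstereo_sphere p : \sum_(l < 3) unstereo p ord0 l ^+ 2 = 1.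
Proof.
rewrite sum3 unstereo_k unstereo_i unstereo_j.
have := thirdE p; have := normsq1 p; have := c1'; have := erefl (normsq p).
rewrite {1}/normsq; move: (third p) (normsq p) p.1 p.2 => t n a b nE cE n0 tE.
rewrite !expr_div_n -!mulrDl; apply: (canLR (mulfK _)); first by rewrite expf_neq0.
rewrite mul1r.
have -> : (2 * t + (n - 1) * z) ^+ 2 + (2 * a + (n - 1) * x) ^+ 2 + (2 * b + (n - 1)
  * y) ^+ 2
  = 4 * (a ^+ 2 + b ^+ 2 + t ^+ 2) + 4 * (n - 1) * (x * a + y * b + z * t)
    + (n - 1) ^+ 2 * (z ^+ 2 + x ^+ 2 + y ^+ 2) by ring.
by rewrite nE cE tE; ring.
Qed.

Lemma sdot_unstereo p : 1 - sdot (unstereo p) = 2 / (normsq p + 1).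
Proof.
rewrite /sdot unstereo_k unstereo_i unstereo_j.
have := thirdE p; have := normsq1 p; have := c1'.
move: (third p) (normsq p) p.1 p.2 => t n a b cE n0 tE.
have -> : (2 * t + (n - 1) * z) / (n + 1) * z + (2 * a + (n - 1) * x) / (n + 1) * x +
  (2 * b + (n - 1) * y) / (n + 1) * y
  = (2 * (x * a + y * b + z * t) + (n - 1) * (z ^+ 2 + x ^+ 2 + y ^+ 2)) / (n + 1)
    by field.
by rewrite cE tE; field.
Qed.

Lemma sdot_unstereo_neq p : sdot (unstereo p) != 1.
Proof.
apply/eqP => d1; have := sdot_unstereo p; rewrite d1 subrr => /esym/eqP.
by rewrite mulf_eq0 invr_eq0 (negPf (normsq1 p)) orbF pnatr_eq0.
Qed.

Lemma unstereoK p : stereo (unstereo p) = p.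
Proof.
have d := sdot_unstereo p; rewrite /stereo d.
have -> : sdot (unstereo p) = 1 - 2 / (normsq p + 1) by rewrite -d; ring.
rewrite unstereo_i unstereo_j; have n0 := normsq1 p.
by case: p n0 {d} => a b n0; congr (_, _) => /=; field.
Qed.

(** For unit vectors the squared distance from v to c is 2 - 2 [sdot v]. *)
Lemma sdot_eq1 (v : 'rV[R]_3) : \sum_(l < 3) v ord0 l ^+ 2 = 1 -> sdot v = 1 -> v = c.
Proof.
rewrite sum3 /sdot => v1 d1; apply/rowP; apply: coordP.
all: have h : (v ord0 k - z) ^+ 2 + (v ord0 i - x) ^+ 2 + (v ord0 j - y) ^+ 2 = 0
  by have -> : (v ord0 k - z) ^+ 2 + (v ord0 i - x) ^+ 2 + (v ord0 j - y) ^+ 2 =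
    (v ord0 k ^+ 2 + v ord0 i ^+ 2 + v ord0 j ^+ 2) + (z ^+ 2 + x ^+ 2 + y ^+ 2)
    - 2 * (v ord0 k * z + v ord0 i * x + v ord0 j * y) by [ring]; rewrite v1 c1' d1;
      ring.
all: have := sqr_ge0 (v ord0 k - z); have := sqr_ge0 (v ord0 i - x); have :=
  sqr_ge0 (v ord0 j - y).
all: move=> h1 h2 h3; apply/eqP; rewrite -subr_eq0 -sqrf_eq0; apply/eqP;
  rewrite -?/x -?/y -?/z; lra.
Qed.

Lemma stereoK (v : 'rV[R]_3) : \sum_(l < 3) v ord0 l ^+ 2 = 1 -> sdot v != 1 ->
  unstereo (stereo v) = v.
Proof.
move=> v1 d1; have d0 : 1 - sdot v != 0 by rewrite subr_eq0 eq_sym.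
rewrite sum3 in v1.
have tE : third (stereo v) = (v ord0 k - sdot v * z) / (1 - sdot v).
  apply: (mulfI ck); have := thirdE (stereo v); rewrite -/z /stereo /=.
  move=> /eqP; rewrite addrC addr_eq0 => /eqP ->.
  have := erefl (sdot v); rewrite {1}/sdot; have := c1'.
  move: (v ord0 k) (v ord0 i) (v ord0 j) (sdot v) d0 => p q r d d0 cE dE.
  have -> : - (x * ((q - d * x) / (1 - d)) + y * ((r - d * y) / (1 - d))) =
    - ((p * z + q * x + r * y) - p * z - d * (z ^+ 2 + x ^+ 2 + y ^+ 2) + d * z ^+ 2)
      / (1 - d) by field.
  by rewrite cE dE; field.
have nE : normsq (stereo v) + 1 = 2 / (1 - sdot v).
  rewrite /normsq tE /stereo /=.
  have := erefl (sdot v); rewrite {1}/sdot; have := c1'.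
  move: (v ord0 k) (v ord0 i) (v ord0 j) (sdot v) d0 v1 => p q r d d0 v1 cE dE.
  have -> : ((q - d * x) / (1 - d)) ^+ 2 + ((r - d * y) / (1 - d)) ^+ 2 + ((p - d *
    z) / (1 - d)) ^+ 2 =
    ((p ^+ 2 + q ^+ 2 + r ^+ 2) - 2 * d * (p * z + q * x + r * y) + d ^+ 2 * (z ^+ 2
      + x ^+ 2 + y ^+ 2)) / (1 - d) ^+ 2 by field.
  by rewrite cE dE v1; field.
have nE' : normsq (stereo v) - 1 = 2 / (1 - sdot v) - 2 by rewrite -nE; ring.
apply/rowP; apply: coordP.
- by rewrite unstereo_k nE nE' tE -/z; field; rewrite d0.
- by rewrite unstereo_i nE nE' /= -/x; field; rewrite d0.
- by rewrite unstereo_j nE nE' /= -/y; field; rewrite d0.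
Qed.

End Stereographic.

(* On subtypes, [cvgD] and the like fail to find the filter instance of [nbhs];
   hence these versions with an abstract domain. *)
Section ContinuousArithmetic.
Variables (R : realType) (T : topologicalType) (f g : T -> R).
Hypotheses (cf : continuous f) (cg : continuous g).

Lemma continuous_add : continuous (fun t => f t + g t).
Proof. by move=> t; apply: cvgD; [exact: cf | exact: cg]. Qed.

Lemma continuous_sub : continuous (fun t => f t - g t).
Proof. by move=> t; apply: cvgB; [exact: cf | exact: cg]. Qed.

Lemma continuous_mul : continuous (fun t => f t * g t).
Proof. by move=> t; apply: cvgM; [exact: cf | exact: cg]. Qed.

Lemma continuous_inv : (forall t, g t != 0) -> continuous (fun t => (g t)^-1).
Proof. by move=> g0 t; apply: cvgV => //; exact: cg. Qed.

Lemma continuous_const (a : R) : continuous (fun _ : T => a).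
Proof. by move=> t; exact: cvg_cst. Qed.

End ContinuousArithmetic.

(** * A chart of the twice punctured sphere *)

Section PuncturedSphere.
Variables (R : realType) (x1 x2 : sphere2 R) (x12 : x1 <> x2).
Local Notation M := (punctured_sphere2 x1 x2).
Variable m0 : M.
Let c : 'rV[R]_3 := \val x1.
Variable k : 'I_3.
Hypothesis ck : c ord0 k != 0.

Let sphereP (v : sphere2 R) : \sum_(l < 3) (\val v : 'rV[R]_3) ord0 l ^+ 2 = 1.
Proof. exact: set_mem (valP v). Qed.

Let c1 : \sum_(l < 3) c ord0 l ^+ 2 = 1. Proof. exact: sphereP. Qed.

Let coord (x : M) : 'rV[R]_3 := \val (\val x : sphere2 R).

Let sdot_neq (v : sphere2 R) : v <> x1 -> sdot c k (\val v) != 1.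
Proof.
move=> vx; apply/eqP => d; apply: vx; apply/val_inj.
exact: (sdot_eq1 c1 (sphereP v) d).
Qed.

Let coord_neq (x : M) : (\val x : sphere2 R) <> x1 /\ (\val x : sphere2 R) <> x2.
Proof.
by have := set_mem (valP x) => nx; split=> e; apply: nx; [left | right].
Qed.

Let p2 : R * R := stereo c k (\val x2).

(* Stereographic projection from x1, translated so that x2 goes to the origin. *)
Definition punctured_chart (x : M) : R * R :=
  ((stereo c k (coord x)).1 - p2.1, (stereo c k (coord x)).2 - p2.2).

Let back (p : R * R) : sphere2 R :=
  SigSub (mem_set (unstereo_sphere ck c1 (p.1 + p2.1, p.2 + p2.2))).

Let back_neq1 p : back p <> x1.
Proof.
move=> /(congr1 val) e; have := sdot_unstereo_neq ck c1 (p.1 + p2.1, p.2 + p2.2).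
by rewrite [unstereo _ _ _]e (sdot_self k c1) eqxx.
Qed.

Let back_neq2 p : p <> (0, 0) -> back p <> x2.
Proof.
move=> p0 /(congr1 val) e; apply: p0.
have := unstereoK ck c1 (p.1 + p2.1, p.2 + p2.2); rewrite [unstereo _ _ _]e -/p2.
rewrite [p2]surjective_pairing [p]surjective_pairing /= => -[e1 e2]; congr (_, _); lra.
Qed.

Let back_mem p : p <> (0, 0) -> (~` [set x1; x2]) (back p).
Proof. by move=> p0 [/back_neq1//|/(back_neq2 p0)]. Qed.

Definition punctured_param (p : R * R) : M :=
  if pselect (p <> (0, 0)) is left p0 then SigSub (mem_set (back_mem p0)) else m0.

Let paramE p : p <> (0, 0) -> \val (punctured_param p) = back p.
Proof. by rewrite /punctured_param; case: pselect. Qed.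

Let stereo_coordK (x : M) : unstereo c k (stereo c k (coord x)) = coord x.
Proof. by have [n1 _] := coord_neq x; exact: (stereoK ck c1 (sphereP _) (sdot_neq
  n1)). Qed.

Let chart_translate (x : M) :
  ((punctured_chart x).1 + p2.1, (punctured_chart x).2 + p2.2) = stereo c k (coord x).
Proof. by rewrite /punctured_chart; case: (stereo c k (coord x)) => a b /=;
  rewrite !subrK. Qed.

Lemma punctured_chart_neq0 x : punctured_chart x <> (0, 0).
Proof.
move=> e; have [_ n2] := coord_neq x; apply: n2; apply/val_inj.
have xp2 : stereo c k (coord x) = p2.
  by rewrite -chart_translate e [RHS]surjective_pairing; congr (_, _); exact: add0r.
rewrite -[LHS]/(coord x) -stereo_coordK xp2.
by apply: (stereoK ck c1 (sphereP _)); apply: sdot_neq; exact: nesym.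
Qed.

Lemma punctured_chartK : cancel punctured_chart punctured_param.
Proof.
move=> x; apply/val_inj; rewrite paramE; last exact: punctured_chart_neq0.
by apply/val_inj; rewrite -[LHS]/(unstereo _ _ _) chart_translate stereo_coordK.
Qed.

Lemma punctured_paramK p : p <> (0, 0) -> punctured_chart (punctured_param p) = p.
Proof.
move=> p0; rewrite /punctured_chart /coord paramE // -[\val (back p)]/(unstereo _ _
  _) unstereoK //.
by case: p {p0} => a b /=; rewrite !addrK.
Qed.

Lemma punctured_chart_continuous : continuous punctured_chart.
Proof.
have cl l : continuous (fun x : M => coord x ord0 l).
  apply: (@continuous_funcomp M 'rV[R]_3 R coord (fun v => v ord0 l));
    last exact: coord_continuous.
  apply: (@continuous_funcomp M (sphere2 R) 'rV[R]_3 (fun x => \val x) (fun x => \val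
    x));
    exact: initial_continuous.
have cs : continuous (fun x : M => sdot c k (coord x)).
  by do 2?apply: continuous_add; apply: continuous_mul; try exact: continuous_const;
    exact: cl.
have cq l (a b : R) : continuous (fun x : M => (coord x ord0 l - sdot c k (coord x) *
  a) / (1 - sdot c k (coord x)) - b).
  apply: continuous_sub; last exact: continuous_const.
  apply: continuous_mul.
    by apply: continuous_sub; [exact: cl | apply: continuous_mul;
      [exact: cs | exact: continuous_const]].
  apply: continuous_inv; first by apply: continuous_sub;
    [exact: continuous_const | exact: cs].
  by move=> x; rewrite subr_eq0 eq_sym; apply: sdot_neq; case: (coord_neq x).
by apply: continuous_pair; exact: cq.
Qed.

Let back_continuous : continuous back.
Proof.
have n1 (u : R * R -> R) : continuous u -> continuous (fun p => (u p) ^+ 2).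
  by move=> cu; exact: (continuous_mul cu cu).
pose q (p : R * R) := (p.1 + p2.1, p.2 + p2.2).
have c1q : continuous (fun p => (q p).1).
  by apply: continuous_add; [exact: continuous_fst | exact: continuous_const].
have c2q : continuous (fun p => (q p).2).
  by apply: continuous_add; [exact: continuous_snd | exact: continuous_const].
have ct : continuous (fun p => third c k (q p)).
  apply: continuous_mul; last exact: continuous_const.
  move=> p; apply: cvgN; move: p; apply: continuous_add; apply: continuous_mul;
    try exact: continuous_const; [exact: c1q | exact: c2q].
have cn : continuous (fun p => normsq c k (q p)).
  by apply: continuous_add; [apply: continuous_add|]; exact: n1.
apply: continuous_comp_initial; apply: row_continuous => l.
rewrite (_ : (fun p => _) = fun p => (2 * (if l == k then third c k (q p) else
    if l == lift k ord0 then (q p).1 else (q p).2) + (normsq c k (q p) - 1) * c ord0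
      l) / (normsq c k (q p) + 1)).
  apply: continuous_mul; last first.
    apply: continuous_inv; first by apply: continuous_add;
      [exact: cn | exact: continuous_const].
    by move=> p; rewrite gt_eqF // ltr_wpDl // /normsq !addr_ge0 // sqr_ge0.
  apply: continuous_add; apply: continuous_mul; try exact: continuous_const.
    by case: (l == k); [exact: ct | case: (l == lift k ord0);
      [exact: c1q | exact: c2q]].
  by apply: continuous_sub; [exact: cn | exact: continuous_const].
by apply/funext => p; rewrite /= mxE.
Qed.

Lemma punctured_param_continuous p : p <> (0, 0) -> {for p, continuous punctured_param}.
Proof.
move=> p0 A [_ [[W oW <-] Wp sWA]]; apply: filterS sWA _.
have near0 : \forall q \near p, q <> (0, 0).
  have [n1|n2] : p.1 != 0 \/ p.2 != 0.
    apply/orP; rewrite -negb_and; apply/negP => /andP[/eqP e1 /eqP e2]; apply: p0.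
    by rewrite [p]surjective_pairing e1 e2.
  - have nz : nbhs p.1 [set t : R | t != 0].
      by apply: open_nbhs_nbhs; split; [exact: open_neq | exact: n1].
    have : \forall q \near p, q.1 != 0 by exact: (@continuous_fst R R p _ nz).
    by apply: filterS => q /eqP q0 qE; rewrite qE in q0.
  - have nz : nbhs p.2 [set t : R | t != 0].
      by apply: open_nbhs_nbhs; split; [exact: open_neq | exact: n2].
    have : \forall q \near p, q.2 != 0 by exact: (@continuous_snd R R p _ nz).
    by apply: filterS => q /eqP q0 qE; rewrite qE in q0.
have nW : \forall q \near p, W (back q).
  by apply: back_continuous; apply: open_nbhs_nbhs; split=> //; rewrite -paramE.
suff : \forall q \near p, W (\val (punctured_param q)) by [].
by near=> q; rewrite paramE; near: q.
Unshelve. all: by end_near.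
Qed.

End PuncturedSphere.

Theorem proposition11 (R : realType) (x1 x2 : sphere2 R) (x12 : x1 <> x2)
    (b : unordered_config 3 (punctured_sphere2 x1 x2)) :
  group_isomorphic (derived_quotient (braid_group R b) 1)
    (Algebra.to_multiplicative 'rV[int]_4).
Proof.
have [k ck] : exists k, (\val x1 : 'rV[R]_3) ord0 k != 0.
  have := set_mem (valP x1); rewrite /= => x1P.
  have [//|none] := pselect (exists k, (\val x1 : 'rV[R]_3) ord0 k != 0).
  suff : (0 : R) = 1 by move/eqP; rewrite eq_sym oner_eq0.
  rewrite -x1P big1 // => l _; have [->|ne] := eqVneq ((\val x1 : 'rV[R]_3) ord0 l) 0.
    by rewrite expr0n.
  by case: none; exists l.
(* The value of the parametrization at the origin, taken from the base configuration. *)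
have m0 : punctured_sphere2 x1 x2 := (\val (repr b) : 'I_3 ->
  punctured_sphere2 x1 x2) ord0.
apply: (@derived_quotient_punctured_plane R (punctured_sphere2 x1 x2)
  (@punctured_chart R x1 x2 k)
  (@punctured_param R x1 x2 m0 k ck)).
- exact: punctured_chart_continuous.
- exact: punctured_param_continuous.
- exact: punctured_chartK.
- exact: punctured_paramK.
- exact: (punctured_chart_neq0 x12 ck).
- exact: b.
Qed.
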